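(* Let $D_0=1$ and $D_n=(2n-1)!!=(2n-1)(2n-3)\cdots3\cdot1$ for $n\ge1$. Then: (a) $\{D_n\}_{n=0}^\infty$ is an infinitely divisible Stieltjes moment sequence. (b) For real $c>0$, the power sequence $\{D_n^c\}_{n=0}^\infty$ is Stieltjes determinate if and only if $c\le 2$. (c) For each real $c\in(0,2]$, the (unique) measure $\mu_c$ on $[0,\infty)$ with moment sequence $\{D_n^c\}_{n=0}^\infty$ has Mellin transform $$\int_0^\infty t^s\,d\mu_c(t)=\left(\frac{2^s}{\sqrt{\pi}}\Gamma(s+1/2)\right)^c=\left(\frac{1}{2^s}\cdot\frac{\Gamma(2s+1)}{\Gamma(s+1)}\right)^c,\quad s\ge0.$$
   Context: A real sequence $\{m_n\}_{n=0}^\infty$ is a Stieltjes moment sequence if there is a nonnegative measure $\mu$ on $[0,\infty)$ with $m_n=\int_{[0,\infty)}x^n\,d\mu(x)$ for all $n\ge0$; it is Stieltjes determinate if such $\mu$ is unique. A Stieltjes moment sequence $\{m_n\}$ is infinitely divisible (in the sense of Tyan) if $\{m_n^c\}_{n=0}^\infty$ is a Stieltjes moment sequence for every real $c>0$. *)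

(* Defs.v *)
From HB Require Import structures.
From mathcomp Require Import all_boot all_order all_algebra.
From mathcomp Require Import all_classical all_reals all_analysis.
Import Order.TTheory GRing.Theory Num.Theory.
Import numFieldNormedType.Exports.

Set Implicit Arguments.
Unset Strict Implicit.
Unset Printing Implicit Defensive.

Local Open Scope classical_set_scope.
Local Open Scope ring_scope.

(* A measure on [0, +oo) is encoded as a Borel measure on the real line that
   is null off [0, +oo). Finiteness is not assumed: it follows from the
   moment of order 0. *)
Definition has_stieltjes_moments (R : realType)
    (mu : {measure set (measurableTypeR R) -> \bar R}) (m : nat -> R) : Prop :=
  mu (~` `[0, +oo[) = 0%E /\
  forall n, (\int[mu]_(x in `[0%R, +oo[) (x ^+ n)%:E = (m n)%:E)%E.

Definition stieltjes_moment_seq (R : realType) (m : nat -> R) : Prop :=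
  exists mu : {measure set (measurableTypeR R) -> \bar R},
    has_stieltjes_moments mu m.

Definition stieltjes_determinate (R : realType) (m : nat -> R) : Prop :=
  stieltjes_moment_seq m /\
  forall mu nu : {measure set (measurableTypeR R) -> \bar R},
    has_stieltjes_moments mu m -> has_stieltjes_moments nu m ->
    forall A : set (measurableTypeR R), measurable A -> mu A = nu A.

(* Moments are nonnegative, so [powR] is only applied to nonnegative bases,
   with 0 `^ c = 0 since c > 0. *)
Definition infinitely_divisible (R : realType) (m : nat -> R) : Prop :=
  stieltjes_moment_seq m /\
  forall c : R, 0 < c -> stieltjes_moment_seq (fun n => m n `^ c).

(* Euler's integral; as the real part of an extended-real integral, it is the
   Gamma function for 0 < x only. *)
Definition Gamma (R : realType) (x : R) : R :=
  \int[@lebesgue_measure R]_(t in `]0, +oo[) (t `^ (x - 1) * expR (- t)).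

(* (2n - 1)!!, with value 1 at n = 0 *)
Definition odd_double_fact (n : nat) : nat :=
  (\prod_(1 <= k < n.+1) (2 * k - 1))%N.

(* Main.v *)
Require Import Defs.
From HB Require Import structures.
From mathcomp Require Import all_boot all_order all_algebra.
From mathcomp Require Import all_classical all_reals all_analysis.
From mathcomp Require Import measurable_realfun ring lra zify.
Import Order.TTheory GRing.Theory Num.Theory.
Import numFieldNormedType.Exports.
Local Open Scope classical_set_scope.
Local Open Scope ring_scope.

(* Write M(s) = 2^s Gamma(s + 1/2) / sqrt pi, so that M(n) = (2n - 1)!!.

   Existence: Gauss's product writes M(s)^c as a limit of products of factors
   r^s (a / (s + a))^c. Such a factor is the Mellin transform of a scaled
   exp(- G / a) with G Gamma(c)-distributed, and Mellin transforms of probability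
   laws on [0, oo) are stable under products (independence) and pointwise limits
   (Helly's selection applied to quantile functions). The same uniqueness
   argument a la Bohr-Mollerup gives Legendre's duplication formula.

   Determinacy for c <= 2: then the moments are at most (2n)!, so bounded
   functions G with equal integrals of G x^k, for all k, under two solutions are
   stable under multiplication by cos(u sqrt x) for small u. As
   cos(t sqrt x / sqrt N)^N tends to exp(- t^2 x / 2), and
   (1 - exp(- N a x))^(N 2^N) to the indicator of x > ln 2 / a, the two solutions
   agree on half-lines.

   Indeterminacy for c > 2: let Y have Mellin transform M^(c - 1) and Z be
   standard normal. The law of Y Z^2 has moments M(n)^c and, up to an atom at 0,
   a density f. An affine minorant in the moments of Y gives
   f(x) >= d exp(- k x^(1/c)). With a = 1/c < 1/2, the function
   h(x) = exp(- K x^a cos(a pi)) sin(K x^a sin(a pi)) has vanishing moments: its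
   moments are the values at th = a pi of integrals that depend on an angle th,
   have zero derivative in th and vanish at th = 0. So f and f + d h, for
   K = k / cos(a pi), are two solutions. *)

Set Implicit Arguments.
Unset Strict Implicit.
Unset Printing Implicit Defensive.

(** * Improper integrals and the Gamma function *)

(** The exponent 2 is critical because, up to geometric factors, the moments grow like (n!)^c. Up to
    (2n)! the series of cos (u sqrt x) can be integrated term by term, but only for small u; this is
    why large frequencies enter only as high powers of cosines of small argument. Beyond it, a
    density with these moments can be kept above a multiple of exp (- k x^(1/c)) with 1/c < 1/2,
    which leaves room for an oscillating function with vanishing moments. The law of Y is known only
    through its moments, and nothing prevents it from charging 0. Splitting off one factor Z^2
    supplies an explicit kernel, so that the lower bound for the density becomes an inequality
    between moments of Y. Limits of laws are taken on decreasing quantile functions over ]0, 1[: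
    selection is then a fact about monotone functions, and Markov's inequality provides the
    domination. The Mellin transform in the last claim is not computed from the moments: it is known
    for the measure constructed, and uniqueness carries it over to any solution. *)

Section improper_FTC.
Context {R : realType}.
Local Notation leb := (@lebesgue_measure R).
Implicit Types (f F : R -> R) (l : R).

Lemma measurable_oy_continuous f :
  (forall x : R, 0 < x -> {for x, continuous f}) -> measurable_fun (`]0%R, +oo[%classic : set R) f.
Proof.
move=> cf; apply: open_continuous_measurable_fun => //.
by move=> x; rewrite inE/= in_itv/= andbT; exact: cf.
Qed.

Lemma itv_oy_bigcup : `]0%R, +oo[%classic =
  \bigcup_n (`[(n.+1%:R^-1 : R), +oo[%classic).
Proof.
apply/seteqP; split => x /=; rewrite in_itv/= andbT.
  move=> x0; exists (Num.truncn x^-1) => //=.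
  rewrite in_itv/= andbT invf_ple ?posrE//.
  by rewrite ltW// truncnS_gt// ltW// invr_gt0.
by move=> [n _] /=; rewrite in_itv/= andbT; apply: lt_le_trans.
Qed.

(** Monotone convergence along the half-lines [[1 / (n + 1), +oo[]. Only the limits of the primitive
    at both ends enter, since the integrand may blow up at 0. *)
Lemma ge0_FTC_oy f F l0 l1 :
  (forall x : R, 0 < x -> {for x, continuous f}) ->
  (forall x : R, 0 < x -> 0 <= f x) ->
  (forall x : R, 0 < x -> is_derive x 1 F (f x)) ->
  F x @[x --> 0^'+] --> l0 -> F x @[x --> +oo] --> l1 ->
  (\int[leb]_(x in `]0%R, +oo[) (f x)%:E = (l1 - l0)%:E)%E.
Proof.
move=> cf f0 dF F0 F1.
have e0 n : 0 < n.+1%:R^-1 :> R by rewrite invr_gt0.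
have cF (x : R) : 0 < x -> {for x, continuous F}.
  by move=> x0; apply/differentiable_continuous/derivable1_diffP; case: (dF _ x0).
have step n : (\int[leb]_(x in `[(n.+1%:R^-1 : R)%R, +oo[) (f x)%:E =
    (l1 - F n.+1%:R^-1)%:E)%E.
  rewrite (@ge0_continuous_FTC2y _ f F _ l1)//.
  - by move=> x nx; apply: f0; apply: lt_le_trans nx.
  - apply/continuous_within_itvcyP; split.
      move=> x; rewrite in_itv/= andbT => nx; apply: cf.
      by apply: lt_trans nx.
    by apply: cvg_at_right_filter; exact: cf.
  - by move=> x nx; have [] := dF x (lt_trans (e0 n) nx).
  - by apply: cvg_at_right_filter; exact: cF.
  - move=> x; rewrite in_itv/= andbT => nx; rewrite derive1E.
    by have [_ ->] := dF x (lt_trans (e0 n) nx).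
rewrite itv_oy_bigcup.
have nd : nondecreasing_seq (fun n => `[(n.+1%:R^-1 : R), +oo[%classic).
  move=> m n mn; apply/subsetPset => x /=; rewrite !in_itv/= !andbT.
  by apply: le_trans; rewrite lef_pV2 ?posrE// ler_nat ltnS.
have mf n : measurable_fun (`[(n.+1%:R^-1 : R), +oo[%classic : set R) (EFin \o f).
  apply/measurable_EFinP.
  apply: measurable_funS (measurable_oy_continuous cf) => //.
  by move=> x /=; rewrite !in_itv/= !andbT; apply: lt_le_trans.
have := @ge0_nondecreasing_set_cvg_integral _ (measurableTypeR R) R _
  (EFin \o f) leb nd (fun=> measurable_itv _) mf.
have f0' (n : nat) (x : R) : `[n.+1%:R^-1, +oo[%classic x -> (0 <= (EFin \o f) x)%E.
  rewrite /= in_itv/= andbT => nx; rewrite lee_fin f0//.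
  exact: lt_le_trans nx.
move=> /(_ f0'); under eq_fun do rewrite step.
move=> /cvg_unique; apply => //.
apply: cvg_EFin; first exact: nearW.
apply: cvgB; first exact: cvg_cst.
move/cvg_at_rightP : F0; apply; split => //.
exact: cvg_harmonic.
Qed.

(** For integrands of varying sign, dominated convergence takes the place of monotone
    convergence. *)
Lemma integrable_FTC_oy f F l0 l1 :
  leb.-integrable `]0%R, +oo[%classic (EFin \o f) ->
  (forall x : R, 0 < x -> {for x, continuous f}) ->
  (forall x : R, 0 < x -> is_derive x 1 F (f x)) ->
  F x @[x --> 0^'+] --> l0 -> F x @[x --> +oo] --> l1 ->
  (\int[leb]_(x in `]0%R, +oo[) (f x)%:E = (l1 - l0)%:E)%E.
Proof.
move=> intf cf dF F0 F1.
(* The shift by 2 keeps the left endpoint strictly below the right one already at n = 0. *)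
pose I n := `[n.+2%:R^-1 : R, n.+2%:R]%classic.
have e0 n : 0 < n.+2%:R^-1 :> R by rewrite invr_gt0.
have lt1 n : n.+2%:R^-1 < n.+2%:R :> R.
  by rewrite (@lt_trans _ _ 1)// ?invf_lt1// ltr1n.
have Isub n : I n `<=` `]0%R, +oo[%classic.
  by move=> x /=; rewrite !in_itv/= andbT => /andP[+ _]; exact: lt_le_trans (e0 n).
have cF (x : R) : 0 < x -> {for x, continuous F}.
  by move=> x0; apply/differentiable_continuous/derivable1_diffP; case: (dF _ x0).
have step n : (\int[leb]_(x in I n) (f x)%:E =
    (F n.+2%:R - F n.+2%:R^-1)%:E)%E.
  rewrite (@continuous_FTC2 _ f F)//.
  - apply: continuous_in_subspaceT => x; rewrite inE => /Isub/=.
    by rewrite in_itv/= andbT; exact: cf.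
  - split.
    + move=> x; rewrite in_itv/= => /andP[nx _].
      by have [] := dF x (lt_trans (e0 n) nx).
    + by apply: cvg_at_right_filter; exact: cF.
    + by apply: cvg_at_left_filter; exact: cF.
  - move=> x; rewrite in_itv/= => /andP[nx _]; rewrite derive1E.
    by have [_ ->] := dF x (lt_trans (e0 n) nx).
pose D : set (measurableTypeR R) := `]0%R, +oo[%classic.
have mD : measurable D by exact: measurable_itv.
have mI n : measurable (I n : set (measurableTypeR R)) by exact: measurable_itv.
have mf : measurable_fun D (EFin \o f) by exact: measurable_int intf.
pose fn n := (EFin \o f) \_ (I n).
have mfn n : measurable_fun D (fn n).
  apply/(measurable_restrict (EFin \o f) (mI n) mD).
  by apply: measurable_funS mf => //; exact: subIsetl.
have fnE n : (\int[leb]_(x in `]0%R, +oo[) fn n x = (F n.+2%:R - F n.+2%:R^-1)%:E)%E.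
  rewrite -step [in RHS]integral_mkcond/= -/(fn n) integral_mkcond/= /fn.
  by rewrite -patch_setI setIidr//.
have [] := @dominated_convergence _ _ _ leb D mD fn (EFin \o f)
  (abse \o (EFin \o f)) mfn mf.
- apply: aeW => x /=; rewrite /D/= in_itv/= andbT => x0.
  apply: cvg_near_cst; near=> n; rewrite /fn patchE mem_set//=.
  rewrite /I/= in_itv/=; apply/andP; split.
    rewrite invf_ple ?posrE//; near: n.
    have := nbhs_infty_ger (x^-1); apply: filterS => n /le_trans; apply.
    by rewrite ler_nat -addn2 leq_addr.
  near: n; have := nbhs_infty_ger x; apply: filterS => n /le_trans; apply.
  by rewrite ler_nat -addn2 leq_addr.
- exact: integrable_abse.
- apply: aeW => x n _; rewrite /fn patchE; case: ifPn => //= _.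
  by rewrite normr0 lee_fin.
move=> _ _; rewrite /D; under eq_fun do rewrite fnE.
move=> /(cvg_unique _); apply => //.
apply: cvg_EFin; first exact: nearW.
have n2 : (n.+2%:R : R) @[n --> \oo] --> +oo.
  have := @cvgr_idn R; rewrite -(cvg_shiftn 2)/=.
  by under eq_fun do rewrite addn2.
apply: cvgB; first exact: cvg_comp n2 F1.
move/cvg_at_rightP : F0; apply; split => //.
have := @cvg_harmonic R; rewrite -(cvg_shiftn 1) /harmonic/=.
by under eq_fun do rewrite addn1.
Unshelve. all: by end_near. Qed.

End improper_FTC.

(** * Bounds on powers and a common majorant on the half-line *)

Section powR_bounds.
Context {R : realType}.
Implicit Types (p e t x s : R).

(** With t = (p / e) w this is w <= exp w raised to the power p. *)
Lemma powR_le_expR p e t : 0 < p -> 0 < e -> 0 <= t ->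
  t `^ p <= (p / e) `^ p * expR (e * t).
Proof.
move=> p0 e0 t0; have q0 : 0 <= p / e by rewrite divr_ge0// ltW.
have -> : t = (p / e) * (e * t / p) by field; rewrite !gt_eqF.
rewrite powRM//; last by rewrite divr_ge0 ?mulr_ge0// ltW.
rewrite ler_wpM2l ?powR_ge0//.
have -> : e * (p / e * (e * t / p)) = (e * t / p) * p by field; rewrite !gt_eqF.
rewrite expRM; apply: ge0_ler_powR; rewrite ?nnegrE ?expR_ge0 ?(ltW p0)//.
  by rewrite divr_ge0 ?mulr_ge0// ltW.
by rewrite (le_trans _ (expR_ge1Dx _))// lerDr.
Qed.

(** Weighted arithmetic-geometric mean inequality for v and 1: Young's inequality with the exponents
    1 / s and 1 / (1 - s). *)
Lemma powR_Young v s : 0 <= v -> 0 <= s <= 1 -> v `^ s <= 1 - s + s * v.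
Proof.
move=> v0 /andP[]; rewrite le_eqVlt => /predU1P[<- _|s0].
  by rewrite powRr0 mul0r addr0 subr0.
rewrite le_eqVlt => /predU1P[->|s1]; first by rewrite powRr1// subrr add0r mul1r.
have := @conjugate_powR _ (v `^ s) 1 s^-1 (1 - s)^-1.
rewrite !invrK mulr1 -powRrM divff ?gt_eqF// powRr1// powR1 mul1r => H.
rewrite (addrC (1 - s)) (mulrC s); apply: H.
- exact: powR_ge0.
- exact: ler01.
- by rewrite invr_gt0.
- by rewrite invr_gt0 subr_gt0.
- by rewrite addrC subrK.
Qed.

Lemma continuous_powR p t : 0 < t -> {for t, continuous (fun u : R => u `^ p)}.
Proof.
move=> t0; apply/differentiable_continuous/derivable1_diffP.
by apply: derivable_powR; rewrite in_itv/= t0.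
Qed.

End powR_bounds.

Section integrable_oy.
Context {R : realType}.
Local Notation leb := (@lebesgue_measure R).

(** The integrand is the derivative of (t / (1 + t))^p. It serves as the majorant for integrability
    on the half-line, being of order t^(p - 1) at 0 and t^(- 2) at infinity. *)
Lemma integral_powR_ratio (p : R) : 0 < p ->
  (\int[leb]_(t in `]0%R, +oo[)
    (p * (t `^ (p - 1) * (1 + t) `^ (- p - 1)))%:E = 1)%E.
Proof.
move=> p0; rewrite -[1%E]/(1%:E) -[1 in RHS]subr0.
have d1 (t : R) : 0 < t -> 0 < 1 + t by move=> ?; rewrite addr_gt0.
have cD (q t : R) : 0 < t -> {for t, continuous (fun x : R => (1 + x) `^ q)}.
  move=> t0; apply: (@continuous_comp _ _ _ (fun x : R => 1 + x) (fun x : R => x `^ q)).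
    by apply: cvgD; [exact: cvg_cst|exact: cvg_id].
  by apply: continuous_powR; exact: d1.
apply: (@ge0_FTC_oy _ _ (fun t => (1 - (1 + t) `^ (-1)) `^ p)).
- move=> t t0; apply: cvgM; first exact: cvg_cst.
  by apply: cvgM; [exact: continuous_powR|exact: cD].
- by move=> t t0; rewrite mulr_ge0 ?(ltW p0)// mulr_ge0 ?powR_ge0.
- move=> t t0.
  have n0 : 1 + t != 0 by rewrite gt_eqF// d1.
  have q0 : 0 < 1 - (1 + t) `^ (-1).
    by rewrite powR_inv1 ?(ltW (d1 _ t0))// subr_gt0 invf_lt1 ?d1// ltrDl.
  have D1 : is_derive t 1 (fun t : R => 1 + t) 1.
    have := is_deriveD (is_derive_cst (1 : R) t 1) (is_derive_id t (1 : R)).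
    by rewrite add0r.
  have D2 := is_derive1_comp (is_derive1_powR (- 1) (d1 _ t0)) D1.
  have D3 : is_derive t 1 (fun t : R => 1 - (1 + t) `^ (-1)) ((1 + t) `^ (- 1 - 1)).
    have := is_deriveB (is_derive_cst (1 : R) t 1) D2.
    by rewrite mulr1 mulN1r sub0r opprK.
  have H := @is_derive1_comp _ (fun u : R => u `^ p)
    (fun t : R => 1 - (1 + t) `^ (-1)) t _ _ (is_derive1_powR p q0) D3.
  apply: (is_derive_eq H).
  have -> : 1 - (1 + t) `^ (-1) = t * (1 + t) `^ (-1).
    by rewrite powR_inv1 ?(ltW (d1 _ t0))//; field.
  rewrite powRM ?powR_ge0 ?(ltW t0)// -powRrM -!mulrA -powRD ?n0 ?implybT//.
  by congr (_ * (_ * _ `^ _)); ring.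
- apply: (@squeeze_cvgr _ _ _ _ (cst 0) (fun t : R => t `^ p)).
  + near=> t; have t0 : 0 < t by near: t; exact: nbhs_right_gt.
    rewrite powR_ge0/= ge0_ler_powR ?(ltW p0) ?nnegrE ?(ltW t0)//.
      by rewrite powR_inv1 ?(ltW (d1 _ t0))// subr_ge0 invf_le1 ?d1// lerDl ltW.
    rewrite powR_inv1 ?(ltW (d1 _ t0))// -subr_ge0.
    have -> : t - (1 - (1 + t)^-1) = t ^+ 2 / (1 + t) by field; rewrite gt_eqF ?d1.
    by rewrite divr_ge0 ?sqr_ge0// ltW// d1.
  + exact: cvg_cst.
  + exact: powR_cvg0.
- have E : 1 = (1 - 0) `^ p :> R by rewrite subr0 powR1.
  rewrite [X in _ --> X]E.
  apply: (@cvg_comp _ _ _ (fun t : R => 1 - (1 + t) `^ (-1)) (fun x : R => x `^ p)); last first.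
    by apply: continuous_powR; rewrite subr0.
  apply: cvgB; first exact: cvg_cst.
  apply: (@cvg_trans _ ((1 + t : R)^-1 @[t --> +oo])).
    apply: near_eq_cvg; near=> t.
    have t0 : 0 < t by near: t; exact: nbhs_pinfty_gt.
    by rewrite powR_inv1// ltW// d1.
  apply/gtr0_cvgV0; last exact: cvg_addrl.
  near=> t.
  have t0 : 0 < t by near: t; exact: nbhs_pinfty_gt.
  by rewrite d1.
Unshelve. all: by end_near. Qed.

Lemma integrable_oy (f : R -> R) (p C : R) : 0 < p ->
  (forall x : R, 0 < x -> {for x, continuous f}) ->
  (forall x : R, 0 < x -> `|f x| <= C * (x `^ (p - 1) * (1 + x) `^ (- p - 1))) ->
  leb.-integrable `]0%R, +oo[%classic (EFin \o f).
Proof.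
move=> p0 cf fC.
pose g x := C * (x `^ (p - 1) * (1 + x) `^ (- p - 1)).
pose D : set (measurableTypeR R) := `]0%R, +oo[%classic.
have mD : measurable D by exact: measurable_itv.
have mh : measurable_fun D (fun x : R => p * (x `^ (p - 1) * (1 + x) `^ (- p - 1))).
  apply: measurable_funTS; apply: measurable_funM => //.
  apply: measurable_funM => //.
  apply: (@measurableT_comp _ _ _ _ _ _ (fun u : R => u `^ (- p - 1)) _
    (fun x : R => 1 + x)); first exact: measurable_powR.
  exact: measurable_funD.
have ih : leb.-integrable D (fun x => (p * (x `^ (p - 1) * (1 + x) `^ (- p - 1)))%:E).
  apply/integrableP; split; first exact/measurable_EFinP.
  under eq_integral => x xD.
    rewrite gee0_abs; last first.
      by rewrite lee_fin !mulr_ge0 ?powR_ge0// ltW.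
    over.
  by rewrite integral_powR_ratio// ltry.
have ig : leb.-integrable D
    (fun x => ((C / p)%:E * (p * (x `^ (p - 1) * (1 + x) `^ (- p - 1)))%:E)%E).
  exact: integrableZl.
apply: le_integrable ig => //.
  by apply/measurable_EFinP; exact: measurable_oy_continuous cf.
move=> x; rewrite /D /= in_itv/= andbT => x0; rewrite lee_fin.
apply: le_trans (fC _ x0) _.
have -> : C / p * (p * (x `^ (p - 1) * (1 + x) `^ (- p - 1))) =
    C * (x `^ (p - 1) * (1 + x) `^ (- p - 1)) by field; rewrite gt_eqF.
exact: ler_norm.
Qed.

End integrable_oy.

Lemma integral_neq0 d (T : measurableType d) (R : realType)
    (mu : {measure set T -> \bar R}) (D : set T) (f : T -> R) :
  measurable D -> measurable_fun D f -> (forall x, D x -> 0 < f x) ->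
  mu D != 0%E -> (\int[mu]_(x in D) (f x)%:E)%E != 0%E.
Proof.
move=> mD mf f0 muD; apply/eqP => int0; move/eqP: muD; apply.
have mEf : measurable_fun D (EFin \o f) by exact/measurable_EFinP.
have /(ae_eq_integral_abs mu mD mEf) [N [mN N0 DN]] :
    (\int[mu]_(x in D) `|(EFin \o f) x|)%E = 0%E.
  rewrite -[RHS]int0; apply: eq_integral => x; rewrite inE => Dx.
  by rewrite gee0_abs// lee_fin ltW// f0.
apply: (subset_measure0 mD mN _ N0) => x Dx; apply: DN => /= /(_ Dx) [fx0].
by have := f0 _ Dx; rewrite fx0 ltxx.
Qed.

(** * Euler's integral: recurrence, positivity, Wendel's inequality *)

Section Gamma_function.
Context {R : realType}.
Local Notation leb := (@lebesgue_measure R).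
Implicit Types (x s t : R).

Lemma integrable_powR_expR x e : 0 < x -> 0 < e ->
  leb.-integrable `]0%R, +oo[%classic
    (fun t => (t `^ (x - 1) * expR (- (e * t)))%:E).
Proof.
move=> x0 e0; apply: (@integrable_oy _ (fun t => t `^ (x - 1) * expR (- (e * t))) x
   (((x + 1) / e) `^ (x + 1) * expR e)) => //.
  move=> t t0; apply: cvgM; first exact: continuous_powR.
  apply: (@continuous_comp _ _ _ (fun u : R => - (e * u)) (@expR R)).
    by apply: cvgN; apply: cvgM; [exact: cvg_cst|exact: cvg_id].
  exact: continuous_expR.
move=> t t0; rewrite ger0_norm ?mulr_ge0 ?powR_ge0 ?expR_ge0//.
have t1 : 0 < 1 + t by rewrite addr_gt0.
rewrite [leRHS]mulrCA ler_wpM2l ?powR_ge0//.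
have -> : - x - 1 = - (x + 1) by ring.
rewrite powRN ler_pdivlMr ?powR_gt0// mulrC.
have := @powR_le_expR _ (x + 1) e (1 + t) _ e0 (ltW t1).
rewrite addr_gt0// => /(_ isT) /(ler_wpM2r (expR_ge0 (- (e * t)))).
move=> /le_trans; apply.
by rewrite -!mulrA -!expRD mulrDr mulr1 addrK.
Qed.

Lemma integrable_Gamma x : 0 < x ->
  leb.-integrable `]0%R, +oo[%classic (fun t => (t `^ (x - 1) * expR (- t))%:E).
Proof.
move=> x0; have := integrable_powR_expR x0 ltr01.
by congr (integrable _ _ _); apply/funext => t; rewrite mul1r.
Qed.

Lemma GammaE x : 0 < x ->
  (\int[leb]_(t in `]0%R, +oo[) (t `^ (x - 1) * expR (- t))%:E = (Gamma x)%:E)%E.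
Proof.
move=> x0; rewrite /Gamma /Rintegral fineK//.
exact: integrable_fin_num (integrable_Gamma x0).
Qed.

Lemma powR_expR_cvgy0 x : 0 < x -> t `^ x * expR (- t) @[t --> +oo] --> (0 : R).
Proof.
move=> x0; have h0 : 0 < 2^-1 :> R by rewrite invr_gt0.
pose C : R := (x / 2^-1) `^ x.
apply: (@squeeze_cvgr _ _ _ _ (cst 0) (fun t => C * expR (- (t * 2^-1)))).
- near=> t; have t0 : 0 < t by near: t; exact: nbhs_pinfty_gt.
  rewrite mulr_ge0 ?powR_ge0 ?expR_ge0//=.
  have := powR_le_expR x0 h0 (ltW t0).
  move=> /(ler_wpM2r (expR_ge0 (- t))) /le_trans; apply.
  rewrite -mulrA -expRD; have -> // : 2^-1 * t + - t = - (t * 2^-1) by field.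
- exact: cvg_cst.
- rewrite -[X in _ --> X](mulr0 C); apply: cvgM; first exact: cvg_cst.
  apply: (cvg_comp (fun t : R => t * 2^-1) (fun t => expR (- t))); last first.
    exact: cvgr_expR.
  exact: (gt0_cvgMly h0 (@cvg_id _ _)).
Unshelve. all: by end_near. Qed.

Lemma powR_expR_cvg00 x : 0 < x -> t `^ x * expR (- t) @[t --> 0^'+] --> (0 : R).
Proof.
move=> x0; apply: (@squeeze_cvgr _ _ _ _ (cst 0) (fun t => t `^ x)).
- near=> t; have t0 : 0 < t by near: t; exact: nbhs_right_gt.
  rewrite mulr_ge0 ?powR_ge0 ?expR_ge0//= ler_piMr ?powR_ge0//.
  by rewrite expR_le1 oppr_le0 ltW.
- exact: cvg_cst.
- exact: powR_cvg0.
Unshelve. all: by end_near. Qed.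

Lemma continuous_powR_expR x t : 0 < t ->
  {for t, continuous (fun t => t `^ x * expR (- t))}.
Proof.
move=> t0; apply: cvgM; first exact: continuous_powR.
apply: (@continuous_comp _ _ _ (fun u : R => - u) (@expR R)).
  by apply: cvgN; exact: cvg_id.
exact: continuous_expR.
Qed.

(** Integration by parts: t^x exp (- t) is a primitive of the difference of the two integrands and
    vanishes at both ends. *)
Lemma Gamma_recurrence x : 0 < x -> Gamma (x + 1) = x * Gamma x.
Proof.
move=> x0; have x10 : 0 < x + 1 by rewrite addr_gt0.
pose D : set (measurableTypeR R) := `]0%R, +oo[%classic.
have mD : measurable D by exact: measurable_itv.
have i1 : leb.-integrable D (fun t => (x%:E * (t `^ (x - 1) * expR (- t))%:E)%E).
  by apply: integrableZl => //; exact: integrable_Gamma.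
have i2 : leb.-integrable D (fun t => (t `^ (x + 1 - 1) * expR (- t))%:E).
  exact: integrable_Gamma.
pose f t := x * (t `^ (x - 1) * expR (- t)) - t `^ (x + 1 - 1) * expR (- t).
have intf : leb.-integrable D (EFin \o f) by exact: (integrableB mD i1 i2).
have cf t : 0 < t -> {for t, continuous f}.
  move=> t0; apply: cvgB; last exact: continuous_powR_expR.
  by apply: cvgM; [exact: cvg_cst|exact: continuous_powR_expR].
have dF t : 0 < t -> is_derive t 1 (fun t => t `^ x * expR (- t)) (f t).
  move=> t0.
  have D1 : is_derive t 1 (fun t : R => expR (- t)) (expR (- t) * -1).
    exact: (@is_derive1_comp _ (@expR R) (fun t : R => - t)).
  have H := is_deriveM (is_derive1_powR x t0) D1.
  apply: (is_derive_eq H).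
  by rewrite /f /GRing.scale/= addrK; ring.
have := integrable_FTC_oy intf cf dF (powR_expR_cvg00 x0) (powR_expR_cvgy0 x0).
rewrite subrr /f; under eq_integral do rewrite EFinB EFinM.
rewrite integralB// integralZl//; last exact: integrable_Gamma.
by rewrite !GammaE// -EFinM -EFinB => -[] /eqP; rewrite subr_eq0 => /eqP.
Qed.

Lemma Gamma_gt0 x : 0 < x -> 0 < Gamma x.
Proof.
move=> x0; rewrite -lte_fin -GammaE// lt0e; apply/andP; split; last first.
  by apply: integral_ge0 => t _; rewrite lee_fin mulr_ge0 ?powR_ge0 ?expR_ge0.
apply: integral_neq0 => //.
- by have /measurable_int/measurable_EFinP := integrable_Gamma x0.
- by move=> t /=; rewrite in_itv/= andbT => t0; rewrite mulr_gt0 ?powR_gt0 ?expR_gt0.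
- have H : leb `]0%R, +oo[ != 0%E by rewrite lebesgue_measure_itv/= ltry.
  exact: H.
Qed.

(* Wendel's inequality, by integrating the tangent-line bound
   t^s <= x^s ((1 - s) + s t / x). *)
Lemma Gamma_Wendel x s : 0 < x -> 0 <= s <= 1 ->
  Gamma (x + s) <= x `^ s * Gamma x.
Proof.
move=> x0 s01; have /andP[s0 s1] := s01.
have xs0 : 0 < x + s by rewrite ltr_pwDl.
have x10 : 0 < x + 1 by rewrite addr_gt0.
pose D : set (measurableTypeR R) := `]0%R, +oo[%classic.
have mD : measurable D by exact: measurable_itv.
have iG y : 0 < y -> leb.-integrable D (fun t => (t `^ (y - 1) * expR (- t))%:E).
  by move=> ?; exact: integrable_Gamma.
have -> : x `^ s * Gamma x =
    x `^ s * (1 - s) * Gamma x + x `^ s * s / x * Gamma (x + 1).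
  by rewrite Gamma_recurrence//; field; rewrite gt_eqF.
rewrite -lee_fin EFinD EFinM [(_ / _ * _)%:E]EFinM -!GammaE//.
rewrite -!integralZl ?iG// -integralD//; last 2 first.
- by apply: integrableZl => //; exact: iG.
- by apply: integrableZl => //; exact: iG.
apply: le_integral => //.
- exact: iG.
- by apply: integrableD => //; apply: integrableZl => //; exact: iG.
move=> t; rewrite inE /D /= in_itv/= andbT => t0; rewrite lee_fin.
have -> : x + s - 1 = (x - 1) + s by ring.
have -> : x + 1 - 1 = (x - 1) + 1 by ring.
move: (x - 1) => y; rewrite !powRD ?(gt_eqF t0) ?implybT// (powRr1 (ltW t0)).
have := @powR_Young _ (t / x) s (divr_ge0 (ltW t0) (ltW x0)) s01.
move=> /(ler_wpM2l (powR_ge0 x s)).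
rewrite -powRM ?divr_ge0 ?(ltW t0) ?(ltW x0)// mulrCA divff ?gt_eqF// mulr1 => H.
have := ler_wpM2l (mulr_ge0 (powR_ge0 t y) (expR_ge0 (- t))) H.
have -> : t `^ y * expR (- t) * t `^ s = t `^ y * t `^ s * expR (- t) by ring.
by move=> /le_trans; apply; rewrite le_eqVlt; apply/orP; left; apply/eqP; ring.
Qed.

End Gamma_function.

(* The measure structure on a pushforward depends on the proof mf, which
   [pushforward mu f] does not carry. *)
Definition push_measure d d' (T : measurableType d) (T' : measurableType d')
    (R : realType) (mu : {measure set T -> \bar R}) (f : T -> T')
    (mf : measurable_fun setT f) : {measure set T' -> \bar R} :=
  measure_function_pushforward__canonical__measure_function_Measure mu mf.

(** * Change of scale and the value of Gamma at 1/2 *)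

Section lebesgue_scaling.
Context {R : realType}.
Local Notation leb := (@lebesgue_measure R).

Let scale (l : R) : measurableTypeR R -> measurableTypeR R := fun x => l * x.

Let measurable_scale (l : R) : measurable_fun setT (scale l).
Proof. exact: mulrl_measurable. Qed.

Lemma lebesgue_measure_scale (l : R) (l0 : 0 < l) (A : set (measurableTypeR R)) :
  measurable A -> leb A = (l%:E * pushforward leb (scale l) A)%E.
Proof.
move=> mA; pose l' : {nonneg R} := NngNum (ltW l0).
have -> : (l%:E * pushforward leb (scale l) A)%E =
    mscale l' (push_measure leb (measurable_scale l)) A by [].
apply: lebesgue_measure_unique => //= _ [[a b]] _ <-.
rewrite /mscale/= /pushforward.
have -> : scale l @^-1` `]a, b] = `]a / l, b / l]%classic.
  apply/seteqP; split => x /=; rewrite /scale !in_itv/= ltr_pdivrMr// ler_pdivlMr//;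
  by rewrite mulrC.
rewrite !lebesgue_measure_itv/= !lte_fin ltr_pM2r ?invr_gt0//.
by case: ifP => _; rewrite ?mule0// -!EFinD -EFinM; congr EFin; field; rewrite gt_eqF.
Qed.

Lemma ge0_integral_scale (l : R) (f : R -> \bar R) : 0 < l ->
  measurable_fun (`]0%R, +oo[%classic : set R) f ->
  (forall x : R, 0 < x -> (0 <= f x)%E) ->
  (\int[leb]_(x in `]0%R, +oo[) f x =
   l%:E * \int[leb]_(x in `]0%R, +oo[) f (l * x)%R)%E.
Proof.
move=> l0 mf f0; pose l' : {nonneg R} := NngNum (ltW l0).
pose D : set (measurableTypeR R) := `]0%R, +oo[%classic.
have mD : measurable D by exact: measurable_itv.
have f0' x : D x -> (0 <= f x)%E by rewrite /D/= in_itv/= andbT => /f0.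
transitivity (\int[mscale l' (push_measure leb (measurable_scale l))]_(x in D) f x)%E.
  apply: eq_measure_integral => A mA _; exact: lebesgue_measure_scale.
rewrite ge0_integral_mscale//; congr (_ * _)%E.
rewrite ge0_integral_pushforward//; last by move=> x; rewrite inE; exact: f0'.
congr (integral _ _ _); apply/seteqP; split => x /=;
  by rewrite /D/= /scale !in_itv/= !andbT pmulr_rgt0.
Qed.

End lebesgue_scaling.

Section Gamma_values.
Context {R : realType}.
Local Notation leb := (@lebesgue_measure R).
Implicit Types (x s t : R).

Lemma Gamma_scale x (l : R) : 0 < x -> 0 < l ->
  (\int[leb]_(t in `]0%R, +oo[) (t `^ (x - 1) * expR (- (l * t)))%:E =
    (l `^ (- x) * Gamma x)%:E)%E.
Proof.
move=> x0 l0.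
have H := @ge0_integral_scale R l (fun t => (t `^ (x - 1) * expR (- t))%:E) l0.
rewrite EFinM -GammaE// H; last 2 first.
- exact: measurable_int (integrable_Gamma x0).
- by move=> t t0; rewrite lee_fin mulr_ge0 ?powR_ge0 ?expR_ge0.
rewrite muleA -EFinM -ge0_integralZl//; last 3 first.
- apply/measurable_EFinP; apply: measurable_oy_continuous => t t0.
  apply: (@continuous_comp _ _ _ (fun t : R => l * t) (fun t => t `^ (x - 1) * expR (- t))).
    by apply: cvgM; [exact: cvg_cst|exact: cvg_id].
  by apply: continuous_powR_expR; rewrite mulr_gt0.
- by move=> t t0; rewrite lee_fin mulr_ge0 ?powR_ge0 ?expR_ge0.
- by rewrite lee_fin mulr_ge0 ?powR_ge0// ltW.
apply: eq_integral => t; rewrite inE/= in_itv/= andbT => t0.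
rewrite -!EFinM; congr EFin.
rewrite powRM ?(ltW l0) ?(ltW t0)//.
have e : l `^ (- x) * l * l `^ (x - 1) = 1.
  rewrite -{2}(powRr1 (ltW l0)) -!powRD ?(gt_eqF l0) ?implybT//.
  by rewrite (_ : - x + 1 + (x - 1) = 0) ?powRr0//; ring.
rewrite [RHS](_ : _ = (l `^ (- x) * l * l `^ (x - 1)) *
  (t `^ (x - 1) * expR (- (l * t)))); last by ring.
by rewrite e mul1r.
Qed.

Lemma powR_cvgy (p : R) : 0 < p -> t `^ p @[t --> +oo] --> +oo.
Proof.
move=> p0; apply/cvgryPge => A; near=> t.
have t0 : `|A| `^ p^-1 <= t by near: t; exact: nbhs_pinfty_ge.
apply: (le_trans (ler_norm A)).
have {1}-> : `|A| = (`|A| `^ p^-1) `^ p.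
  by rewrite -powRrM mulVf ?gt_eqF// powRr1.
apply: ge0_ler_powR; rewrite ?nnegrE ?powR_ge0 ?(ltW p0)//.
Unshelve. all: by end_near. Qed.

(** The substitution u = sqrt t is made on primitives: with [H] the integral of exp (- u^2) from 0,
    the function 2 [H] (sqrt t) is a primitive of t^(- 1/2) exp (- t). *)
Lemma Gamma_half : Gamma (2^-1 : R) = Num.sqrt pi.
Proof.
have h0 : 0 < 2^-1 :> R by rewrite invr_gt0.
pose H := @gauss_integral_proof.integral0_gauss R.
have iH (b : R) : leb.-integrable `[0, b] (EFin \o gauss_fun).
  exact: integrableS integrableT_gauss.
have Hy : H x @[x --> +oo] --> Num.sqrt pi / 2.
  have : Num.sqrt (H x ^+ 2) @[x --> +oo] --> Num.sqrt (pi / 4).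
    by apply: continuous_cvg; [exact: sqrt_continuous|
      exact: gauss_integral_proof.cvg_integral0_gauss_sqr].
  rewrite sqrtrM ?pi_ge0// sqrtrV// (_ : 4 = 2 ^+ 2); last first.
    by rewrite expr2 -natrM.
  rewrite sqrtr_sqr ger0_norm//.
  rewrite (_ : (fun _ => Num.sqrt _) = H)//.
  apply/funext => r; rewrite sqrtr_sqr// ger0_norm//.
  exact: gauss_integral_proof.integral0_gauss_ge0.
have H0 : H x @[x --> 0] --> 0.
  exact: (@parameterized_integral_cvg_left _ 0 1 _ ltr01 (iH 1)).
have dH x : 0 < x -> is_derive x 1 H (gauss_fun x).
  move=> x0; have x1 : x < x + 1 by rewrite ltrDl.
  have [//|dH H'] := continuous_FTC1_closed x1 (iH _) x0.
    exact: continuous_gauss_fun.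
  by rewrite derive1E in H'; apply: DeriveDef.
apply: EFin_inj; rewrite -GammaE//.
have -> : Num.sqrt pi = 2 * (Num.sqrt pi / 2) - 2 * 0 :> R by field.
apply: (@ge0_FTC_oy _ _ (fun t => 2 * H (t `^ 2^-1))).
- by move=> t t0; exact: continuous_powR_expR.
- by move=> t t0; rewrite mulr_ge0 ?powR_ge0 ?expR_ge0.
- move=> t t0.
  have d1 := @is_derive1_comp _ H (fun t : R => t `^ 2^-1) t _ _
    (dH _ (powR_gt0 _ t0)) (is_derive1_powR 2^-1 t0).
  have := is_deriveM (is_derive_cst (2 : R) t 1) d1.
  move=> d2; apply: (is_derive_eq d2).
  rewrite /GRing.scale/= /gauss_fun -powR_mulrn ?powR_ge0// -powRrM.
  by rewrite mulVf// powRr1 ?(ltW t0)//; field.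
- apply: cvgM; first exact: cvg_cst.
  exact: (cvg_comp _ _ (powR_cvg0 h0) H0).
- apply: cvgM; first exact: cvg_cst.
  exact: (cvg_comp _ _ (powR_cvgy h0) Hy).
Qed.

End Gamma_values.

Lemma powR_gt0D (R : realType) (x r s : R) : 0 < x ->
  x `^ (r + s) = x `^ r * x `^ s.
Proof. by move=> x0; rewrite powRD// (gt_eqF x0) implybT. Qed.

(** * Uniqueness of solutions of the recurrence by Gauss's product *)

Section Bohr_Mollerup.
Context {R : realType}.
Implicit Types (x s b c : R).

Lemma cvg_ratioD b c : (n%:R + b) / (n%:R + c) @[n --> \oo] --> (1 : R).
Proof.
have H : (n%:R + c)^-1 @[n --> \oo] --> (0 : R).
  apply/gtr0_cvgV0.
    near=> n; rewrite -ltrBlDr sub0r; near: n; exact: nbhs_infty_gtr.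
  exact: cvg_comp (@cvgr_idn R) (cvg_addrr c).
have E : 1 = 1 + (b - c) * 0 :> R by rewrite mulr0 addr0.
rewrite [X in _ --> X]E.
apply: (@cvg_trans _ (1 + (b - c) * (n%:R + c)^-1 @[n --> \oo])); last first.
  by apply: cvgD; [exact: cvg_cst|apply: cvgM => //; exact: cvg_cst].
apply: near_eq_cvg; near=> n.
have n0 : 0 < n%:R + c by rewrite -ltrBlDr sub0r; near: n; exact: nbhs_infty_gtr.
by field; rewrite gt_eqF.
Unshelve. all: by end_near. Qed.

(* Gauss's approximation of Gamma (s + b) / Gamma b *)
Definition Gauss_prod b s (n : nat) : R :=
  n%:R `^ s * \prod_(k < n) ((b + k%:R) / (s + b + k%:R)).

Variables (f : R -> R) (b c : R).
Hypotheses (b0 : 0 < b) (c0 : 0 < c).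
Hypothesis f_gt0 : forall x, 0 <= x -> 0 < f x.
Hypothesis f_rec : forall x, 0 <= x -> f (x + 1) = (x + b) * f x.
(* the only consequence of log-convexity that the Bohr-Mollerup argument uses *)
Hypothesis f_Wendel : forall x s, 0 <= x -> 0 <= s <= 1 ->
  f (x + s) <= (x + c) `^ s * f x.

Let f_addn s n : 0 <= s -> f (s + n%:R) = (\prod_(k < n) (s + b + k%:R)) * f s.
Proof.
move=> s0; elim: n => [|n IH]; first by rewrite big_ord0 mul1r addr0.
rewrite -natr1 addrA f_rec ?addr_ge0// IH big_ord_recr/=; ring.
Qed.

(** The recurrence turns the Gauss product into (f s / f 0) q n with q n = n^s f n / f (n + s). The
    hypothesis [f_Wendel] from n to n + s bounds q n from below, and from n + s to n + 1 it bounds q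
    n from above. *)
Let Gauss_prod_cvg01 s : 0 <= s <= 1 -> Gauss_prod b s @ \oo --> f s / f 0.
Proof.
move=> s01; have /andP[s0 s1] := s01.
have E : f s / f 0 = f s / f 0 * 1 by rewrite mulr1.
rewrite [X in _ --> X]E.
pose q (n : nat) : R := n%:R `^ s * f n%:R / f (n%:R + s).
apply: (@cvg_trans _ (f s / f 0 * q n @[n --> \oo])).
  apply: near_eq_cvg; near=> n; rewrite /Gauss_prod /q.
  have fs := f_gt0 s0; have f0 := f_gt0 (lexx 0).
  have fn := @f_gt0 n%:R (ler0n _ _).
  rewrite prodf_div (addrC n%:R s) (f_addn n s0) -[in f n%:R](add0r n%:R).
  rewrite (f_addn n (lexx 0)) add0r.
  have P0 : \prod_(k < n) (s + b + k%:R) != 0.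
    by apply/prodf_neq0 => k _; rewrite gt_eqF// ltr_wpDr// ltr_wpDl.
  by field; rewrite P0 !gt_eqF.
apply: cvgM; first exact: cvg_cst.
apply: (@squeeze_cvgr _ _ _ _ (fun n => (n%:R + 0) / (n%:R + c))
  (fun n => (n%:R + (1 + c)) / (n%:R + b))); [|exact: cvg_ratioD..].
near=> n; rewrite /q.
have n0 : 0 < n%:R :> R by near: n; exact: nbhs_infty_gtr.
have fn := f_gt0 (ltW n0); have fns := @f_gt0 (n%:R + s) (addr_ge0 (ltW n0) s0).
have nc0 : 0 < n%:R + c by rewrite addr_gt0.
have nb0 : 0 < n%:R + b by rewrite addr_gt0.
apply/andP; split.
  rewrite addr0 ler_pdivlMr//.
  apply: (@le_trans _ _ (n%:R / (n%:R + c) * ((n%:R + c) `^ s * f n%:R))).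
    rewrite ler_wpM2l ?divr_ge0 ?(ltW n0) ?(ltW nc0)//.
    exact: f_Wendel (ltW n0) s01.
  rewrite mulrA ler_wpM2r ?(ltW fn)//.
  apply: (@le_trans _ _ ((n%:R / (n%:R + c)) `^ s * (n%:R + c) `^ s)).
    rewrite ler_wpM2r ?powR_ge0//; apply: ger1_powR => //.
    by rewrite divr_gt0//= ler_pdivrMr// mul1r lerDl ltW.
  by rewrite -powRM ?divr_ge0 ?(ltW n0) ?(ltW nc0)// divfK// gt_eqF.
rewrite ler_pdivrMr// mulrAC ler_pdivlMr//.
have nsc : 0 < n%:R + s + c by rewrite ltr_wpDl// addr_ge0// ltW.
have E2 : f (n%:R + s + (1 - s)) = (n%:R + b) * f n%:R.
  by rewrite -(f_rec (ltW n0)); congr f; ring.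
have := @f_Wendel (n%:R + s) (1 - s) (addr_ge0 (ltW n0) s0).
rewrite E2 subr_ge0 s1 lerBlDr lerDl s0 => /(_ isT) H.
have := ler_wpM2l (powR_ge0 n%:R s) H.
rewrite mulrA mulrAC -mulrA => /le_trans; apply.
rewrite mulrA ler_wpM2r ?(ltW fns)//.
apply: (@le_trans _ _ ((n%:R + s + c) `^ s * (n%:R + s + c) `^ (1 - s))).
  rewrite ler_wpM2r ?powR_ge0// ge0_ler_powR// ?nnegrE ?(ltW nsc) ?(ltW n0)//.
  by rewrite -addrA lerDl addr_ge0// ltW.
rewrite -powRD ?(gt_eqF nsc) ?implybT//.
rewrite (_ : s + (1 - s) = 1) ?powRr1 ?(ltW nsc)//; last by ring.
by rewrite -addrA lerD2l lerD2r.
Unshelve. all: by end_near. Qed.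

(** Induction on the integer part of s. From s - 1 to s the Gauss product gains the factor (s - 1 +
    b) m / (m + s - 1 + b), whose limit is the factor s - 1 + b of the recurrence. *)
Lemma Gauss_prod_cvg s : 0 <= s -> Gauss_prod b s @ \oo --> f s / f 0.
Proof.
move=> s0; have [n] : exists n, s \in `[n%:R, n%:R + 1].
  exists (Num.truncn s); rewrite in_itv/= natr1.
  by apply/andP; split; [rewrite truncn_le|rewrite ltW// truncnS_gt].
elim: n s s0 => [|n IH] s s0 sn.
  by apply: Gauss_prod_cvg01; rewrite in_itv/= add0r in sn.
have s1 : 0 <= s - 1.
  rewrite subr_ge0; move: sn; rewrite in_itv/= => /andP[+ _].
  by apply: le_trans; rewrite ler1n.
have sn1 : s - 1 \in `[n%:R, n%:R + 1].
  move: sn; rewrite !in_itv/= -natr1 => /andP[? ?].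
  by rewrite lerBrDr lerBlDr; apply/andP.
have {}IH := IH _ s1 sn1.
have -> : f s / f 0 = f (s - 1) / f 0 * ((s - 1 + b) * 1).
  have {1}-> : s = s - 1 + 1 by ring.
  by rewrite f_rec//; ring.
apply: (@cvg_trans _ (Gauss_prod b (s - 1) n *
    ((s - 1 + b) * ((n%:R + 0) / (n%:R + (s - 1 + b)))) @[n --> \oo])); last first.
  apply: cvgM => //; apply: cvgM; first exact: cvg_cst.
  exact: cvg_ratioD.
apply: near_eq_cvg; near=> m.
have m0 : 0 < m%:R :> R by near: m; exact: nbhs_infty_gtr.
rewrite /Gauss_prod addr0 !prodf_div.
have -> : m%:R `^ s = m%:R `^ (s - 1) * m%:R.
  rewrite -{3}(powRr1 (ltW m0)) -powRD ?(gt_eqF m0) ?implybT//.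
  by congr (_ `^ _); ring.
have P0 (t : R) : 0 <= t -> \prod_(k < m) (t + b + k%:R) != 0.
  by move=> t0; apply/prodf_neq0 => k _; rewrite gt_eqF// ltr_wpDr// ltr_wpDl.
have : (\prod_(k < m) (s + b + k%:R)) * (s - 1 + b) =
  (\prod_(k < m) (s - 1 + b + k%:R)) * (s - 1 + b + m%:R).
  clear; elim: m => [|m IH]; first by rewrite !big_ord0 addr0.
  rewrite !big_ord_recr/= mulrAC IH -!mulrA; congr (_ * _).
  by rewrite -natr1; ring.
move: (P0 _ s0) (P0 _ s1).
set P := \prod_(k < m) (s + b + k%:R); set Q := \prod_(k < m) (s - 1 + b + k%:R).
move=> nP nQ PQ.
have -> : P = Q * (s - 1 + b + m%:R) / (s - 1 + b).
  by rewrite -PQ mulfK// gt_eqF// ltr_wpDl.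
have p1 : s - 1 + b != 0 by rewrite gt_eqF// ltr_wpDl.
have p2 : m%:R + (s - 1 + b) != 0 by rewrite gt_eqF// ltr_wpDr// addr_ge0// ltW.
by field; rewrite nQ p1 (addrC (s - 1 + b)) p2.
Unshelve. all: by end_near. Qed.

End Bohr_Mollerup.

(** * Growth of the odd double factorials *)

Section odd_double_factorial.
Local Open Scope nat_scope.

Lemma odd_double_fact0 : odd_double_fact 0 = 1.
Proof. by rewrite /odd_double_fact big_geq. Qed.

Lemma odd_double_factS n : odd_double_fact n.+1 = odd_double_fact n * n.*2.+1.
Proof. by rewrite /odd_double_fact big_nat_recr//=; congr (_ * _); lia. Qed.

Lemma odd_double_fact_gt0 n : 0 < odd_double_fact n.
Proof.
by elim: n => [|n IH]; rewrite ?odd_double_fact0// odd_double_factS muln_gt0 IH.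
Qed.

(** This is the growth bound for determinacy in the extreme case c = 2. *)
Lemma odd_double_fact_sqr_le n : odd_double_fact n ^ 2 <= n.*2`!.
Proof.
elim: n => [|n IH]; first by rewrite odd_double_fact0.
rewrite odd_double_factS expnMn doubleS 2!factS mulnA mulnC leq_mul//; nia.
Qed.

(** The induction rests on (4n + 3) (4n + 5) <= 16 (2n + 1)^2, which is tightest at n = 0, where it
    reads 15 <= 16. *)
Lemma odd_double_fact_double n :
  odd_double_fact n.*2.+1 <= 16 ^ n * odd_double_fact n ^ 2.
Proof.
elim: n => [|n IH]; first by rewrite odd_double_factS odd_double_fact0.
rewrite doubleS 2!odd_double_factS (odd_double_factS n) expnMn expnS.
rewrite (mulnC 16) mulnACA -mulnA.
by rewrite leq_mul//; nia.
Qed.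

End odd_double_factorial.

(** Consecutive left-hand sides have a ratio of at most n + 1, by (1 + 1/n)^n <= e, while the ratio
    on the right is 2n + 1. *)
Lemma odd_double_fact_lower (R : realType) n :
  (n%:R : R) ^+ n * expR (- n%:R) <= (odd_double_fact n)%:R.
Proof.
elim: n => [|n IH]; first by rewrite oppr0 expR0 mulr1 odd_double_fact0.
apply: (@le_trans _ _ (n.+1%:R * (n%:R ^+ n * expR (- n%:R)))); last first.
  rewrite odd_double_factS natrM mulrC ler_pM ?ler_nat ?mulr_ge0 ?exprn_ge0 ?expR_ge0//.
  by lia.
rewrite exprS -mulrA ler_wpM2l//.
rewrite (_ : - n.+1%:R = - 1 - n%:R :> R); last by rewrite -natr1; ring.
rewrite expRD mulrA ler_wpM2r ?expR_ge0// -natr1.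
case: n {IH} => [|n]; first by rewrite !expr0 mul1r -[leRHS]expR0 ler_expR; lra.
have n0 : (0 : R) < n.+1%:R by [].
have : (1 + n.+1%:R^-1) ^+ n.+1 <= expR 1 :> R.
  have := expR_ge1Dx (n.+1%:R^-1 : R) => /(lerXn2r n.+1).
  rewrite !nnegrE expR_ge0 addr_ge0 ?invr_ge0// => /(_ isT isT) /le_trans; apply.
  by rewrite -expRM_natl mulfV ?gt_eqF.
rewrite expRN ler_pdivrMr ?expR_gt0// => H.
rewrite (_ : n.+1%:R + 1 = n.+1%:R * (1 + n.+1%:R^-1)); last by field; rewrite gt_eqF.
by rewrite exprMn ler_wpM2l// exprn_ge0.
Qed.

(** * Duplication formula and interpolation of the double factorials *)

Section Gamma_odd_double_factorial.
Context {R : realType}.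
Implicit Types (x s b : R).

Lemma Gauss_prod_Gamma b s : 0 < b -> 0 <= s ->
  Gauss_prod b s @ \oo --> Gamma (s + b) / Gamma b.
Proof.
move=> b0 s0.
have := @Gauss_prod_cvg _ (fun x => Gamma (x + b)) b b b0 b0 _ _ _ s s0.
rewrite add0r; apply.
- by move=> x x0; rewrite Gamma_gt0// ltr_wpDl.
- by move=> x x0; rewrite addrAC Gamma_recurrence// ltr_wpDl.
- by move=> x t x0 t01; rewrite addrAC; apply: Gamma_Wendel => //; rewrite ltr_wpDl.
Qed.

(** Both Gamma (x + 1) and [h] x satisfy g (x + 1) = (x + 1) g x, so that each, divided by its value
    at 0, is the limit of the same Gauss product. *)
Lemma Gamma_duplication s : 0 <= s ->
  Gamma (2 * s + 1) * Num.sqrt pi = 2 `^ (2 * s) * Gamma (s + 2^-1) * Gamma (s + 1).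
Proof.
move=> s0; pose x := 2 * s; have x0 : 0 <= x by rewrite mulr_ge0.
pose h (x : R) := 2 `^ x * Gamma (x / 2 + 2^-1) * Gamma (x / 2 + 1).
have p1 (y : R) : 0 <= y -> 0 < y / 2 + 2^-1 by move=> ?; rewrite ltr_wpDl ?divr_ge0// invr_gt0.
have p2 (y : R) : 0 <= y -> 0 < y / 2 + 1 by move=> ?; rewrite ltr_wpDl ?divr_ge0.
have h_gt0 y : 0 <= y -> 0 < h y.
  by move=> y0; rewrite !mulr_gt0 ?powR_gt0 ?Gamma_gt0 ?p1 ?p2.
have E : Gauss_prod 1 x @ \oo --> h x / h 0.
  (* Wendel's inequality with exponent t / 2 for the two Gamma factors produces ((y + 2) / 2)^(t /
     2) twice. Hence the shift 2 in the inequality, next to the shift 1 in the recurrence. *)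
  apply: (@Gauss_prod_cvg _ h 1 2) => //.
  - move=> y y0; rewrite /h powR_gt0D// powRr1//.
    have -> : (y + 1) / 2 + 2^-1 = y / 2 + 1 by field.
    have -> : (y + 1) / 2 + 1 = (y / 2 + 2^-1) + 1 by field.
    by rewrite (Gamma_recurrence (p1 _ y0)); field.
  - move=> y t y0 t01; have /andP[t0 t1] := t01; rewrite /h.
    have t2 : 0 <= t / 2 <= 1.
      by rewrite divr_ge0//= ler_pdivrMr// mul1r (le_trans t1)// ler1n.
    have -> : (y + t) / 2 + 2^-1 = y / 2 + 2^-1 + t / 2 by field.
    have -> : (y + t) / 2 + 1 = y / 2 + 1 + t / 2 by field.
    have W1 := Gamma_Wendel (p1 _ y0) t2.
    have W2 := Gamma_Wendel (p2 _ y0) t2.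
    have -> : (y + 2) `^ t = 2 `^ t * ((y / 2 + 1) `^ (t / 2) * (y / 2 + 1) `^ (t / 2)).
      rewrite -powRD ?(gt_eqF (p2 _ y0)) ?implybT//.
      have -> : t / 2 + t / 2 = t by field.
      by rewrite -powRM// ?(ltW (p2 _ y0))//; congr (_ `^ _); field.
    have W3 : (y / 2 + 2^-1) `^ (t / 2) <= (y / 2 + 1) `^ (t / 2).
      rewrite ge0_ler_powR ?nnegrE ?(ltW (p1 _ y0)) ?(ltW (p2 _ y0))//; last first.
        by rewrite lerD2l invf_le1// ler1n.
      by case/andP: t2.
    have W1' := le_trans W1 (ler_wpM2r (ltW (Gamma_gt0 (p1 _ y0))) W3).
    have G1 : 0 <= Gamma (y / 2 + 2^-1 + t / 2).
      by rewrite ltW// Gamma_gt0// ltr_wpDr ?p1//; case/andP: t2.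
    have G2 : 0 <= Gamma (y / 2 + 1 + t / 2).
      by rewrite ltW// Gamma_gt0// ltr_wpDr ?p2//; case/andP: t2.
    have W := ler_wpM2l (powR_ge0 2 (y + t)) (ler_pM G1 G2 W1' W2).
    rewrite mulrA in W; apply: (le_trans W).
    rewrite powR_gt0D//.
    by rewrite le_eqVlt; apply/orP; left; apply/eqP; ring.
have := cvg_unique (@Rhausdorff R) E (Gauss_prod_Gamma ltr01 x0).
have -> : h 0 = Num.sqrt pi * Gamma 1.
  by rewrite /h powRr0 mul0r !add0r mul1r Gamma_half.
have -> : h x = 2 `^ (2 * s) * Gamma (s + 2^-1) * Gamma (s + 1).
  by rewrite /h /x; have -> : 2 * s / 2 = s by field.
have G1 : Gamma 1 != 0 :> R by rewrite gt_eqF// Gamma_gt0.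
have pi0 : Num.sqrt pi != 0 :> R by rewrite gt_eqF// sqrtr_gt0 pi_gt0.
move=> H; apply: (mulIf (invr_neq0 (mulf_neq0 pi0 G1))).
by rewrite H -/x; field; rewrite G1 pi0.
Qed.

(** The M of the overview: the Mellin transform of the square of a standard normal variable. *)
Definition odd_double_Gamma s : R := 2 `^ s / Num.sqrt pi * Gamma (s + 2^-1).

Lemma odd_double_GammaE s : odd_double_Gamma s = 2 `^ s * (Gamma (s + 2^-1) / Gamma 2^-1).
Proof. by rewrite /odd_double_Gamma Gamma_half mulrAC mulrA. Qed.

Lemma odd_double_Gamma_nat n : odd_double_Gamma n%:R = (odd_double_fact n)%:R.
Proof.
elim: n => [|n IH].
  rewrite odd_double_GammaE powRr0 add0r mul1r odd_double_fact0 divff//.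
  by rewrite gt_eqF// Gamma_gt0// invr_gt0.
rewrite odd_double_factS natrM -IH /odd_double_Gamma -(natr1 n) powR_gt0D//.
rewrite powRr1// (addrAC n%:R) Gamma_recurrence; last by rewrite ltr_wpDl// invr_gt0.
have pi0 : Num.sqrt pi != 0 :> R by rewrite gt_eqF// sqrtr_gt0 pi_gt0.
by rewrite -(natr1 n.*2) -mul2n natrM; field.
Qed.

End Gamma_odd_double_factorial.

(** * Mellin transforms of probability laws *)

Section density_measure.
Local Open Scope ereal_scope.
Context d (T : measurableType d) (R : realType).
Variables (mu : {measure set T -> \bar R}) (g : T -> \bar R).

(** The proofs [mg] and [g0] belong to the term so that its measure structure can be inferred from
    it. *)
Definition density_measure (mg : measurable_fun setT g)
  (g0 : forall x, 0 <= g x) (A : set T) : \bar R := \int[mu]_(x in A) g x.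

Variables (mg : measurable_fun setT g) (g0 : forall x, 0 <= g x).
Local Notation nu := (density_measure mg g0).

Let nu0 : nu set0 = 0. Proof. by rewrite /nu integral_set0. Qed.

Let nu_ge0 A : 0 <= nu A. Proof. exact: integral_ge0. Qed.

Let nu_sigma_additive : semi_sigma_additive nu.
Proof.
move=> F mF tF mUF; rewrite /nu ge0_integral_bigcup//.
  by apply: is_cvg_nneseries => n _ _; exact: integral_ge0.
exact: measurable_funTS.
Qed.

HB.instance Definition _ := isMeasure.Build _ _ _ nu nu0 nu_ge0 nu_sigma_additive.

Import HBNNSimple.

Let integral_density_nnsfun (h : {nnsfun T >-> R}) :
  \int[nu]_x (h x)%:E = \int[mu]_x ((h x)%:E * g x).
Proof.
have E x : (h x)%:E * g x =
    \sum_(r \in range h) ((r * \1_(h @^-1` [set r]) x)%:E * g x).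
  rewrite {1}fimfunE -fsumEFin// ge0_mule_fsuml// => r.
  by rewrite nnfun_muleindic_ge0.
under [RHS]eq_integral do rewrite E.
under [LHS]eq_integral do rewrite fimfunE -fsumEFin//.
rewrite ge0_integral_fsum//; last 2 first.
- by move=> y; exact/measurable_EFinP/measurable_funM.
- by move=> y x _; rewrite nnfun_muleindic_ge0.
rewrite ge0_integral_fsum//; last 2 first.
- move=> r; apply: emeasurable_funM => //.
  exact/measurable_EFinP/measurable_funM.
- by move=> n x _; rewrite mule_ge0// nnfun_muleindic_ge0.
apply: eq_fsbigr => r; rewrite inE => -[x _ <-].
rewrite integralZl_indic_nnsfun// integral_indic// setIT.
have hx0 : 0 <= (h x)%:E by rewrite lee_fin.
under [RHS]eq_integral do rewrite EFinM -muleA.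
rewrite ge0_integralZl//; last 2 first.
- by apply: emeasurable_funM => //; exact/measurable_EFinP.
- by move=> y _; rewrite mule_ge0// lee_fin.
congr (_ * _); rewrite -[LHS]/(\int[mu]_(x in _) g x) integral_mkcond.
by rewrite epatch_indic; apply: eq_integral => y _; rewrite muleC.
Qed.

Lemma ge0_integral_density (D : set T) (f : T -> \bar R) : measurable D ->
  measurable_fun D f -> (forall x, D x -> 0 <= f x) ->
  \int[nu]_(x in D) f x = \int[mu]_(x in D) (f x * g x).
Proof.
move=> mD mf f0.
pose F := f \_ D.
have mF : measurable_fun setT F by exact/(measurable_restrictT f).
have F0 x : 0 <= F x by apply: erestrict_ge0.
have -> : \int[nu]_(x in D) f x = \int[nu]_x F x by rewrite integral_mkcond.
have -> : \int[mu]_(x in D) (f x * g x) = \int[mu]_x (F x * g x).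
  rewrite integral_mkcond; apply: eq_integral => x _.
  by rewrite /F !patchE; case: ifP; rewrite ?mul0e.
pose f_ := nnsfun_approx measurableT mF.
have F_ x : (f_ n x)%:E @[n --> \oo] --> F x by exact: cvg_nnsfun_approx.
have nd x : {homo (fun n => (f_ n x)%:E) : m n / (m <= n)%N >-> m <= n}.
  by move=> m n mn; rewrite lee_fin; exact/lefP/nd_nnsfun_approx.
transitivity (limn (fun n => \int[nu]_x (f_ n x)%:E)).
  rewrite -monotone_convergence//.
  - by apply: eq_integral => x _; apply/esym/cvg_lim.
  - by move=> n; exact/measurable_EFinP/measurable_funP.
  - by move=> n x _; rewrite lee_fin.
rewrite [X in limn X](_ : _ = (fun n => \int[mu]_x ((f_ n x)%:E * g x))); last first.
  by apply/funext => n; exact: integral_density_nnsfun.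
rewrite -monotone_convergence//.
- apply: eq_integral => x _; apply/cvg_lim => //.
  (* Multiplication is not continuous at 0 times infinity. Where [F] vanishes its approximations
     vanish too, whatever the value of the density. *)
  have [Fx0|Fx0] := eqVneq (F x) 0.
    rewrite Fx0 mul0e; apply: cvg_near_cst; apply: nearW => n.
    suff -> : (f_ n x)%:E = 0 by rewrite mul0e.
    apply/eqP; rewrite eq_le [X in _ && X]lee_fin fun_ge0 andbT -Fx0.
    apply: (lee_cvg_to (@cvg_cst _ _ _ _ _) (F_ x)); near=> m; apply: nd.
    by near: m; exact: nbhs_infty_ge.
  have [gx0|gx0] := eqVneq (g x) 0.
    by rewrite gx0 mule0; under eq_fun do rewrite mule0; exact: cvg_cst.
  apply: cvgeM; [|exact: F_|exact: cvg_cst].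
  by move: Fx0 gx0; case: (F x) => [?||]; case: (g x) => [?||].
- by move=> n; apply: emeasurable_funM => //; exact/measurable_EFinP/measurable_funP.
- by move=> n x _; rewrite mule_ge0// lee_fin.
- by move=> x _ m n mn; rewrite lee_wpmul2r//; exact: nd.
Unshelve. all: by end_near. Qed.

End density_measure.

Section probability_of_measure.
Context d (T : measurableType d) (R : realType).

(** An alias that remembers the proof of total mass 1, to which the probability structure is
    attached. *)
Definition prob_of (mu : {measure set T -> \bar R}) (mu1 : mu setT = 1%E) :
  set T -> \bar R := mu.

Variables (mu : {measure set T -> \bar R}) (mu1 : mu setT = 1%E).

HB.instance Definition _ := Measure.copy (prob_of mu1) mu.

HB.instance Definition _ :=
  Measure_isProbability.Build d T R (prob_of mu1) mu1.

End probability_of_measure.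

(** * Scaling, products and Gamma laws *)

Section Mellin_transforms.
Context {R : realType}.
Local Notation leb := (@lebesgue_measure R).
Implicit Types (M N : R -> R) (s : R).

Definition is_mellin d (T : measurableType d) (P : probability T R)
    (X : T -> R) M :=
  [/\ measurable_fun setT X, forall t, 0 <= X t &
   forall s, 0 <= s -> (\int[P]_t (X t `^ s)%:E = (M s)%:E)%E].

(* M is the Mellin transform s |-> E[X^s] of a nonnegative random variable X. *)
Definition mellin M : Prop := exists (d : measure_display)
  (T : measurableType d) (P : probability T R) (X : T -> R), is_mellin P X M.

Lemma eq_mellin M N : (forall s, 0 <= s -> M s = N s) -> mellin M -> mellin N.
Proof.
move=> MN [d [T [P [X [mX X0 XM]]]]]; exists d, T, P, X; split=> // s s0.
by rewrite XM// MN.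
Qed.

Lemma measurable_powR_comp d (T : measurableType d) (X : T -> R) s :
  measurable_fun setT X -> measurable_fun setT (fun t => (X t `^ s)%:E).
Proof.
move=> mX; apply/measurable_EFinP.
exact: (measurableT_comp (measurable_powR s) mX).
Qed.

Lemma mellin1 : mellin (fun=> 1).
Proof.
exists _, (measurableTypeR R), (\d_ (0 : measurableTypeR R)), (fun=> 1).
split=> // s s0; rewrite powR1 integral_cst//.
by rewrite mul1e [LHS]diracT.
Qed.

Lemma mellin_scale M r : 0 < r -> mellin M -> mellin (fun s => r `^ s * M s).
Proof.
move=> r0 [d [T [P [X [mX X0 XM]]]]]; exists d, T, P, (fun t => r * X t).
split.
- exact: measurable_funM.
- by move=> t; rewrite mulr_ge0// ltW.
move=> s s0; under eq_integral do rewrite (powRM _ (ltW r0))// EFinM.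
rewrite ge0_integralZl//; [by rewrite XM| |by move=> t _; rewrite lee_fin powR_ge0|].
- exact: measurable_powR_comp.
- by rewrite lee_fin powR_ge0.
Qed.

Lemma mellin_mul M N : mellin M -> mellin N -> mellin (fun s => M s * N s).
Proof.
move=> [d [T [P [X [mX X0 XM]]]]] [d' [T' [Q [Y [mY Y0 YN]]]]].
have mX' : measurable_fun setT (fun z : T * T' => X z.1).
  exact: (measurableT_comp mX measurable_fst).
have mY' : measurable_fun setT (fun z : T * T' => Y z.2).
  exact: (measurableT_comp mY measurable_snd).
have mXY : measurable_fun setT (fun z : T * T' => X z.1 * Y z.2).
  exact: measurable_funM.
exists _, (T * T')%type, (P \x Q)%E, (fun z => X z.1 * Y z.2); split => //.
  by move=> z; rewrite mulr_ge0.
move=> s s0; rewrite fubini_tonelli1//; last 2 first.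
- exact: measurable_powR_comp.
- by move=> z; rewrite lee_fin powR_ge0.
rewrite /fubini_F; transitivity (\int[P]_x ((N s)%:E * (X x `^ s)%:E))%E.
  apply: eq_integral => x _ /=; under eq_integral do rewrite powRM// EFinM.
  rewrite ge0_integralZl//; [by rewrite YN// muleC| |by move=> t _; rewrite lee_fin powR_ge0|].
  - exact: measurable_powR_comp.
  - by rewrite lee_fin powR_ge0.
have N0 : (0 <= (N s)%:E)%E.
  by rewrite -YN//; apply: integral_ge0 => t _; rewrite lee_fin powR_ge0.
rewrite ge0_integralZl//; [by rewrite XM// muleC| |by move=> t _; rewrite lee_fin powR_ge0].
exact: measurable_powR_comp.
Qed.

Lemma mellin_prod (M : nat -> R -> R) n : (forall k, mellin (M k)) ->
  mellin (fun s => \prod_(k < n) M k s).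
Proof.
move=> HM; elim: n => [|n IH].
  by apply: eq_mellin mellin1 => s _; rewrite big_ord0.
apply: eq_mellin (mellin_mul IH (HM n)) => s _.
by rewrite big_ord_recr.
Qed.

(** The Laplace transform of the Gamma(c) law at s / a is (1 + s / a)^(- c). *)
Lemma mellin_gamma a c : 0 < a -> 0 < c -> mellin (fun s => (a / (s + a)) `^ c).
Proof.
move=> a0 c0; pose D : set (measurableTypeR R) := `]0%R, +oo[%classic.
have mD : measurable D by exact: measurable_itv.
have G0 := Gamma_gt0 c0.
pose g0 (t : R) : \bar R := ((Gamma c)^-1 * (t `^ (c - 1) * expR (- t)))%:E.
have mg0 : measurable_fun D g0.
  apply/measurable_EFinP; apply: measurable_funM => //.
  by have /measurable_int/measurable_EFinP := integrable_Gamma c0.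
pose g : measurableTypeR R -> \bar R := g0 \_ D.
have mg : measurable_fun setT g by exact/(measurable_restrictT g0).
have g_ge0 x : (0 <= g x)%E.
  apply: erestrict_ge0 => y _; rewrite lee_fin !mulr_ge0 ?powR_ge0 ?expR_ge0//.
  by rewrite invr_ge0 ltW.
pose nu := density_measure leb mg g_ge0.
pose X (t : measurableTypeR R) := expR (- (t / a)).
have mX : measurable_fun setT X.
  apply: measurableT_comp => //; apply: measurableT_comp => //.
  exact: measurable_funM.
have nuE s : 0 <= s -> (\int[nu]_t (X t `^ s)%:E = ((a / (s + a)) `^ c)%:E)%E.
  move=> s0; rewrite /nu ge0_integral_density//; last 2 first.
  - exact: measurable_powR_comp.
  - by move=> t _; rewrite lee_fin powR_ge0.
  have l0 : 0 < 1 + s / a by rewrite ltr_wpDr ?divr_ge0 ?(ltW a0).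
  transitivity (\int[leb]_(t in `]0%R, +oo[) ((Gamma c)^-1%:E *
      (t `^ (c - 1) * expR (- ((1 + s / a) * t)))%:E))%E.
    rewrite [RHS]integral_mkcond; apply: eq_integral => t _.
    rewrite /g !patchE /D; case: ifPn => tD; last by rewrite mule0.
    rewrite /g0 -!EFinM; congr EFin.
    rewrite /X -expRM mulrCA; congr (_ * _); rewrite mulrCA -expRD; congr (_ * expR _).
    by field; rewrite gt_eqF.
  rewrite ge0_integralZl//; last 3 first.
  - by have /measurable_int := integrable_powR_expR c0 l0.
  - by move=> t _; rewrite lee_fin mulr_ge0 ?powR_ge0 ?expR_ge0.
  - by rewrite lee_fin invr_ge0 ltW.
  rewrite Gamma_scale// -EFinM; congr EFin.
  rewrite mulrCA mulVf ?gt_eqF// mulr1 powRN -powR_inv1 ?powR_ge0// -powRrM.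
  rewrite (mulrC c) powRrM powR_inv1 ?(ltW l0)//; congr (_ `^ _).
  rewrite (_ : 1 + s / a = (s + a) / a) ?invf_div//.
  by field; rewrite gt_eqF.
have nu1 : nu setT = 1%E.
  have := nuE 0 (lexx 0); under eq_integral do rewrite powRr0.
  by rewrite integral_cst// mul1e add0r divff ?gt_eqF// powR1.
exists _, (measurableTypeR R), (prob_of nu1), X; split => //.
by move=> t; exact: expR_ge0.
Qed.

End Mellin_transforms.

(** * Helly's selection for decreasing functions *)

Section selection.
Context {R : realType}.
Implicit Types (u s x : R).

Lemma antitone_measurable (f : R -> R) :
  (forall u v : R, 0 < u -> u <= v -> f v <= f u) ->
  measurable_fun (`]0%R, +oo[%classic : set R) f.
Proof.
move=> f_ni; pose g u := - f u.
suff : measurable_fun (`]0%R, +oo[%classic : set R) g.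
  by move=> mg; rewrite -(opprK f); exact/measurable_funN.
apply: (measurability (@RGenCInfty.G R)) => [|/= _ [_] [r] -> <-].
  exact: RGenCInfty.measurableE.
apply: is_interval_measurable => s t/=.
rewrite /= !in_itv/= !andbT => -[s0 fs] [t0 ft] u /andP[su ut].
rewrite in_itv/= !andbT; have u0 := lt_le_trans s0 su.
by split=> //; rewrite in_itv/= andbT; apply: (le_trans fs); rewrite /g lerN2 f_ni.
Qed.

(** Compactness of [0, b] provides a cluster point, and along an ultrafilter a cluster point is a
    limit. *)
Lemma ultra_cvg_bounded (U : set_system nat) (w : nat -> R) (b : R) :
  UltraFilter U -> (forall n, 0 <= w n <= b) ->
  exists2 l : R, 0 <= l <= b & forall e : R, 0 < e -> U [set n | `|w n - l| < e].
Proof.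
move=> UU wb.
have [l [lb lcl]] : `[0, b] `&` cluster (w @ U) !=set0.
  apply: (@segment_compact R 0 b); apply: (@filterE _ U) => n /=.
  by rewrite in_itv/= wb.
exists l; first by move: lb; rewrite /= in_itv.
move=> e e0; have [//|UC] := in_ultra_setVsetC [set n | `|w n - l| < e] UU.
have UC' : (w @ U) (~` ball l e).
  apply: (@filterS _ U _ _ _ _ UC) => n /= we; rewrite /ball/= => le.
  by apply: we; rewrite distrC.
by have [x []] := lcl _ _ UC' (nbhsx_ballx l e e0).
Qed.

(** An enumeration of the rationals, with the default 0 at numbers that code none. *)
Definition nth_rat (k : nat) : R := odflt 0 (omap ratr (unpickle k : option rat)).

Lemma nth_rat_dense u v : u < v -> exists k, u < nth_rat k < v.
Proof.
move=> uv; have [q quv] := rat_in_itvoo uv.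
exists (pickle q); rewrite /nth_rat pickleK/=.
by move: quv; rewrite in_itv.
Qed.

(* L is the limit along a nonprincipal ultrafilter; phi only has to follow it at
   the rationals, and the exceptional points are the jumps of L. *)
Lemma Helly_selection (v : nat -> R -> R) (b : R -> R) :
  (forall n u, 0 < u -> 0 <= v n u <= b u) ->
  (forall n u w, 0 < u -> u <= w -> v n w <= v n u) ->
  exists (phi : nat -> nat) (L : R -> R) (N : set (measurableTypeR R)),
    [/\ forall k, (k <= phi k)%N,
        forall u, 0 < u -> 0 <= L u,
        forall u w, 0 < u -> u <= w -> L w <= L u,
        (@lebesgue_measure R).-negligible N &
        forall u, 0 < u -> ~ N u -> v (phi k) u @[k --> \oo] --> L u].
Proof.
move=> vb vmono.
have [U [UU Uoo]] := @ultraFilterLemma nat \oo _.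
have UI (A B : set nat) : U A -> U B -> exists n, A n /\ B n.
  by move=> UA UB; exact: (@filter_ex _ U _ _ (@filterI _ U _ _ _ UA UB)).
have /choice[L LP] : forall u, exists l : R, 0 < u ->
    0 <= l /\ forall e : R, 0 < e -> U [set n | `|v n u - l| < e].
  move=> u; have [u0|u0] := ltP 0 u; last by exists 0.
  have [l /andP[l0 _] le] := @ultra_cvg_bounded U (v ^~ u) (b u) UU (fun n => vb n u u0).
  by exists l.
have L0 u : 0 < u -> 0 <= L u by move=> /LP[].
have LU u (e : R) : 0 < u -> 0 < e -> U [set n | `|v n u - L u| < e].
  by move=> /LP[_]; apply.
have Lmono u w : 0 < u -> u <= w -> L w <= L u.
  move=> u0 uw; rewrite leNgt; apply/negP => Luw.
  pose e := (L w - L u) / 2.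
  have e0 : 0 < e by rewrite divr_gt0// subr_gt0.
  have w0 : 0 < w by exact: lt_le_trans uw.
  have [n /= [n1 n2]] := UI _ _ (LU u e u0 e0) (LU w e w0 e0).
  have := vmono n u w u0 uw; move: n1 n2; rewrite /e !ltr_norml; lra.
(* For each of the finitely many rationals concerned the good indices form a set of the ultrafilter,
   hence so does their intersection. *)
have sel k : exists n, (k <= n)%N /\
    forall j, (j <= k)%N -> 0 < nth_rat j -> `|v n (nth_rat j) - L (nth_rat j)| < k.+1%:R^-1.
  have H m : U [set n | forall j, (j < m)%N -> 0 < nth_rat j ->
      `|v n (nth_rat j) - L (nth_rat j)| < k.+1%:R^-1].
    elim: m => [|m IH]; first by apply: (@filterE _ U).
    have [r0|r0] := ltP 0 (nth_rat m); last first.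
      apply: (@filterS _ U _ _ _ _ IH) => n /= H j; rewrite ltnS leq_eqVlt => /predU1P[->|/H//].
      by rewrite ltNge r0.
    have e0 : 0 < k.+1%:R^-1 :> R by rewrite invr_gt0.
    apply: (@filterS _ U _ _ _ _ (@filterI _ U _ _ _ IH (LU _ _ r0 e0))) => n /= [H1 H2] j.
    by rewrite ltnS leq_eqVlt => /predU1P[->//|/H1].
  have Uk : U [set n | (k <= n)%N] by apply: Uoo; exists k.
  by have [n /= [n1 n2]] := UI _ _ Uk (H k.+1); exists n; split.
have [phi phiP] := choice sel.
(* [B t] has at most one point, where L crosses the level t. If convergence fails at u, a rational
   level t separates the values of L at the rationals to the left of u from those to the right, so
   countably many levels suffice. *)
pose B (t : R) : set (measurableTypeR R) := [set u | 0 < u /\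
  (forall j, 0 < nth_rat j -> (nth_rat j < u -> t < L (nth_rat j)) /\
     (u < nth_rat j -> L (nth_rat j) < t))].
have B1 t u u' : B t u -> B t u' -> u < u' -> False.
  move=> [u0 Bu] [u'0 Bu'] uu'.
  have [j /andP[uj ju']] := nth_rat_dense uu'.
  have j0 : 0 < nth_rat j by exact: lt_trans uj.
  have [_ /(_ uj) h1] := Bu _ j0; have [/(_ ju') h2 _] := Bu' _ j0.
  by have := lt_trans h1 h2; rewrite ltxx.
exists phi, L, (\bigcup_m B (nth_rat m)); split=> //.
- by move=> k; case: (phiP k).
- apply: negligible_bigcup => m.
  have [[u Bu]|B0] := pselect (exists u, B (nth_rat m) u); last first.
    rewrite (_ : B _ = set0); first exact: negligible_set0.
    by apply/seteqP; split => // u Bu; apply: B0; exists u.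
  exists [set u]; split; first exact: measurable_set1.
    exact: lebesgue_measure_set1.
  move=> u' Bu'; apply/eqP; rewrite eq_le; apply/andP; split;
  by rewrite leNgt; apply/negP => uu';
    first [exact: (B1 _ _ _ Bu Bu' uu')|exact: (B1 _ _ _ Bu' Bu uu')].
move=> u u0 Nu.
have rcvg j : 0 < nth_rat j -> v (phi k) (nth_rat j) @[k --> \oo] --> L (nth_rat j).
  move=> j0; apply/cvgrPdist_lt => e e0; near=> k.
  have [_ /(_ j)] := phiP k; rewrite distrC => /(_ _ j0) H.
  apply: (lt_trans (H _)); first by near: k; exact: nbhs_infty_ge.
  by near: k; exact: near_infty_natSinv_lt (PosNum e0).
apply/cvgrPdist_lt => e e0.
have upper : exists2 j, 0 < nth_rat j < u & L (nth_rat j) < L u + e.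
  apply: contrapT => H; apply: Nu.
  have [m /andP[m1 m2]] : exists m, L u < nth_rat m < L u + e.
    by apply: nth_rat_dense; rewrite ltrDl.
  exists m => //; split=> // j j0; split=> [ju|uj].
    by rewrite (lt_le_trans m2)// leNgt; apply/negP => ?; apply: H; exists j; rewrite ?j0.
  by rewrite (le_lt_trans _ m1)// Lmono// ltW.
have lower : exists2 j, u < nth_rat j & L u - e < L (nth_rat j).
  apply: contrapT => H; apply: Nu.
  have [m /andP[m1 m2]] : exists m, L u - e < nth_rat m < L u.
    by apply: nth_rat_dense; rewrite ltrBlDr ltrDl.
  exists m => //; split=> // j j0; split=> [ju|uj].
    by rewrite (lt_le_trans m2)// Lmono// ltW.
  by rewrite (le_lt_trans _ m1)// leNgt; apply/negP => ?; apply: H; exists j.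
have [j /andP[j0 ju] Lj] := upper; have [i ui Li] := lower.
have i0 : 0 < nth_rat i by exact: lt_trans ui.
have d1 : 0 < L u + e - L (nth_rat j) by rewrite subr_gt0.
have d2 : 0 < L (nth_rat i) - (L u - e) by rewrite subr_gt0.
near=> k.
have H1 : `|L (nth_rat j) - v (phi k) (nth_rat j)| < L u + e - L (nth_rat j).
  by near: k; move/cvgrPdist_lt: (rcvg _ j0); exact.
have H2 : `|L (nth_rat i) - v (phi k) (nth_rat i)| < L (nth_rat i) - (L u - e).
  by near: k; move/cvgrPdist_lt: (rcvg _ i0); exact.
have := vmono (phi k) _ _ j0 (ltW ju); have := vmono (phi k) _ _ u0 (ltW ui).
move: H1 H2; rewrite !ltr_norml; lra.
Unshelve. all: by end_near. Qed.

End selection.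

Lemma eq_measure_rays (R : realType)
    (m1 m2 : {measure set (measurableTypeR R) -> \bar R}) :
  (m1 setT < +oo)%E -> (forall r : R, m1 `]r, +oo[%classic = m2 `]r, +oo[%classic) ->
  forall A : set (measurableTypeR R), measurable A -> m1 A = m2 A.
Proof.
move=> m1oo m12 A mA.
have := @measure_unique _ R (measurableTypeR R) (@RGenOInfty.G R)
  (fun n => `](- n%:R : R), +oo[%classic).
apply => //.
- exact: RGenOInfty.measurableE.
- move=> _ _ [a ->] [b ->]; exists (Num.max a b).
  by apply/seteqP; split => x /=; rewrite !in_itv/= !andbT gt_max => /andP.
- by move=> n; exists (- n%:R).
- apply/seteqP; split => // x _; exists (Num.truncn `|x|).+1 => //=.
  rewrite in_itv/= andbT ltrNl (le_lt_trans (ler_norm _))// normrN truncnS_gt//.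
- by move=> _ [r ->].
- move=> n; apply: le_lt_trans m1oo; by apply: le_measure; rewrite ?inE//.
Qed.

(** * Decreasing quantile functions *)

Section quantile.
Context {R : realType}.
Local Notation leb := (@lebesgue_measure R).
Context d (T : measurableType d) (P : probability T R) (X : {RV P >-> R}).
Hypothesis X0 : forall t, 0 <= X t.
Implicit Types (u x r s : R).

Let G r : R := fine (ccdf X r).

Let GE r : (G r)%:E = P [set t | r < X t].
Proof.
rewrite /G fineK ?fin_num_measure// /ccdf /distribution /pushforward.
by congr (P _); apply/seteqP; split => t /=; rewrite in_itv/= andbT.
Qed.

Let G_le1 r : G r <= 1.
Proof. by rewrite -lee_fin fineK ?fin_num_measure//; exact: probability_le1. Qed.

Let G_ge0 r : 0 <= G r.
Proof. by rewrite -lee_fin GE. Qed.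

Let G_mono r x : r <= x -> G x <= G r.
Proof. by move=> rx; rewrite fine_le ?fin_num_measure// ccdf_nonincreasing. Qed.

Let G_right r u : u < G r -> \forall x \near r^'+, u < G x.
Proof.
move=> uG; have := @ccdf_right_continuous _ _ _ P X r.
rewrite -[X in _ --> X](@fineK _ (ccdf X r)) ?fin_num_measure//.
by move/fine_cvg => /cvgr_gt; apply.
Qed.

Let G_cvg0 u : 0 < u -> exists2 x, 0 <= x & G x <= u.
Proof.
move=> u0; have : G x @[x --> +oo] --> 0 by exact: fine_cvg (@cvg_ccdfy0 _ _ _ P X).
move=> /cvgr_le /(_ u u0) [x [_ xG]].
exists (`|x| + 1); first by rewrite addr_ge0.
by apply: xG; rewrite (le_lt_trans (ler_norm _))// ltrDl.
Qed.

Let S u : set R := [set x | 0 <= x /\ G x <= u].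

(** The generalized inverse of the survival function [G]; under the uniform law on ]0, 1[ it has the
    law of [X]. *)
Let q u := inf (S u).

Let q_ge0 u : 0 <= q u.
Proof.
have [S0|/set0P S0] := eqVneq (S u) set0; first by rewrite /q S0 inf0.
by apply: lb_le_inf => // x [].
Qed.

(** Galois connection between [q] and [G]: right continuity of [G] puts the infimum into the set. *)
Let qP u x : 0 < u -> 0 <= x -> (q u <= x) = (G x <= u).
Proof.
move=> u0 x0; have [y y0 Gy] := G_cvg0 u0.
apply/idP/idP => [qx|Gx]; last first.
  by apply: ge_inf; [exists 0 => z []|split].
rewrite leNgt; apply/negP => uG.
have [e /= e0 eP] := G_right uG.
suff : x + e <= q u by move=> /le_trans /(_ qx); rewrite gerDl leNgt e0.
apply: lb_le_inf; first by exists y.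
move=> z [z0 Gz]; rewrite leNgt; apply/negP => zx.
have [zlex|xz] := leP z x.
  by have := lt_le_trans uG (G_mono zlex); rewrite ltNge Gz.
have := eP z; rewrite /ball_/= distrC ltr_distlC => H.
have : u < G z by apply: H => //; apply/andP; split; lra.
by rewrite ltNge Gz.
Qed.

Let q_anti u w : 0 < u -> u <= w -> q w <= q u.
Proof.
move=> u0 uw; have w0 := lt_le_trans u0 uw.
by rewrite qP// (le_trans _ uw)// -qP.
Qed.

(** Markov's inequality at the radius r with r^p = b / u gives [G] r <= u. *)
Let q_bound (p b u : R) : 0 < p -> 0 < b -> 0 < u ->
  (\int[P]_t (X t `^ p)%:E <= b%:E)%E -> q u <= (b / u) `^ p^-1.
Proof.
move=> p0 b0 u0 Xb; rewrite qP ?powR_ge0//; set r := (b / u) `^ p^-1.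
have r0 : 0 <= r by exact: powR_ge0.
have rp : r `^ p = b / u.
  by rewrite /r -powRrM mulVf ?gt_eqF// powRr1// divr_ge0 ?ltW.
have mS : measurable [set t | r < X t].
  have -> : [set t | r < X t] = X @^-1` `]r, +oo[%classic.
    by apply/seteqP; split => t /=; rewrite in_itv/= andbT.
  rewrite -[_ @^-1` _]setTI; apply: (@measurable_funP _ _ _ _ _ X) => //.
have : ((r `^ p)%:E * (G r)%:E <= b%:E)%E.
  rewrite GE -[P _]mul1e; apply: le_trans Xb.
  rewrite mul1e -integral_cst// [leLHS]integral_mkcond.
  apply: ge0_le_integral => //.
  - by move=> t _; apply: erestrict_ge0 => ? _; rewrite lee_fin powR_ge0.
  - by apply/(measurable_restrictT (cst (r `^ p)%:E) mS).
  - exact: measurable_powR_comp.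
  - move=> t _; rewrite patchE; case: ifPn => [|_]; last by rewrite lee_fin powR_ge0.
    rewrite inE/= => rX; rewrite lee_fin ge0_ler_powR ?nnegrE ?X0 ?(ltW p0)//.
    exact: ltW.
rewrite rp -EFinM lee_fin mulrAC ler_pdivrMr// ler_pM2l//.
Qed.

Let qT : measurableTypeR R -> measurableTypeR R := q \_ `]0%R, +oo[%classic.

Let measurable_qT : measurable_fun setT qT.
Proof.
by apply/(measurable_restrictT q) => //; apply: antitone_measurable; exact: q_anti.
Qed.

Let g01 : measurableTypeR R -> \bar R := EFin \o \1_(`]0%R, 1%R[%classic : set (measurableTypeR R)).

Let mg01 : measurable_fun setT g01.
Proof. exact/measurable_EFinP/measurable_indic. Qed.

Let g01_ge0 x : (0 <= g01 x)%E. Proof. by rewrite lee_fin. Qed.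

Let unif := density_measure leb mg01 g01_ge0.

Let unifE (A : set (measurableTypeR R)) : measurable A ->
  unif A = leb (A `&` `]0, 1[%classic).
Proof.
move=> mA; rewrite -[unif A]/(\int[leb]_(x in A)
  (\1_(`]0%R, 1%R[%classic : set (measurableTypeR R)) x)%:E)%E.
by rewrite integral_indic// setIC.
Qed.

Let nu := push_measure unif measurable_qT.

Let measurable_X : @measurable_fun _ _ T (measurableTypeR R) setT X.
Proof.
have mX : measurable_fun setT X by exact: measurable_funP.
by move=> mT Y mY; exact: mX.
Qed.

Let nuX := push_measure P measurable_X.

Let lebesgue01 (r : R) : 0 <= r <= 1 -> leb `]0, r[%classic = r%:E.
Proof.
move=> /andP[r0 r1]; rewrite lebesgue_measure_itv/= lte_fin.
case: ltP => [_|r0']; first by rewrite oppr0 adde0.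
by congr EFin; apply/eqP; rewrite eq_le r0.
Qed.

(** For r >= 0, q u > r means u < G r, which cuts out of ]0, 1[ an interval of length P(X > r). For
    r < 0 both measures of the ray are 1. *)
Let nuE (A : set (measurableTypeR R)) : measurable A -> nu A = nuX A.
Proof.
move=> mA; symmetry.
apply: (@eq_measure_rays R nuX nu) => //.
  by rewrite [ltLHS]probability_setT ltry.
move=> r; rewrite /nu -[RHS]/(unif (qT @^-1` `]r, +oo[%classic)) unifE; last first.
  rewrite -[X in measurable X]setTI; exact: measurable_qT.
transitivity ((G r)%:E); first by rewrite /G fineK ?fin_num_measure.
have [r0|r0] := leP 0 r.
  have rqP (v : R) : 0 < v -> (r < q v) = (v < G r).
    by move=> v0; rewrite !ltNge qP.
  have qTE (v : R) : 0 < v -> (qT v : R) = q v.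
    by move=> v0; rewrite /qT patchE mem_set//= in_itv/= v0.
  rewrite -lebesgue01 ?G_ge0 ?G_le1//; congr (leb _).
  apply/seteqP; split => u /=; rewrite !in_itv/= andbT.
    move=> /andP[u0 uG]; split; last by rewrite u0 (lt_le_trans uG).
    by have := rqP _ u0; rewrite -qTE// => ->.
  move=> [rq /andP[u0 u1]]; rewrite u0/=.
  by have := rqP _ u0; rewrite -qTE// => <-.
have -> : qT @^-1` `]r, +oo[%classic `&` `]0, 1[%classic = `]0, 1[%classic.
  apply/setIidr => u /= _; rewrite in_itv/= andbT.
  by rewrite (lt_le_trans r0)// /qT patchE; case: ifP.
rewrite (lebesgue01 (r := 1)) ?ler01 ?lexx// GE.
rewrite (_ : [set t | r < X t] = setT) ?probability_setT//.
by apply/seteqP; split => // t _ /=; exact: lt_le_trans (X0 t).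
Qed.

Lemma quantile_function : exists f : R -> R,
  [/\ forall u, 0 < u -> 0 <= f u, forall u w, 0 < u -> u <= w -> f w <= f u,
   forall p b u, 0 < p -> 0 < b -> 0 < u ->
     (\int[P]_t (X t `^ p)%:E <= b%:E)%E -> f u <= (b / u) `^ p^-1 &
   forall s, 0 <= s ->
     (\int[leb]_(u in `]0%R, 1%R[) (f u `^ s)%:E = \int[P]_t (X t `^ s)%:E)%E].
Proof.
exists q; split => // s s0.
have mp : measurable_fun setT (fun x : measurableTypeR R => (x `^ s)%:E).
  by apply/measurable_EFinP; exact: measurable_powR.
transitivity (\int[nuX]_x (x `^ s)%:E)%E; last first.
  by rewrite ge0_integral_pushforward// => y _; rewrite lee_fin powR_ge0.
transitivity (\int[nu]_x (x `^ s)%:E)%E; last first.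
  by apply: eq_measure_integral => A mA _; exact: nuE.
rewrite ge0_integral_pushforward//; last by move=> y _; rewrite lee_fin powR_ge0.
rewrite preimage_setT ge0_integral_density//; last 2 first.
- exact: measurable_powR_comp.
- by move=> y _; rewrite lee_fin powR_ge0.
rewrite [LHS]integral_mkcond; apply: eq_integral => u _.
rewrite patchE /g01/= indicE; case: ifPn => u0; last by rewrite mule0.
rewrite mule1 /qT patchE mem_set//.
by move: u0; rewrite inE/= !in_itv/= andbT => /andP[].
Qed.

End quantile.

(** * Pointwise limits of Mellin transforms *)

Section mellin_limit.
Context {R : realType}.
Local Notation leb := (@lebesgue_measure R).
Implicit Types (M : R -> R) (u s x : R).

Lemma mellin_quantile M : mellin M -> exists f : R -> R,
  [/\ forall u, 0 < u -> 0 <= f u, forall u w, 0 < u -> u <= w -> f w <= f u,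
   forall p b u, 0 < p -> 0 < b -> 0 < u -> M p <= b -> f u <= (b / u) `^ p^-1 &
   forall s, 0 <= s -> (\int[leb]_(u in `]0%R, 1%R[) (f u `^ s)%:E = (M s)%:E)%E].
Proof.
move=> [d [T [P [X [mX X0 XM]]]]].
pose X' : {RV P >-> R} := HB.pack_for {mfun T >-> R} X (isMeasurableFun.Build _ _ _ _ X mX).
have [f [f0 fm fb fM]] := @quantile_function R d T P X' X0.
exists f; split=> // [p b u p0 b0 u0 Mb|s s0]; last by rewrite fM// XM.
by apply: fb => //; rewrite XM ?lee_fin// ltW.
Qed.

Lemma mellin_antitone (f : R -> R) M :
  (forall u, 0 < u -> 0 <= f u) -> (forall u w, 0 < u -> u <= w -> f w <= f u) ->
  (forall s, 0 <= s -> (\int[leb]_(u in `]0%R, 1%R[) (f u `^ s)%:E = (M s)%:E)%E) ->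
  mellin M.
Proof.
move=> f0 fm fM.
pose D : set (measurableTypeR R) := `]0%R, 1%R[%classic.
pose g : measurableTypeR R -> \bar R := EFin \o \1_D.
have mD : measurable D by exact: measurable_itv.
have mg : measurable_fun setT g by apply/measurable_EFinP; exact: measurable_indic.
have g0 x : (0 <= g x)%E by rewrite lee_fin.
have nu1 : density_measure leb mg g0 setT = 1%E.
  rewrite /density_measure/= integral_indic// setIT.
  have H : leb `]0%R, 1%R[%classic = 1%E.
    by rewrite lebesgue_measure_itv/= lte01 oppr0 adde0.
  exact: H.
pose X : measurableTypeR R -> R := f \_ `]0%R, +oo[%classic.
have mX : measurable_fun setT X.
  by apply/(measurable_restrictT f) => //; exact: antitone_measurable.
exists _, (measurableTypeR R), (prob_of nu1), X; split => //.
  move=> t; rewrite /X patchE; case: ifPn => //.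
  by rewrite inE/= in_itv/= andbT => /f0.
move=> s s0; rewrite -fM// [LHS]ge0_integral_density//; last 2 first.
- exact: measurable_powR_comp.
- by move=> y _; rewrite lee_fin powR_ge0.
rewrite [RHS]integral_mkcond; apply: eq_integral => u _.
rewrite patchE /g/= indicE /D; case: ifPn => u0; last by rewrite mule0.
rewrite mule1 /X patchE mem_set//.
by move: u0; rewrite inE/= !in_itv/= andbT => /andP[].
Qed.

Lemma cvg_powR_ge0 (w : nat -> R) x s : 0 < s -> (forall n, 0 <= w n) ->
  w n @[n --> \oo] --> x -> w n `^ s @[n --> \oo] --> x `^ s.
Proof.
move=> s0 w0 wx.
have : 0 <= x by apply: (ler_cvg_to (@cvg_cst _ _ _ _ _) wx); exact: nearW.
rewrite le_eqVlt => /predU1P[x0|x0]; last first.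
  exact: (cvg_comp w (fun y : R => y `^ s) wx (@continuous_powR _ s x x0)).
rewrite -x0 powR0 ?gt_eqF// in wx *.
apply/cvgrPdist_lt => e e0.
have e1 : 0 < e `^ s^-1 by exact: powR_gt0.
near=> n; rewrite sub0r normrN ger0_norm ?powR_ge0//.
have -> : e = (e `^ s^-1) `^ s by rewrite -powRrM mulVf ?gt_eqF// powRr1// ltW.
rewrite gt0_ltr_powR ?nnegrE ?w0 ?(ltW e1)//.
have : `|0 - w n| < e `^ s^-1 by near: n; move/cvgrPdist_lt: wx; exact.
by rewrite sub0r normrN ger0_norm.
Unshelve. all: by end_near. Qed.

(** On ]0, 1[ one has exp (1 - u) >= 1, so e times the integrand of Gamma at 1/2 dominates. *)
Lemma integrable_invsqrt01 : leb.-integrable `]0%R, 1%R[%classic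
  (fun u : R => (u `^ (- 2^-1))%:E).
Proof.
have h0 : 0 < 2^-1 :> R by rewrite invr_gt0.
have iG := integrable_Gamma h0.
pose D : set (measurableTypeR R) := `]0%R, 1%R[%classic.
have mD : measurable D by exact: measurable_itv.
have i1 : leb.-integrable D
    (fun t : R => ((expR 1)%:E * (t `^ (2^-1 - 1) * expR (- t))%:E)%E).
  apply: integrableZl => //; apply: integrableS iG => //.
  by move=> x /=; rewrite !in_itv/= andbT => /andP[].
apply: le_integrable i1 => //.
  by apply: measurable_funTS; apply/measurable_EFinP; exact: measurable_powR.
move=> u; rewrite /D/= in_itv/= => /andP[u0 u1].
rewrite lee_fin !ger0_norm ?powR_ge0 ?mulr_ge0 ?powR_ge0 ?expR_ge0//.
rewrite mulrCA -expRD (_ : 2^-1 - 1 = - 2^-1); last by field.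
by rewrite ler_peMr ?powR_ge0// (le_trans _ (expR_ge1Dx _))// lerDl subr_ge0 ltW.
Qed.

(** Quantile functions put all the laws on ]0, 1[, where selection gives convergence almost
    everywhere. Markov's inequality of order 2s dominates the s-th powers by a multiple of u^(-
    1/2). *)
Lemma mellin_lim (M_ : nat -> R -> R) M : (forall n, mellin (M_ n)) ->
  (forall s, 0 <= s -> M_ n s @[n --> \oo] --> M s) -> mellin M.
Proof.
move=> mM_ M_M.
have /choice[f fP] := fun n => mellin_quantile (mM_ n).
have /choice[b bP] : forall p, exists b : R, 0 <= p -> 0 < b /\ forall n, M_ n p <= b.
  move=> p; have [p0|p0] := leP 0 p; last by exists 0.
  have /cvg_seq_bounded[B [_ HB]] : cvgn (fun n => M_ n p).
    by apply/cvg_ex; exists (M p); exact: M_M.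
  exists (`|B| + 1) => _; split; first by rewrite ltr_wpDl.
  move=> n; apply: (le_trans (ler_norm _)); apply: (HB (`|B| + 1)) => //.
  by rewrite (le_lt_trans (ler_norm B))// ltrDl.
(* The bounded first moments supply the pointwise bound required for selection. *)
have vb n u : 0 < u -> 0 <= f n u <= (b 1 / u) `^ 1^-1.
  move=> u0; have [f0 _ fb _] := fP n; have [b0 Mb] := bP 1 ler01.
  by rewrite f0//= fb.
have vm n u w : 0 < u -> u <= w -> f n w <= f n u.
  by have [_ fm _ _] := fP n; exact: fm.
have [phi [L [N [phik L0 Lm N0 fL]]]] := Helly_selection vb vm.
apply: (mellin_antitone L0 Lm) => s s0.
pose D : set (measurableTypeR R) := `]0%R, 1%R[%classic.
have mD : measurable D by exact: measurable_itv.
have phioo : phi k @[k --> \oo] --> \oo.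
  by apply/cvgnyPge => m; near=> k; rewrite (leq_trans _ (phik k))//;
    near: k; exact: nbhs_infty_ge.
have lim1 : (\int[leb]_(u in D) (f (phi k) u `^ s)%:E)%E @[k --> \oo] --> (M s)%:E.
  have -> : (fun k => \int[leb]_(u in D) (f (phi k) u `^ s)%:E)%E =
      (fun k => (M_ (phi k) s)%:E).
    by apply/funext => k; have [_ _ _ ->] := fP (phi k).
  apply: cvg_EFin; first exact: nearW.
  exact: cvg_comp phioo (M_M s s0).
(* Markov's inequality of order 2s is void at s = 0, where all the integrands are 1. *)
have [s_eq0|s_neq0] := eqVneq s 0.
  have := lim1; rewrite s_eq0; under eq_fun do under eq_integral do rewrite powRr0.
  move=> /(cvg_unique (@ereal_hausdorff R) (@cvg_cst _ _ _ _ _)) <-.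
  by apply: eq_integral => u _; rewrite powRr0.
have s_gt0 : 0 < s by rewrite lt_neqAle eq_sym s_neq0.
have s2 : 0 < s * 2 by rewrite mulr_gt0.
have [b0 Mb] := bP _ (ltW s2).
have msub : `]0%R, 1%R[%classic `<=` (`]0%R, +oo[%classic : set R).
  by move=> x /=; rewrite !in_itv/= andbT => /andP[].
have mf_ k : measurable_fun D (fun u => (f (phi k) u `^ s)%:E).
  apply/measurable_EFinP.
  have mf : measurable_fun D (f (phi k)).
    have := antitone_measurable (vm (phi k)).
    exact: measurable_funS.
  exact: (measurableT_comp (measurable_powR s) mf).
have mL : measurable_fun D (fun u => (L u `^ s)%:E).
  apply/measurable_EFinP.
  have mf : measurable_fun D L by have := antitone_measurable Lm; exact: measurable_funS.
  exact: (measurableT_comp (measurable_powR s) mf).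
have ig : leb.-integrable D (fun u => ((b (s * 2) `^ 2^-1)%:E * (u `^ (- 2^-1))%:E)%E).
  by apply: integrableZl => //; exact: integrable_invsqrt01.
have [] := @dominated_convergence _ _ _ leb D mD _ _ _ mf_ mL _ ig.
- apply: (negligibleS _ N0) => u /= Hu; apply: contrapT => Nu; apply: Hu.
  rewrite /D/= in_itv/= => /andP[u0 _].
  apply: cvg_EFin; first exact: nearW.
  apply: cvg_powR_ge0 => //; last exact: fL.
  by move=> k; have /andP[] := vb (phi k) u u0.
- apply: aeW => u k; rewrite /D/= in_itv/= => /andP[u0 u1].
  have [f0 _ fb _] := fP (phi k).
  rewrite lee_fin ger0_norm ?powR_ge0//.
  have : f (phi k) u <= (b (s * 2) / u) `^ (s * 2)^-1 by apply: fb.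
  move=> /(ge0_ler_powR (ltW s_gt0)); rewrite !nnegrE f0// powR_ge0.
  move=> /(_ isT isT) /le_trans; apply.
  rewrite -powRrM invfM -mulrA (mulrC 2^-1) mulrA mulVf ?gt_eqF// mul1r.
  rewrite powRM ?invr_ge0 ?(ltW b0) ?(ltW u0)//.
  by rewrite -(powR_inv1 (ltW u0)) -powRrM mulN1r.
move=> _ _ lim2.
exact: (cvg_unique (@ereal_hausdorff R) lim2 lim1).
Unshelve. all: by end_near. Qed.

Lemma mellin_odd_double_Gamma c : 0 < c -> mellin (fun s => odd_double_Gamma s `^ c).
Proof.
move=> c0; have h0 : 0 < 2^-1 :> R by rewrite invr_gt0.
have F0 (s : R) (k : nat) : 0 <= s -> 0 <= (2^-1 + k%:R) / (s + 2^-1 + k%:R).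
  by move=> s0; rewrite divr_ge0// !addr_ge0// ltW.
(* Taking the product at n + 1 makes the scale (n + 1)^c positive. *)
pose M n s := (2 `^ s * Gauss_prod 2^-1 s n.+1) `^ c.
apply: (@mellin_lim M) => [n|s s0]; last first.
  apply: cvg_powR_ge0 => // [n|].
    rewrite mulr_ge0 ?powR_ge0// mulr_ge0 ?powR_ge0// prodr_ge0// => k _; exact: F0.
  rewrite odd_double_GammaE; apply: cvgM; first exact: cvg_cst.
  have := Gauss_prod_Gamma h0 s0; rewrite -(cvg_shiftn 1)/=.
  by under eq_fun do rewrite addn1.
have H := mellin_scale (powR_gt0 c (ltr0n R n.+1))
  (mellin_prod n.+1 (fun k =>
    @mellin_gamma R (2^-1 + k%:R) c (ltr_wpDr (ler0n _ k) h0) c0)).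
apply: eq_mellin (mellin_scale (powR_gt0 c (ltr0n R 2)) H) => s s0.
suff E (m : nat) : (2 `^ c) `^ s * ((m%:R `^ c) `^ s *
    \prod_(k < m) ((2^-1 + k%:R) / (s + (2^-1 + k%:R))) `^ c) =
    (2 `^ s * Gauss_prod 2^-1 s m) `^ c by exact: E.
rewrite /Gauss_prod.
have P0 (j : nat) : 0 <= \prod_(k < j) ((2^-1 + k%:R) / (s + 2^-1 + k%:R)).
  by rewrite prodr_ge0// => k _; exact: F0.
rewrite !powRM ?mulr_ge0 ?powR_ge0// -!powRrM !(mulrC c); congr (_ * (_ * _)).
elim: m => [|m IH]; first by rewrite !big_ord0 powR1.
have E : s + (2^-1 + m%:R) = s + 2^-1 + m%:R by rewrite addrA.
by rewrite !big_ord_recr/= IH E [in RHS]powRM ?F0 ?P0.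
Qed.

End mellin_limit.

Lemma mellin_measure (R : realType) (M : R -> R) : mellin M ->
  exists mu : {measure set (measurableTypeR R) -> \bar R},
    mu (~` `[0%R, +oo[) = 0%E /\
    forall s, 0 <= s -> (\int[mu]_(x in `[0%R, +oo[) (x `^ s)%:E = (M s)%:E)%E.
Proof.
move=> [d [T [P [X [mX0 X0 XM]]]]].
have mX : @measurable_fun _ _ T (measurableTypeR R) setT X by move=> mT Y mY; exact: mX0.
exists (push_measure P mX); split.
  rewrite -[LHS]/(P (X @^-1` (~` `[0%R, +oo[%classic))).
  rewrite (_ : _ @^-1` _ = set0) ?measure0//.
  by apply/seteqP; split => // t /=; rewrite in_itv/= andbT X0.
move=> s s0; rewrite ge0_integral_pushforward//; last 2 first.
- by apply: measurable_funTS; apply/measurable_EFinP; exact: measurable_powR.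
- by move=> y _; rewrite lee_fin powR_ge0.
rewrite (_ : _ @^-1` _ = setT) ?XM//.
by apply/seteqP; split => // t _ /=; rewrite in_itv/= andbT X0.
Qed.

(** * Determinacy *)

Lemma leq_fact_add p q : ((p + q)`! <= 2 ^ (p + q) * (p`! * q`!))%N.
Proof.
have H : ('C(p + q, p) <= 2 ^ (p + q))%N.
  rewrite -[2%N]/(1 + 1)%N expnDn (bigD1 (inord p)) //= inordK ?ltnS ?leq_addr//.
  by rewrite !exp1n !muln1 leq_addr.
have <- : ('C(p + q, p) * (p`! * q`!) = (p + q)`!)%N.
  by have := bin_fact (leq_addr q p); rewrite addKn.
by rewrite leq_mul2r H orbT.
Qed.

Lemma ler_dist_exp (R : realDomainType) (a b : R) n : `|a| <= 1 -> `|b| <= 1 ->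
  `|a ^+ n - b ^+ n| <= n%:R * `|a - b|.
Proof.
move=> a1 b1; elim: n => [|n IH]; first by rewrite subrr normr0 mul0r.
rewrite (_ : _ - _ = a * (a ^+ n - b ^+ n) + (a - b) * b ^+ n); last first.
  by rewrite !exprS; ring.
rewrite (le_trans (ler_normD _ _))// -natr1 [leRHS]mulrDl mul1r lerD// normrM.
  by rewrite (le_trans _ IH)// ler_piMl.
by rewrite ler_piMr// normrX exprn_ile1.
Qed.

(** * Powers of cosines tend to a Gaussian *)

Section cos_power_limit.
Context {R : realType}.
Implicit Types (w z y : R).

(** By the mean value theorem sin v = v cos c with 0 <= c <= v, and cos^2 c = 1 - sin^2 c >= 1 -
    v^2. *)
Lemma sin_sqr_bounds w : 0 <= w -> w ^+ 2 * (1 - w ^+ 2) <= sin w ^+ 2 <= w ^+ 2.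
Proof.
have sinE (v : R) : 0 < v -> exists2 c, 0 <= c <= v & sin v = v * cos c.
  move=> v0; have dsin (x : R) : x \in `]0, v[%R -> is_derive x 1 sin (cos x).
    by move=> _; exact: is_derive_sin.
  have cs : {within `[0, v], continuous sin}.
    by apply: continuous_subspaceT => x; exact: continuous_sin.
  have [c] := MVT v0 dsin cs; rewrite in_itv/= => /andP[c0 cv].
  rewrite sin0 !subr0 => ->; exists c; last by rewrite mulrC.
  by rewrite !ltW.
have ub (v : R) : 0 <= v -> sin v ^+ 2 <= v ^+ 2.
  rewrite le_eqVlt => /predU1P[<-|/sinE[c _ ->]]; first by rewrite sin0.
  by rewrite exprMn ler_piMr ?sqr_ge0//.
move=> w0; rewrite ub// andbT; move: w0.
rewrite le_eqVlt => /predU1P[<-|/sinE[c /andP[c0 cw] ->]]; first by rewrite expr0n mul0r sqr_ge0.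
rewrite exprMn ler_wpM2l ?sqr_ge0// cos2sin2 lerB//.
by rewrite (le_trans (ub _ c0))// lerXn2r ?nnegrE// (le_trans c0).
Qed.

(** With v = z^2 / 2 both terms lie between 1 - v and 1 - v + v^2, while z^4 = 4 v^2. *)
Lemma cos_expR_dist z : 0 <= z -> `|cos z - expR (- (z ^+ 2 / 2))| <= z ^+ 4.
Proof.
move=> z0; have w0 : 0 <= z / 2 by rewrite divr_ge0.
have cosE : cos z = 1 - 2 * sin (z / 2) ^+ 2.
  rewrite {1}(_ : z = (z / 2) *+ 2); last by rewrite -mulr_natr; field.
  by rewrite cos_mulr2n cos2sin2 -[X in X - 1]mulr_natr; ring.
have /andP[s1 s2] := sin_sqr_bounds w0; rewrite cosE.
set v := z ^+ 2 / 2; have v0 : 0 <= v by rewrite divr_ge0// sqr_ge0.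
have e1 : 1 - v <= expR (- v) by exact: expR_ge1Dx.
have e2 : expR (- v) <= 1 - v + v ^+ 2.
  rewrite expRN -(@ler_pM2l _ (expR v)) ?expR_gt0// mulfV ?gt_eqF ?expR_gt0//.
  apply: (@le_trans _ _ ((1 + v) * (1 - v + v ^+ 2))).
    rewrite (_ : _ * _ = 1 + v ^+ 3); last by ring.
    by rewrite lerDl exprn_ge0.
  rewrite ler_wpM2r ?expR_ge1Dx//.
  rewrite (_ : _ + _ = (1 - v / 2) ^+ 2 + 3 / 4 * v ^+ 2); last by field.
  by rewrite addr_ge0 ?sqr_ge0// mulr_ge0 ?sqr_ge0// divr_ge0.
have E1 : (z / 2) ^+ 2 = v / 2 by rewrite /v; field.
have E2 : z ^+ 4 = 4 * v ^+ 2 by rewrite /v; field.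
rewrite E1 in s1 s2; rewrite E2 ler_norml; nra.
Qed.

(** With N = n + 1 and z = y / sqrt N the limit is the N-th power of exp (- z^2 / 2), so the
    distance to it is at most N z^4 = y^4 / N. *)
Lemma cos_power_cvg y : 0 <= y ->
  cos (y / Num.sqrt n.+1%:R) ^+ n.+1 @[n --> \oo] --> expR (- (y ^+ 2 / 2)).
Proof.
move=> y0; apply/cvgrPdist_le => e e0.
have [K K0 HK] : exists2 K : R, 0 < K & y ^+ 4 <= K.
  by exists (y ^+ 4 + 1) => //; rewrite ?ltr_wpDl ?exprn_ge0// lerDl.
near=> n; rewrite distrC.
have n0 : (0 : R) < n.+1%:R by [].
set z := y / _.
have z0 : 0 <= z by rewrite divr_ge0// sqrtr_ge0.
have z2 : z ^+ 2 = y ^+ 2 / n.+1%:R by rewrite expr_div_n sqr_sqrtr// ltW.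
rewrite (_ : expR _ = expR (- (z ^+ 2 / 2)) ^+ n.+1); last first.
  by rewrite -expRM_natl z2; congr expR; field; rewrite nat1r pnatr_eq0.
apply: (le_trans (ler_dist_exp _ _ _)).
- by rewrite ler_norml cos_geN1 cos_le1.
- by rewrite ger0_norm ?expR_ge0// -[leRHS]expR0 ler_expR oppr_le0 divr_ge0// sqr_ge0.
apply: (@le_trans _ _ (n.+1%:R * z ^+ 4)).
  by rewrite ler_wpM2l// cos_expR_dist.
rewrite (_ : 4%N = (2 * 2)%N)// exprM z2 (_ : _ * _ = y ^+ 4 / n.+1%:R); last first.
  by field; rewrite nat1r pnatr_eq0.
rewrite ler_pdivrMr// (le_trans HK)// -ler_pdivrMl// mulrC.
near: n; exists (Num.truncn (K / e)) => // n /= nK.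
by rewrite (le_trans (ltW (truncnS_gt _)))// ler_nat.
Unshelve. all: by end_near. Qed.

End cos_power_limit.

(** * Indicators of half-lines as limits of exponential polynomials *)

Section exponential_rays.
Context {R : realType}.
Implicit Types (a r x : R).

Let cvgMny a : 0 < a -> n.+1%:R * a @[n --> \oo] --> +oo.
Proof.
move=> a0; have ny : (n.+1%:R : R) @[n --> \oo] --> +oo.
  by rewrite (cvg_shiftS (fun n => n%:R : R)); exact: cvgr_idn.
exact: (cvg_comp (fun n : nat => n.+1%:R : R) (fun r : R => r * a) ny
  (gt0_cvgMly a0 (@cvg_id _ _))).
Qed.

Lemma cvg_expRMn a : 0 < a -> expR (- (n.+1%:R * a)) @[n --> \oo] --> 0.
Proof. by move=> a0; exact: (cvg_comp _ _ (cvgMny a0) (@cvgr_expR R)). Qed.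

Let cvgM_expRMn a : 0 < a -> n.+1%:R * expR (- (n.+1%:R * a)) @[n --> \oo] --> 0.
Proof.
move=> a0; have := cvg_comp _ _ (cvgMny a0) (powR_expR_cvgy0 (@ltr01 R)).
move=> /(cvgM (@cvg_cst _ a^-1 _ _ _)); rewrite mulr0.
apply: cvg_trans; apply: near_eq_cvg; apply: nearW => n /=.
rewrite powRr1 ?mulr_ge0 ?(ltW a0)// mulrA; congr (_ * _).
by rewrite mulrCA mulVf ?gt_eqF// mulr1.
Qed.

Lemma Bernoulli_exprn (w : R) n : 0 <= w <= 1 -> 1 - n%:R * w <= (1 - w) ^+ n.
Proof.
move=> /andP[w0 w1]; elim: n => [|n IH]; first by rewrite mul0r subr0 expr0.
rewrite exprSr -natr1.
have := ler_wpM2r (_ : 0 <= 1 - w) IH; rewrite subr_ge0 => /(_ w1); apply: le_trans.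
rewrite -subr_ge0 (_ : _ - _ = n%:R * w ^+ 2); last by ring.
by rewrite mulr_ge0// sqr_ge0.
Qed.

(** With N = n + 1 and [w] the exponential, N 2^N w = N exp (- N b) where b = ln 2 (x / r - 1). This
    tends to 0 for x > r and is at least N for x <= r. The factor N in the exponent settles the
    boundary x = r, where 2^N w = 1. *)
Lemma cvg_exponential_ray r x : 0 < r -> 0 <= x ->
  (1 - expR (- (n.+1%:R * (ln 2 / r) * x))) ^+ (n.+1 * 2 ^ n.+1) @[n --> \oo] -->
  ((r < x)%R%:R : R).
Proof.
move=> r0 x0; have l2 : 0 < ln 2 :> R by rewrite ln_gt0// ltr1n.
set w := fun n : nat => expR (- (n.+1%:R * (ln 2 / r) * x)).
have w0 n : 0 < w n by exact: expR_gt0.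
have w1 n : w n <= 1.
  by rewrite -[leRHS]expR0 ler_expR oppr_le0 !mulr_ge0 ?invr_ge0 ?(ltW l2) ?(ltW r0).
pose b := ln 2 * (x / r - 1).
have kw n : (n.+1 * 2 ^ n.+1)%:R * w n = n.+1%:R * expR (- (n.+1%:R * b)).
  rewrite natrM -mulrA; congr (_ * _); rewrite natrX -[in LHS](@lnK R 2) ?posrE//.
  rewrite -expRM_natl -expRD; congr expR; rewrite /b; field.
  by rewrite gt_eqF.
have G0 n : 0 <= (1 - w n) ^+ (n.+1 * 2 ^ n.+1) by rewrite exprn_ge0// subr_ge0.
have [rx|xr] := ltP r x.
  have b0 : 0 < b by rewrite mulr_gt0// subr_gt0 ltr_pdivlMr// mul1r.
  apply: (squeeze_cvgr (f := fun n => 1 - n.+1%:R * expR (- (n.+1%:R * b)))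
    (h := fun=> 1)); last exact: cvg_cst.
    apply: nearW => n; rewrite -kw Bernoulli_exprn ?(ltW (w0 n)) ?w1//=.
    by rewrite -/(w n) exprn_ile1 ?subr_ge0 ?w1//; have := w0 n; lra.
  rewrite -[X in _ --> X]subr0; apply: cvgB; first exact: cvg_cst.
  exact: cvgM_expRMn.
apply: (squeeze_cvgr (f := fun=> 0) (h := fun n => expR (- (n.+1%:R * 1)))).
- apply: nearW => n; rewrite G0/=.
  have := expR_ge1Dx (- w n) => /(lerXn2r (n.+1 * 2 ^ n.+1)).
  rewrite !nnegrE subr_ge0 w1 expR_ge0 => /(_ isT isT) /le_trans; apply.
  rewrite -expRM_natl ler_expR mulrN lerN2 kw ler_wpM2l//.
  rewrite -[leLHS]expR0 ler_expR oppr_ge0 mulr_ge0_le0// mulr_ge0_le0 ?(ltW l2)//.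
  by rewrite subr_le0 ler_pdivrMr// mul1r.
- exact: cvg_cst.
- by apply: cvg_expRMn.
Qed.

End exponential_rays.

(** * Uniqueness under the growth bound (2n)! *)

Section determinacy.
Context {R : realType}.
Local Notation RB := (measurableTypeR R).
Variables (mu nu : {measure set RB -> \bar R}) (m : nat -> R).
Hypotheses (mu_m : has_stieltjes_moments mu m) (nu_m : has_stieltjes_moments nu m).
Implicit Types (f g G : R -> R) (x a u : R).

Let D : set RB := `[0%R, +oo[%classic.

Let mD : measurable D. Proof. exact: measurable_itv. Qed.

Let D_ge0 x : D x -> 0 <= x.
Proof. by rewrite /D/= in_itv/= andbT. Qed.

Let eqint f := [/\ mu.-integrable D (EFin \o f), nu.-integrable D (EFin \o f) &
  (\int[mu]_(x in D) (f x)%:E = \int[nu]_(x in D) (f x)%:E)%E].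

Let measurable_pow k : measurable_fun D (fun x : RB => x ^+ k).
Proof. by apply: measurable_funTS; apply: measurable_funX. Qed.

Let integrable_pow (la : {measure set RB -> \bar R}) k :
  has_stieltjes_moments la m -> la.-integrable D (fun x => (x ^+ k)%:E).
Proof.
move=> [_ la_m]; apply/integrableP; split.
  by apply/measurable_EFinP; exact: measurable_pow.
under eq_integral => x do rewrite inE => /D_ge0 x0.
rewrite (_ : (\int[la]_(x in D) _ = (m k)%:E)%E) ?ltry// -la_m.
by apply: eq_integral => x; rewrite inE => /D_ge0 x0; rewrite abse_EFin ger0_norm ?exprn_ge0.
Qed.

Let eqint_pow k : eqint (fun x => x ^+ k).
Proof.
split; [exact: integrable_pow|exact: integrable_pow|].
by have [_ ->] := mu_m; have [_ ->] := nu_m.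
Qed.

Let eq_eqint f g : (forall x, 0 <= x -> f x = g x) -> eqint f -> eqint g.
Proof.
move=> fg; have E x : x \in D -> (f x)%:E = (g x)%:E.
  by rewrite inE => /D_ge0 /fg ->.
move=> [if1 if2 e]; split.
- by apply: eq_integrable if1.
- by apply: eq_integrable if2.
- by transitivity (\int[mu]_(x in D) (f x)%:E)%E;
    [exact/esym/eq_integral|rewrite e; exact: eq_integral].
Qed.

Let eqintD f g : eqint f -> eqint g -> eqint (fun x => f x + g x).
Proof.
move=> [f1 f2 ef] [g1 g2 eg]; split.
- exact: (integrableD mD f1 g1).
- exact: (integrableD mD f2 g2).
- by rewrite !integralD_EFin//; congr (_ + _)%E.
Qed.

Let eqintZ a f : eqint f -> eqint (fun x => a * f x).
Proof.
move=> [f1 f2 ef]; split.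
- exact: (integrableZl mD a f1).
- exact: (integrableZl mD a f2).
- under eq_integral do rewrite EFinM; under [RHS]eq_integral do rewrite EFinM.
  by rewrite !integralZl//; congr (_ * _)%E.
Qed.

Let eqint_sum (f : nat -> R -> R) n : (forall i, eqint (f i)) ->
  eqint (fun x => \sum_(0 <= i < n) f i x).
Proof.
move=> ef; elim: n => [|n IH].
  apply: eq_eqint (eqintZ 0 (eqint_pow 0)) => x _.
  by rewrite big_geq// mul0r.
by apply: eq_eqint (eqintD IH (ef n)) => x _; rewrite big_nat_recr.
Qed.

Let eqint_lim (f_ : nat -> R -> R) f (g : R -> \bar R) :
  (forall n, eqint (f_ n)) -> mu.-integrable D g -> nu.-integrable D g ->
  (forall n x, 0 <= x -> (`|(f_ n x)%:E| <= g x)%E) ->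
  (forall x, 0 <= x -> f_ n x @[n --> \oo] --> f x) -> eqint f.
Proof.
move=> ef g1 g2 fg ff.
have mf_ n : measurable_fun D (fun x => (f_ n x)%:E).
  by have [/measurable_int] := ef n.
have ff' x : D x -> (f_ n x)%:E @[n --> \oo] --> (f x)%:E.
  by move=> /D_ge0 x0; apply: cvg_EFin; [exact: nearW|exact: ff].
have mf : measurable_fun D (fun x => (f x)%:E) by exact: emeasurable_fun_cvg mf_ ff'.
have DCT (la : {measure set RB -> \bar R}) (lag : la.-integrable D g) :
    la.-integrable D (fun x => (f x)%:E) /\
    (\int[la]_(x in D) (f_ n x)%:E @[n --> \oo] --> \int[la]_(x in D) (f x)%:E)%E.
  have [] := @dominated_convergence _ _ _ la D mD _ _ _ mf_ mf _ lag _ => //.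
  - exact: aeW.
  - by apply: aeW => x n /D_ge0; exact: fg.
have [if1 l1] := DCT mu g1; have [if2 l2] := DCT nu g2.
split => //; move: l1; have -> : (fun n => \int[mu]_(x in D) (f_ n x)%:E)%E =
    (fun n => \int[nu]_(x in D) (f_ n x)%:E)%E by apply/funext => n; have [] := ef n.
by move=> l1; exact: (cvg_unique (@ereal_hausdorff R) l1 l2).
Qed.

(** All k occur at once because multiplication by a power series in x raises k; boundedness of [G]
    lets the moments dominate G x^k. *)
Let V G := (exists B : R, forall x, 0 <= x -> `|G x| <= B) /\
  forall k, eqint (fun x => G x * x ^+ k).

Let eq_V f g : (forall x, 0 <= x -> f x = g x) -> V f -> V g.
Proof.
move=> fg [[B HB] ef]; split; first by exists B => x x0; rewrite -fg ?HB.
by move=> k; apply: eq_eqint (ef k) => x x0; rewrite fg.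
Qed.

Let V_sub f g : V f -> V g -> V (fun x => f x - g x).
Proof.
move=> [[B HB] ef] [[C HC] eg]; split.
  exists (B + C) => x x0; rewrite (le_trans (ler_normB _ _))//.
  by rewrite lerD ?HB ?HC.
move=> k; apply: eq_eqint (eqintD (ef k) (eqintZ (-1) (eg k))) => x x0.
by rewrite mulN1r mulrBl.
Qed.

Let V_lim (G_ : nat -> R -> R) G (B : R) : (forall n, V (G_ n)) ->
  (forall n x, 0 <= x -> `|G_ n x| <= B) ->
  (forall x, 0 <= x -> G_ n x @[n --> \oo] --> G x) -> V G.
Proof.
move=> VG GB GG; split.
  exists B => x x0; apply: (ler_cvg_to (cvg_norm (GG x x0)) (@cvg_cst _ _ _ _ _)).
  by apply: nearW => n; exact: GB.
move=> k; apply: (eqint_lim (f_ := fun n x => G_ n x * x ^+ k)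
    (g := fun x => (B%:E * (x ^+ k)%:E)%E)).
- by move=> n; have [_] := VG n.
- by apply: integrableZl => //; exact: integrable_pow.
- by apply: integrableZl => //; exact: integrable_pow.
- move=> n x x0; rewrite lee_fin normrM [`|x ^+ k|]ger0_norm ?exprn_ge0//.
  by rewrite ler_wpM2r ?exprn_ge0// GB.
- by move=> x x0; apply: cvgMl; exact: GG.
Qed.

Let V1 : V (fun=> 1).
Proof.
split; first by exists 1 => x _; rewrite normr1.
by move=> k; apply: eq_eqint (eqint_pow k) => x _; rewrite mul1r.
Qed.

Hypothesis m_le : forall n, m n <= (n.*2)`!%:R.

(** The series is B x^k cosh (u sqrt x), the dominating function for the cosine series. As m (k + i)
    <= (2k + 2i)! <= 4^(k + i) (2k)! (2i)!, its i-th term integrates to at most a constant times (4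
    u^2)^i, and u <= 1/4 makes the ratio at most 1/4. *)
Let integrable_cosh (la : {measure set RB -> \bar R}) B u k : 0 <= B ->
  0 <= u <= 4^-1 -> has_stieltjes_moments la m ->
  la.-integrable D (fun x => (\sum_(0 <= i <oo)
    (B * (u ^+ i.*2 / i.*2`!%:R) * x ^+ (k + i))%:E)%E).
Proof.
move=> B0 /andP[u0 u4] [la0 la_m].
have c0 i : 0 <= u ^+ i.*2 / i.*2`!%:R by rewrite divr_ge0 ?exprn_ge0.
have t0 i x : D x -> (0 <= (B * (u ^+ i.*2 / i.*2`!%:R) * x ^+ (k + i))%:E)%E.
  by move=> /D_ge0 x0; rewrite lee_fin mulr_ge0 ?exprn_ge0// mulr_ge0.
have mt i : measurable_fun D (fun x => (B * (u ^+ i.*2 / i.*2`!%:R) * x ^+ (k + i))%:E).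
  by apply/measurable_EFinP; apply: measurable_funM => //; exact: measurable_pow.
apply/integrableP; split.
  refine (@ge0_emeasurable_sum _ _ _ D (fun i x =>
    (B * (u ^+ i.*2 / i.*2`!%:R) * x ^+ (k + i))%:E) xpredT
    (fun i x xD _ => t0 i x xD) (fun i _ => mt i)).
have absE : {in D, (fun x => `|\sum_(0 <= i <oo)
      (B * (u ^+ i.*2 / i.*2`!%:R) * x ^+ (k + i))%:E|)%E =1
    (fun x => \sum_(0 <= i <oo) (B * (u ^+ i.*2 / i.*2`!%:R) * x ^+ (k + i))%:E)%E}.
  move=> x; rewrite inE => xD; rewrite gee0_abs//; apply: nneseries_ge0 => i _ _.
  exact: t0.
rewrite (eq_integral _ _ absE).
rewrite integral_nneseries//.
have m_ge0 i : 0 <= m i.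
  rewrite -lee_fin -la_m; apply: integral_ge0 => x /D_ge0 x0.
  by rewrite lee_fin exprn_ge0.
pose q : R := 4^-1; have q0 : 0 < q by rewrite invr_gt0.
have q1 : `|q| < 1 by rewrite gtr0_norm// invf_lt1 ?ltr1n.
pose K := B * (k.*2)`!%:R * 4 ^+ k.
apply: (@le_lt_trans _ _ (K / (1 - q))%:E); last exact: ltry.
apply: lime_le.
  apply: is_cvg_nneseries => i _ _; apply: integral_ge0 => x xD; exact: t0.
apply: nearW => n.
have Hle i : (\int[la]_(x in D) (B * (u ^+ i.*2 / i.*2`!%:R) * x ^+ (k + i))%:E <=
    (geometric K q i)%:E)%E.
  under eq_integral do rewrite EFinM.
  rewrite ge0_integralZl//; last 3 first.
  - by apply/measurable_EFinP; exact: measurable_pow.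
  - by move=> x /D_ge0 x0; rewrite lee_fin exprn_ge0.
  - by rewrite lee_fin mulr_ge0.
  rewrite la_m -EFinM lee_fin.
  suff : u ^+ i.*2 / i.*2`!%:R * m (k + i) <= (k.*2)`!%:R * 4 ^+ k * q ^+ i.
    by rewrite /K /= -!mulrA => H; rewrite ler_wpM2l.
  rewrite mulrAC ler_pdivrMr ?ltr0n ?fact_gt0//.
  have uq : u ^+ i.*2 <= q ^+ i * q ^+ i.
    by rewrite -exprD addnn lerXn2r ?nnegrE ?(ltW q0).
  have mki : m (k + i) <= 4 ^+ k * 4 ^+ i * (k.*2`!%:R * i.*2`!%:R).
    apply: (le_trans (m_le _)); rewrite doubleD -natrM -exprD -natrX -natrM ler_nat.
    by apply: (leq_trans (leq_fact_add _ _)); rewrite -doubleD -mul2n expnM.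
  apply: (@le_trans _ _ (q ^+ i * q ^+ i * (4 ^+ k * 4 ^+ i * (k.*2`!%:R * i.*2`!%:R)))).
    by rewrite ler_pM ?exprn_ge0.
  rewrite le_eqVlt; apply/orP; left; apply/eqP.
  have qi : q ^+ i * 4 ^+ i = 1 by rewrite -exprMn mulVf ?expr1n ?pnatr_eq0.
  transitivity ((q ^+ i * 4 ^+ i) * ((k.*2)`!%:R * 4 ^+ k * q ^+ i * i.*2`!%:R)).
    by ring.
  by rewrite qi mul1r.
rewrite (le_trans (lee_sum _ (fun i _ => Hle i)))// sumEFin lee_fin.
apply: geometric_le_lim => //.
by rewrite !mulr_ge0// exprn_ge0.
Qed.

(** The cosine being even, cos (u sqrt x) is a power series in x itself, and its partial sums times
    G x^k are combinations of the functions G x^(k + i). *)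
Let V_cos G u : 0 <= u <= 4^-1 -> V G -> V (fun x => G x * cos (u * Num.sqrt x)).
Proof.
move=> u4 [[B HB] eG]; have B0 : 0 <= B by exact: le_trans (HB 0 (lexx 0)).
have u0 : 0 <= u by case/andP: u4.
split.
  exists B => x x0; rewrite normrM -[leRHS]mulr1 ler_pM ?HB// ler_norml.
  by rewrite cos_geN1 cos_le1.
move=> k.
apply: (eqint_lim (f_ := fun n x =>
    \sum_(0 <= i < n) (-1) ^+ i * (u ^+ i.*2 / i.*2`!%:R) * (G x * x ^+ (k + i)))
    _ (integrable_cosh k B0 u4 mu_m) (integrable_cosh k B0 u4 nu_m)).
- by move=> n; apply: eqint_sum => i; exact/eqintZ/eG.
- move=> n x x0; apply: le_trans (@nneseries_lim_ge _ _ xpredT 0%N n _); last first.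
    move=> i _ _; rewrite lee_fin mulr_ge0 ?exprn_ge0// mulr_ge0// divr_ge0//.
    exact: exprn_ge0.
  rewrite sumEFin lee_fin; apply: (le_trans (ler_norm_sum _ _ _)).
  apply: ler_sum => i _; have c0 : 0 <= u ^+ i.*2 / i.*2`!%:R.
    by rewrite divr_ge0 ?exprn_ge0.
  rewrite normrM [X in X * _ <= _]normrM normrX normrN1 expr1n mul1r (ger0_norm c0).
  rewrite normrM [`|x ^+ _|]ger0_norm ?exprn_ge0// mulrA ler_wpM2r ?exprn_ge0//.
  by rewrite mulrC ler_wpM2r ?HB.
move=> x x0.
have E n : \sum_(0 <= i < n) (-1) ^+ i * (u ^+ i.*2 / i.*2`!%:R) * (G x * x ^+ (k + i)) =
    G x * series (cos_coeff' (u * Num.sqrt x)) n * x ^+ k.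
  rewrite /series/= mulrAC mulr_sumr; apply: eq_bigr => i _.
  rewrite /cos_coeff' -exprnP exprMn.
  rewrite (_ : Num.sqrt x ^+ i.*2 = x ^+ i).
    by rewrite exprD; ring.
  by rewrite -muln2 mulnC exprM sqr_sqrtr.
under eq_fun do rewrite E.
apply: cvgMl; apply: cvgMr; exact: cvg_cos_coeff'.
Qed.

Let V_expR G a : 0 < a -> V G -> V (fun x => G x * expR (- (a * x))).
Proof.
(* t = sqrt (2 a), so that t^2 x / 2 = a x. *)
move=> a0 VG; have [[B HB] _] := VG; pose t := Num.sqrt (2 * a).
have t0 : 0 <= t by exact: sqrtr_ge0.
have sN n : 0 < Num.sqrt n.+1%:R :> R by rewrite sqrtr_gt0.
(* From the index [N] on, the frequencies t / sqrt (n + N + 1) are at most 1/4, as [V_cos]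
   requires. *)
pose N := Num.truncn ((4 * t) ^+ 2).
have u4 n : 0 <= t / Num.sqrt (n + N).+1%:R <= 4^-1.
  rewrite divr_ge0 ?sqrtr_ge0//= ler_pdivrMr// ler_pdivlMl//.
  rewrite -[leLHS]ger0_norm ?mulr_ge0// -sqrtr_sqr ler_wsqrtr//.
  by rewrite (le_trans (ltW (truncnS_gt _)))// ler_nat ltnS leq_addl.
pose c n x := cos (t / Num.sqrt n.+1%:R * Num.sqrt x).
have c1 n j x : `|c n x ^+ j| <= 1.
  by rewrite normrX exprn_ile1// ler_norml cos_geN1 cos_le1.
apply: (V_lim (G_ := fun n x => G x * c (n + N)%N x ^+ (n + N).+1) (B := B)).
- move=> n; elim: (n + N).+1 => [|j IH].
    by apply: eq_V VG => x _; rewrite expr0 mulr1.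
  by apply: eq_V (V_cos (u4 n) IH) => x _; rewrite exprSr mulrA.
- move=> n x x0; rewrite normrM -[leRHS]mulr1 ler_pM ?HB//.
- move=> x x0; apply: cvgMr.
  have := cos_power_cvg (mulr_ge0 t0 (sqrtr_ge0 x)).
  rewrite exprMn !sqr_sqrtr// ?mulr_ge0 ?(ltW a0)//.
  rewrite (_ : 2 * a * x / 2 = a * x); last by field.
  rewrite -(cvg_shiftn N)/=; under eq_fun do rewrite mulrAC.
  by [].
Qed.

Let V_1sub_expR a j : 0 < a -> V (fun x => (1 - expR (- (a * x))) ^+ j).
Proof.
move=> a0; elim: j => [|j IH]; first by apply: eq_V V1 => x _; rewrite expr0.
apply: eq_V (V_sub IH (V_expR a0 IH)) => x _.
by rewrite exprSr mulrBr mulr1.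
Qed.

Let exp01 a x : 0 <= a -> 0 <= x -> 0 <= 1 - expR (- (a * x)) <= 1.
Proof.
move=> a0 x0; rewrite subr_ge0 lerBlDr lerDl expR_ge0 andbT.
by rewrite -[leRHS]expR0 ler_expR oppr_le0 mulr_ge0.
Qed.

Let V_ray (r : R) : 0 <= r -> V (fun x => (r < x)%R%:R).
Proof.
rewrite le_eqVlt => /predU1P[<-|r0].
  (* At r = 0 the rate ln 2 / r has no meaning; here 1 - exp (- (n + 1) x) already tends to the
     indicator of x > 0. *)
  apply: (V_lim (G_ := fun n x => (1 - expR (- (n.+1%:R * x))) ^+ 1) (B := 1)).
  - by move=> n; apply: V_1sub_expR; rewrite ltr0n.
  - move=> n x x0; have /andP[h0 h1] := exp01 (ler0n R n.+1) x0.
    by rewrite expr1 ger0_norm.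
  - move=> x; rewrite le_eqVlt => /predU1P[<-|x0].
      rewrite ltxx; apply: cvg_near_cst; apply: nearW => n.
      by rewrite mulr0 oppr0 expR0 subrr.
    rewrite x0 -[X in _ --> X]subr0; under eq_fun do rewrite expr1.
    apply: cvgB; first exact: cvg_cst.
    exact: cvg_expRMn.
have s0 : 0 < ln 2 / r by rewrite divr_gt0// ln_gt0// ltr1n.
apply: (V_lim (G_ := fun n x =>
  (1 - expR (- (n.+1%:R * (ln 2 / r) * x))) ^+ (n.+1 * 2 ^ n.+1)) (B := 1)).
- by move=> n; apply: V_1sub_expR; rewrite mulr_gt0 ?ltr0n.
- move=> n x x0; have /andP[h0 h1] := exp01 (mulr_ge0 (ler0n R n.+1) (ltW s0)) x0.
  by rewrite ger0_norm ?exprn_ge0// exprn_ile1.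
- by move=> x; exact: cvg_exponential_ray.
Qed.

Lemma stieltjes_moments_unique (A : set RB) : measurable A -> mu A = nu A.
Proof.
have mDC : measurable (~` D) by exact: measurableC.
have offD (la : {measure set RB -> \bar R}) (B : set RB) :
    has_stieltjes_moments la m -> measurable B -> la B = la (B `&` D).
  move=> [la0 _] mB; rewrite -[in LHS](setIT B) -(setUv D) setIUr measureU//.
  - rewrite [X in _ + X]( _ : _ = 0%E) ?adde0//.
    by apply: (@subset_measure0 _ _ _ la _ (~` D)) => //; exact: measurableI.
  - exact: measurableI.
  - exact: measurableI.
  - by rewrite setIACA setICr setI0.
have eqD : mu D = nu D.
  have [_ /(_ 0%N)] := mu_m; have [_ /(_ 0%N) <-] := nu_m.
  under eq_integral do rewrite expr0; under [RHS]eq_integral do rewrite expr0.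
  by rewrite !integral_cst// !mul1e.
move=> mA; apply: eq_measure_rays => //.
  rewrite (offD _ _ mu_m)// setTI.
  have [_ /(_ 0%N)] := mu_m; under eq_integral do rewrite expr0.
  by rewrite integral_cst// mul1e => ->; rewrite ltry.
move=> r; rewrite (offD mu)// (offD nu)//; have [r0|r0] := leP 0 r; last first.
  rewrite (_ : _ `&` _ = D)//; apply/setIidr => x /D_ge0 x0 /=.
  by rewrite in_itv/= andbT (lt_le_trans r0).
have [_ /(_ 0%N)[_ _]] := V_ray r0.
have E (la : {measure set RB -> \bar R}) :
    (\int[la]_(x in D) ((r < x)%R%:R * x ^+ 0)%:E = la (`]r, +oo[%classic `&` D))%E.
  rewrite -integral_indic//; apply: eq_integral => x _.
  rewrite expr0 mulr1 indicE; congr ((nat_of_bool _)%:R%:E).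
  by apply/idP/idP; rewrite inE/= in_itv/= andbT.
by rewrite !E.
Qed.

End determinacy.

(** * Indeterminacy *)

Section stretched_exponential.
Context {R : realType}.
Local Notation leb := (@lebesgue_measure R).
Implicit Types (x v t : R).

(** From t <= t^a on [0, 1], applied to 1 / (1 + x) and x / (1 + x), whose sum is 1. *)
Lemma powR_onePlus_le (a x : R) : a <= 1 -> 0 <= x -> (1 + x) `^ a <= 1 + x `^ a.
Proof.
move=> a1 x0; have x1 : 0 < 1 + x by rewrite ltr_wpDr.
have sub1 (t : R) : 0 <= t <= 1 -> t <= t `^ a.
  move=> /andP[]; rewrite le_eqVlt => /predU1P[<-|t0 t1]; first by rewrite powR_ge0.
  by rewrite ger1_powR// t0.
have E : (1 + x)^-1 + x / (1 + x) = 1 by field; rewrite gt_eqF.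
have u1 : 0 <= (1 + x)^-1 <= 1 by rewrite invr_ge0 (ltW x1)/= invf_le1// lerDl.
have u2 : 0 <= x / (1 + x) <= 1 by rewrite divr_ge0 ?(ltW x1)//= ler_pdivrMr// mul1r lerDr.
have := lerD (sub1 _ u1) (sub1 _ u2); rewrite E.
rewrite powRM ?invr_ge0 ?(ltW x1)// -[X in X + _]mul1r -mulrDl.
move=> /(ler_wpM2r (powR_ge0 (1 + x) a)); rewrite mul1r -mulrA -powRM ?invr_ge0 ?(ltW x1)//.
by rewrite mulVf ?gt_eqF// powR1 mulr1.
Qed.

(** (1 + x)^n is the power n / a of (1 + x)^a, hence at most a multiple of exp (k (1 + x)^a), and (1
    + x)^a <= 1 + x^a. *)
Lemma exprn_le_stretched (k a : R) n : 0 < k -> 0 < a <= 1 -> exists C : R,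
  forall x, 0 <= x -> (1 + x) ^+ n * expR (- (k * x `^ a)) <= C.
Proof.
move=> k0 /andP[a0 a1]; case: n => [|n].
  exists 1 => x x0; rewrite mul1r -[leRHS]expR0 ler_expR oppr_le0 mulr_ge0 ?powR_ge0//.
  exact: ltW.
pose p := n.+1%:R / a; have p0 : 0 < p by rewrite divr_gt0.
exists ((p / k) `^ p * expR k) => x x0; have x1 : 0 <= 1 + x by rewrite addr_ge0.
have -> : (1 + x) ^+ n.+1 = ((1 + x) `^ a) `^ p.
  by rewrite -powRrM /p mulrCA mulfV ?gt_eqF// mulr1 powR_mulrn.
rewrite expRN ler_pdivrMr ?expR_gt0// -mulrA -expRD.
apply: (le_trans (powR_le_expR p0 k0 (powR_ge0 _ _))).
rewrite ler_wpM2l ?powR_ge0// ler_expR -[X in X + k * _]mulr1 -mulrDr ler_wpM2l ?(ltW k0)//.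
exact: powR_onePlus_le.
Qed.

Variables (K a p : R).
Hypotheses (K0 : 0 < K) (a0 : 0 < a) (a1 : a <= 1).

(** C + i S = exp (- K v e^(- i th) - i p th), where v stands for x^a, and T is the derivative of S
    in th. With a p = n + 1 the twist by p th compensates a rotation of the ray of integration, so
    that the integral of x^n (C + i S) does not depend on th. Differentiating in th replaces the
    contour argument. *)
Let ang (th v : R) := K * v * sin th - p * th.
Let S (th v : R) := expR (- (K * v * cos th)) * sin (ang th v).
Let C (th v : R) := expR (- (K * v * cos th)) * cos (ang th v).
Let T (th v : R) :=
  expR (- (K * v * cos th)) * (K * v * cos (ang th v - th) - p * cos (ang th v)).

Let dS (th v : R) : is_derive th 1 (S ^~ v) (T th v).
Proof.
have d1 : is_derive th 1 (fun u => - (K * v * cos u)) (K * v * sin th).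
  have H := is_deriveN (is_deriveZ (K * v) (is_derive_cos th)).
  apply: (is_derive_eq H); rewrite scalerN opprK//.
have d2 : is_derive th 1 (ang ^~ v) (K * v * cos th - p).
  have H := is_deriveB (is_deriveZ (K * v) (is_derive_sin th)) (is_deriveZ p (is_derive_id th 1)).
  by apply: (is_derive_eq H); rewrite [p *: 1]mulr1.
have e1 := @is_derive1_comp _ expR (fun u => - (K * v * cos u)) th _ _ (is_derive_expR _) d1.
have e2 := @is_derive1_comp _ sin (ang ^~ v) th _ _ (is_derive_sin _) d2.
apply: (is_derive_eq (is_deriveM e1 e2)).
rewrite /T (cosB (ang th v) th) /=; rewrite -![_ *: _]/(_ * _); ring.
Qed.

Let dC (th v : R) : is_derive v 1 (C th) (- K * (expR (- (K * v * cos th)) * cos (ang th v - th))).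
Proof.
have d1 : is_derive v 1 (fun u => - (K * u * cos th)) (- (K * cos th)).
  rewrite (_ : (fun u => _) = (fun u : R => - (K * cos th) * u)); last first.
    by apply/funext => u; ring.
  have H := is_deriveZ (- (K * cos th)) (is_derive_id v 1).
  by apply: (is_derive_eq H); rewrite [_ *: 1]mulr1.
have d2 : is_derive v 1 (ang th) (K * sin th).
  rewrite (_ : ang th = (fun u : R => K * sin th * u - p * th)); last first.
    by apply/funext => u; rewrite /ang; ring.
  have H := is_deriveB (is_deriveZ (K * sin th) (is_derive_id v 1)) (is_derive_cst (p * th) v 1).
  by apply: (is_derive_eq H); rewrite subr0 [_ *: 1]mulr1.
have e1 := @is_derive1_comp _ expR (fun u => - (K * u * cos th)) v _ _ (is_derive_expR _) d1.
have e2 := @is_derive1_comp _ cos (ang th) v _ _ (is_derive_cos _) d2.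
apply: (is_derive_eq (is_deriveM e1 e2)).
rewrite (cosB (ang th v) th) /=; rewrite -![_ *: _]/(_ * _); ring.
Qed.
Variable n : nat.
Hypothesis ap : a * p = n.+1%:R.

Let p0 : 0 < p.
Proof. by rewrite -(pmulr_rgt0 _ a0) ap. Qed.

(** Uniformity in th is what differentiation under the integral needs. The exponential absorbs n + 3
    powers of 1 + x: one pays for the extra x or for the factor v <= 1 + x in [T], and two leave the
    integrable (1 + x)^(- 2). *)
Let dominated (k0 : R) : 0 < k0 -> exists2 M : R, 0 < M & forall th x, k0 <= cos th -> 0 < x ->
  [/\ `|x ^+ n * S th (x `^ a)| <= M * (1 + x) `^ (- 2),
      `|x ^+ n * T th (x `^ a)| <= M * (1 + x) `^ (- 2) &
      `|x ^+ n.+1 * C th (x `^ a)| <= M * (1 + x) `^ (- 2)].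
Proof.
move=> k0_gt0; have a01 : 0 < a <= 1 by rewrite a0.
have [M HM] := exprn_le_stretched (n.+1 + 2) (mulr_gt0 K0 k0_gt0) a01.
exists ((K + p + 1) * (`|M| + 1)) => [|th x kth x0].
  by apply: mulr_gt0; [rewrite !addr_gt0|rewrite ltr_wpDl].
have x1 : 0 < 1 + x by rewrite addr_gt0.
set v := x `^ a; have v0 : 0 <= v by exact: powR_ge0.
have v1 : v <= 1 + x.
  apply: (@le_trans _ _ ((1 + x) `^ a)); last by rewrite ler1_powR// lerDl ltW.
  by rewrite ge0_ler_powR ?(ltW a0) ?nnegrE ?(ltW x0) ?(ltW x1)// lerDr.
pose E := expR (- (K * k0 * v)).
have eE : expR (- (K * v * cos th)) <= E.
  by rewrite ler_expR lerN2 mulrAC ler_wpM2l// mulr_ge0// ltW.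
have E0 : 0 <= E by exact: expR_ge0.
have ME : (1 + x) ^+ n.+1 * E <= (`|M| + 1) * (1 + x) `^ (- 2).
  rewrite powRN ler_pdivlMr ?powR_gt0// (@powR_mulrn _ _ 2) ?(ltW x1)// mulrAC -exprD.
  by rewrite (le_trans (HM _ (ltW x0)))// (le_trans (ler_norm M))// lerDl.
have xn1 : x ^+ n.+1 <= (1 + x) ^+ n.+1 by rewrite lerXn2r ?nnegrE ?(ltW x0) ?(ltW x1)// lerDr.
have xn : x ^+ n * (1 + x) <= (1 + x) ^+ n.+1.
  by rewrite exprSr ler_wpM2r ?(ltW x1)// lerXn2r ?nnegrE ?(ltW x0) ?(ltW x1)// lerDr.
have xn0 : 0 <= x ^+ n by rewrite exprn_ge0 ?ltW.
have sc (y A : R) : `|y| <= A -> 0 <= A -> A * x ^+ n <= (K + p + 1) * (1 + x) ^+ n.+1 ->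
    `|x ^+ n * (expR (- (K * v * cos th)) * y)| <= (K + p + 1) * (`|M| + 1) * (1 + x) `^ (- 2).
  move=> yA A0 HA; rewrite !normrM (ger0_norm xn0) (ger0_norm (expR_ge0 _)).
  apply: (@le_trans _ _ (x ^+ n * (E * A))).
    by rewrite ler_wpM2l// ler_pM// expR_ge0.
  rewrite (_ : _ * (E * A) = A * x ^+ n * E); last by ring.
  apply: (@le_trans _ _ ((K + p + 1) * (1 + x) ^+ n.+1 * E)); first by rewrite ler_wpM2r.
  by rewrite -!mulrA ler_wpM2l ?mulrA// !addr_ge0// ltW.
have le1 (y : R) : `|cos y| <= 1 by rewrite ler_norml cos_geN1 cos_le1.
have Kp1 : 1 <= K + p + 1 by rewrite lerDr addr_ge0// ltW.
have big0 : 0 <= (1 + x) ^+ n.+1 by rewrite exprn_ge0 ?ltW.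
split.
- apply: (sc _ 1) => //; first by rewrite ler_norml sin_geN1 sin_le1.
  rewrite mul1r (@le_trans _ _ ((1 + x) ^+ n.+1))// ?ler_peMl//.
  by rewrite (le_trans _ xn)// ler_peMr// lerDl ltW.
- apply: (sc _ (K * v + p)).
  + rewrite (le_trans (ler_normB _ _))// lerD// normrM ger0_norm ?(ltW p0) ?mulr_ge0 ?(ltW K0)//.
    * by rewrite ler_piMr// mulr_ge0// ltW.
    * by rewrite ler_piMr// ltW.
  + by rewrite addr_ge0 ?mulr_ge0// ltW.
  + apply: (@le_trans _ _ ((K + p + 1) * (1 + x) * x ^+ n)); last first.
      by rewrite -mulrA [(1 + x) * _]mulrC ler_wpM2l// (le_trans _ Kp1).
    rewrite ler_wpM2r//.
    have : K * v <= K * (1 + x) by rewrite ler_wpM2l// ltW.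
    have : p * 1 <= p * (1 + x) by rewrite ler_wpM2l ?(ltW p0)// lerDl ltW.
    by have := x1; nra.
- rewrite (_ : _ * C _ _ = x ^+ n * (expR (- (K * v * cos th)) * (x * cos (ang th v)))); last first.
    by rewrite /C exprSr; ring.
  apply: (sc _ x); [|exact: ltW|].
    by rewrite normrM (gtr0_norm x0) ler_piMr ?(ltW x0).
  rewrite -exprS (le_trans xn1)// ler_peMl//.
Qed.
Let cang (th : R) : continuous (ang th).
Proof.
move=> v; apply: cvgB; last exact: cvg_cst.
by apply: cvgM; [apply: cvgM; [exact: cvg_cst|exact: cvg_id]|exact: cvg_cst].
Qed.

Let ce (th : R) : continuous (fun v : R => expR (- (K * v * cos th))).
Proof.
move=> v; apply: (continuous_comp (f := fun v : R => - (K * v * cos th)) (g := expR)).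
  apply: cvgN; apply: cvgM; last exact: cvg_cst.
  by apply: cvgM; [exact: cvg_cst|exact: cvg_id].
exact: continuous_expR.
Qed.

Let cvg_x (f : R -> R) x : continuous f -> 0 < x ->
  {for x, continuous (fun y : R => y ^+ n * f (y `^ a))}.
Proof.
move=> cf x0; apply: cvgM; first exact: exprn_continuous.
by apply: (continuous_comp (f := fun y : R => y `^ a)); [exact: continuous_powR|exact: cf].
Qed.

Let cS (th : R) : continuous (S th).
Proof.
move=> v; apply: cvgM; first exact: ce.
by apply: (continuous_comp (f := ang th) (g := sin)); [exact: cang|exact: continuous_sin].
Qed.

Let cT (th : R) : continuous (T th).
Proof.
move=> v; apply: cvgM; first exact: ce.
apply: cvgB; apply: cvgM.
- by apply: cvgM; [exact: cvg_cst|exact: cvg_id].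
- apply: (continuous_comp (f := fun v => ang th v - th) (g := cos)).
    by apply: cvgB; [exact: cang|exact: cvg_cst].
  exact: continuous_cos.
- exact: cvg_cst.
- by apply: (continuous_comp (f := ang th) (g := cos)); [exact: cang|exact: continuous_cos].
Qed.

Let integrable_bounded (f : R -> R) M : (forall x, 0 < x -> {for x, continuous f}) ->
  (forall x, 0 < x -> `|f x| <= M * (1 + x) `^ (- 2)) ->
  leb.-integrable `]0%R, +oo[%classic (EFin \o f).
Proof.
move=> cf fM; apply: (@integrable_oy R f 1 M) => // x x0.
rewrite subrr powRr0 mul1r (_ : - 1 - 1 = - 2 :> R); last by ring.
exact: fM.
Qed.

(** - a x^n T is the derivative in x of x^(n + 1) C, thanks to a p = n + 1, and x^(n + 1) C vanishes
    at both ends. *)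
Let integral_T (th k0 : R) : 0 < k0 -> k0 <= cos th ->
  (\int[leb]_(x in `]0%R, +oo[) (x ^+ n * T th (x `^ a))%:E = 0)%E.
Proof.
move=> k0_gt0 kth; have [M M0 HM] := dominated k0_gt0.
pose q x := - a * (x ^+ n * T th (x `^ a)).
have cq x : 0 < x -> {for x, continuous q}.
  by move=> x0; apply: cvgM; [exact: cvg_cst|exact: (cvg_x (@cT th))].
have iT : leb.-integrable `]0%R, +oo[%classic
    (EFin \o (fun x : R => x ^+ n * T th (x `^ a))).
  apply: (integrable_bounded (M := M)) => [x x0|x x0]; first exact: (cvg_x (@cT th)).
  by have [] := HM th x kth x0.
have iq : leb.-integrable `]0%R, +oo[%classic (EFin \o q).
  by apply: (integrableZl _ (- a) iT) => //; exact: measurable_itv.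
have dq x : 0 < x -> is_derive x 1 (fun y : R => y ^+ n.+1 * C th (y `^ a)) (q x).
  move=> x0; have d1 := @is_derive1_comp _ (C th) (fun y : R => y `^ a) x _ _
    (dC th (x `^ a)) (is_derive1_powR a x0).
  have d2 : is_derive x 1 (fun y : R => y ^+ n.+1) (n.+1%:R * x ^+ n).
    apply: DeriveDef; first exact: exprn_derivable.
    by rewrite exp_derive [LHS]mulr1.
  apply: (is_derive_eq (is_deriveM d2 d1)).
  rewrite /q /T /C /= -![_ *: _]/(_ * _).
  have xa : x * x `^ (a - 1) = x `^ a by rewrite -{1}(powRr1 (ltW x0)) -powR_gt0D// addrC subrK.
  rewrite exprS -ap -xa; ring.
have C1 x : 0 < x -> `|C th (x `^ a)| <= 1.
  move=> x0; rewrite /C normrM mulr_ile1//; last by rewrite ler_norml cos_geN1 cos_le1.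
  rewrite ger0_norm ?expR_ge0// -[leRHS]expR0 ler_expR oppr_le0.
  by rewrite !mulr_ge0 ?powR_ge0 ?(ltW K0)// (le_trans _ kth)// ltW.
have l0 : x ^+ n.+1 * C th (x `^ a) @[x --> 0^'+] --> (0 : R).
  have X0 : x ^+ n.+1 @[x --> (0 : R)^'+] --> (0 : R).
    rewrite -[X in _ --> X](@expr0n R n.+1); apply: cvg_at_right_filter.
    exact: exprn_continuous.
  apply: (squeeze_cvgr (f := fun x => - x ^+ n.+1) (h := fun x => x ^+ n.+1)) (X0) => //.
    near=> x; have x0 : 0 < x by near: x; exact: nbhs_right_gt.
    have xn0 : 0 <= x ^+ n.+1 by rewrite exprn_ge0 ?ltW.
    by rewrite -ler_norml normrM (ger0_norm xn0) ler_piMr// C1.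
  by rewrite -[X in _ --> X]oppr0; exact: cvgN.
have l1 : x ^+ n.+1 * C th (x `^ a) @[x --> +oo] --> (0 : R).
  apply/cvgrPdist_le => e e0; near=> x.
  have x0 : 0 < x by near: x; exact: nbhs_pinfty_gt.
  have x1 : 0 < 1 + x by rewrite addr_gt0.
  rewrite sub0r normrN; have [_ _ /le_trans] := HM th x kth x0; apply.
  rewrite powRN ler_pdivrMr ?powR_gt0// (@powR_mulrn _ _ 2) ?(ltW x1)//.
  have : M / e <= x by near: x; apply: nbhs_pinfty_ge; exact: num_real.
  by rewrite ler_pdivrMr// => h; nra.
have := integrable_FTC_oy iq cq dq l0 l1; rewrite subrr /q.
under eq_integral do rewrite EFinM.
rewrite integralZl//.
move=> /eqP; rewrite mule_eq0 eqe oppr_eq0 gt_eqF//= => /eqP.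
by [].
Unshelve. all: by end_near. Qed.
Let integrable_S (th k0 : R) : 0 < k0 -> k0 <= cos th ->
  leb.-integrable `]0%R, +oo[%classic (EFin \o (fun x : R => x ^+ n * S th (x `^ a))).
Proof.
move=> k0_gt0 kth; have [M M0 HM] := dominated k0_gt0.
apply: (integrable_bounded (M := M)) => [x x0|x x0]; first exact: (cvg_x (@cS th)).
by have [] := HM th x kth x0.
Qed.

Let integral_S (th : R) : 0 <= th < pi / 2 ->
  (\int[leb]_(x in `]0%R, +oo[) (x ^+ n * S th (x `^ a))%:E = 0)%E.
Proof.
(* The midpoint [th1] of th and pi / 2 makes ]- th1, th1[ an open interval around [0, th] on which
   cos is at least cos th1 > 0. *)
move=> /andP[th0 thpi]; pose th1 := (th + pi / 2) / 2.
have pi0 := pi_gt0 R.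
have th1_gt : th < th1 by rewrite /th1; lra.
have th1_lt : th1 < pi / 2 by rewrite /th1; lra.
have k0_gt0 : 0 < cos th1 by apply: cos_gt0_pihalf; apply/andP; split; lra.
have kcos t : t \in `]- th1, th1[%R -> cos th1 <= cos t.
  rewrite in_itv/= => /andP[t1 t2].
  have [t0|/ltW t0] := leP 0 t.
    by rewrite ltW// ltr_cos ?in_itv/=//; apply/andP; split; lra.
  rewrite -(cosN t) ltW// ltr_cos ?in_itv/=; [lra|apply/andP; split; lra|apply/andP; split; lra].
have [M M0 HM] := dominated k0_gt0.
pose D : set (measurableTypeR R) := `]0%R, +oo[%classic.
have mD : measurable D by exact: measurable_itv.
pose G x := M * (1 + x) `^ (- 2).
have G0 (x : R) : 0 <= G x by rewrite mulr_ge0 ?powR_ge0// ltW.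
have iG : leb.-integrable D (EFin \o G).
  apply: (integrable_bounded (M := M)) => [x x0|x x0]; last by rewrite ger0_norm.
  apply: cvgM; first exact: cvg_cst.
  apply: (continuous_comp (f := fun y : R => 1 + y) (g := fun y : R => y `^ (- 2))).
    by apply: cvgD; [exact: cvg_cst|exact: cvg_id].
  by apply: continuous_powR; rewrite addr_gt0.
pose f t (x : measurableTypeR R) := x ^+ n * S t (x `^ a).
pose F t := (\int[leb]_(x in D) f t x)%R.
have df t (x : measurableTypeR R) : is_derive t 1 (f ^~ x) (x ^+ n * T t (x `^ a)).
  exact: (is_deriveZ (x ^+ n) (dS t (x `^ a))).
have d1f t (x : measurableTypeR R) : partial1of2 f t x = x ^+ n * T t (x `^ a).
  by rewrite partial1of2E; apply: derive_val.
have dF t : t \in `]- th1, th1[%R -> is_derive t 1 F 0.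
  move=> tI.
  have It : `]- th1, th1[%classic t by [].
  have intf u : `]- th1, th1[%classic u -> leb.-integrable D (EFin \o f u).
    by move=> uI; apply: (integrable_S k0_gt0); exact: kcos.
  have derf u x : `]- th1, th1[%classic u -> D x -> derivable (f ^~ x) u 1.
    by move=> _ _; have := df u x => -[].
  have G_ub u x : `]- th1, th1[%classic u -> D x -> `|partial1of2 f u x| <= G x.
    move=> uI; rewrite /D/= in_itv/= andbT => x0; rewrite d1f.
    by have [] := HM u x (kcos u uI) x0.
  apply: DeriveDef.
    exact: (derivable_under_integral mD It intf derf G0 iG G_ub).
  rewrite -derive1E (differentiation_under_integral mD It intf derf G0 iG G_ub).
  rewrite /Rintegral (_ : (\int[leb]_(x in D) _ = 0)%E)//.
  under eq_integral do rewrite d1f.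
  exact: (integral_T k0_gt0 (kcos t tI)).
have F0 : F 0 = 0.
  rewrite /F /Rintegral (_ : (\int[leb]_(x in D) _ = 0)%E)//.
  apply: integral0_eq => x _.
  by rewrite /f /S /ang sin0 mulr0 mulr0 subrr sin0 !mulr0.
suff Fth : F th = 0.
  have := integrable_fin_num mD (integrable_S k0_gt0 (kcos th _)).
  rewrite in_itv/=; move=> H.
  have fin : (\int[leb]_(x in D) (f th x)%:E)%E \is a fin_num.
    by apply: H; apply/andP; split; lra.
  by rewrite -[LHS](fineK fin) [fine _]Fth.
move: th0; rewrite le_eqVlt => /predU1P[<-//|th0].
have dF' t : t \in `]0, th[%R -> is_derive t 1 F 0.
  by rewrite in_itv/= => /andP[t0 t1]; apply: dF; rewrite in_itv/=; apply/andP; split; lra.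
have cF : {within `[0, th], continuous F}.
  apply: derivable_within_continuous => t; rewrite in_itv/= => /andP[t0 t1].
  by have [] : is_derive t 1 F 0 by apply: dF; rewrite in_itv/=; apply/andP; split; lra.
have [c _] := MVT th0 dF' cF.
by rewrite F0 mul0r subr0.
Qed.

Let alternate_sin (y : R) k : sin (y - k%:R * pi) = (-1) ^+ k * sin y.
Proof.
elim: k => [|k IH]; first by rewrite mul0r subr0 expr0 mul1r.
have E : y - k%:R * pi = y - k.+1%:R * pi + pi by rewrite -natr1; ring.
by move: IH; rewrite E sinDpi exprS mulN1r mulNr => <-; rewrite opprK.
Qed.

(* at th = a pi the phase p th is an integer multiple of pi *)
Lemma stretched_sin_moment : a < 2^-1 ->
  let h x := expR (- (K * x `^ a * cos (a * pi))) * sin (K * x `^ a * sin (a * pi)) in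
  leb.-integrable `]0%R, +oo[%classic (fun x => (x ^+ n * h x)%:E) /\
  (\int[leb]_(x in `]0%R, +oo[) (x ^+ n * h x)%:E = 0)%E.
Proof.
move=> a2 h; have pi0 := pi_gt0 R.
have thE : 0 <= a * pi < pi / 2 by rewrite mulr_ge0 ?(ltW a0) ?(ltW pi0)//= mulrC ltr_pM2l.
have E x : x ^+ n * h x = (-1) ^+ n.+1 * (x ^+ n * S (a * pi) (x `^ a)).
  rewrite /S /ang [p * _]mulrA (mulrC p) ap alternate_sin /h.
  rewrite [RHS](_ : _ = (-1) ^+ n.+1 * (-1) ^+ n.+1 *
    (x ^+ n * (expR (- (K * x `^ a * cos (a * pi))) *
    sin (K * x `^ a * sin (a * pi))))); last by ring.
  by rewrite -expr2 sqrr_sign mul1r.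
have k0 : 0 < cos (a * pi).
  by case/andP: thE => t0 t1; apply: cos_gt0_pihalf; rewrite t1 andbT; lra.
have iS := integrable_S k0 (lexx _).
have -> : (fun x : R => (x ^+ n * h x)%:E) =
    (fun x : R => ((-1) ^+ n.+1)%:E * (x ^+ n * S (a * pi) (x `^ a))%:E)%E.
  by apply/funext => x; rewrite E.
split; first by apply: integrableZl => //; exact: measurable_itv.
by rewrite integralZl// integral_S// mule0.
Qed.

End stretched_exponential.

(** * The kernel y Z^2 and its minorant *)

Section gamma_mixture_density.
Context {R : realType}.
Local Notation leb := (@lebesgue_measure R).
Implicit Types x y : R.

(* Density at x > 0 of y Z^2 with Z a standard normal variable. It vanishes at
   y = 0, since 0 `^ (- 2^-1) = 0. *)
Definition chi_density x y : R :=
  (2 * pi) `^ (- 2^-1) * (x `^ (- 2^-1) *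
    (y `^ (- 2^-1) * expR (- (2^-1 * (x * y `^ (- 1)))))).

Lemma chi_density_ge0 x y : 0 <= chi_density x y.
Proof. by rewrite !mulr_ge0 ?powR_ge0 ?expR_ge0. Qed.

(** For y < y0 the left-hand side is at most 0. For y >= y0 one has y^(- 1/2) >= 1 / y and exp (- x
    / (2 y)) >= exp (- x / (2 y0)), and (A - y^(n + 1))^2 >= 0 bounds 1 / y below by (2 y^n - y^(2n
    + 1) / A) / A. Only two powers of y remain, so the bound can be averaged knowing moments
    alone. *)
Lemma chi_density_lower x y y0 A n : 0 < x -> 0 <= y -> 1 <= y0 -> 0 < A ->
  (2 * pi) `^ (- 2^-1) * x `^ (- 2^-1) * expR (- (x / (2 * y0))) *
    ((2 * y ^+ n - 2 * y0 ^+ n - y ^+ n.*2.+1 / A) / A) <= chi_density x y.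
Proof.
move=> x0 y_ge0 y01 A0; have y0_gt0 : 0 < y0 by exact: lt_le_trans y01.
rewrite /chi_density -!mulrA ler_wpM2l ?powR_ge0// ler_wpM2l ?powR_ge0//.
have [yy0|y0y] := ltP y y0.
  apply: (@le_trans _ _ 0); last by rewrite mulr_ge0 ?powR_ge0 ?expR_ge0.
  rewrite mulr_ge0_le0 ?expR_ge0// mulr_le0_ge0 ?invr_ge0 ?(ltW A0)//.
  have h1 : y ^+ n <= y0 ^+ n by rewrite lerXn2r ?nnegrE ?(ltW yy0) ?(ltW y0_gt0).
  have h2 : 0 <= y ^+ n.*2.+1 / A by rewrite divr_ge0 ?exprn_ge0// ltW.
  by lra.
have yge1 : 1 <= y by exact: le_trans y0y.
have y_gt0 : 0 < y by exact: lt_le_trans yge1.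
rewrite mulrC; apply: (@le_trans _ _ (y `^ (- 1) * expR (- (x / (2 * y0))))).
  rewrite ler_wpM2r ?expR_ge0// powR_inv1 ?(ltW y_gt0)//.
  rewrite ler_pdivrMr// ler_pdivlMl// -subr_ge0.
  have h : 0 <= y0 ^+ n by rewrite exprn_ge0 ?ltW.
  have -> : y ^+ n.*2.+1 = y ^+ n * y ^+ n * y by rewrite exprSr -addnn exprD.
  rewrite (_ : _ - _ = ((A - y ^+ n * y) ^+ 2 + 2 * y0 ^+ n * y * A) / A); last first.
    by field; rewrite gt_eqF.
  by rewrite divr_ge0 ?(ltW A0)// addr_ge0 ?sqr_ge0// !mulr_ge0// ltW.
apply: ler_pM; rewrite ?powR_ge0 ?expR_ge0//.
  by rewrite ler_powR//; lra.
rewrite ler_expR lerN2 powR_inv1 ?(ltW y_gt0)// invfM mulrCA.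
by rewrite ler_wpM2l ?(ltW x0)// ler_wpM2l// lef_pV2.
Qed.

(** A Gamma integral of order n + 1/2. The value at y = 0 is 0 even for n = 0, which leaves the mass
    of Y at 0 to a separate atom. *)
Lemma integral_chi_density y n : 0 <= y ->
  (\int[leb]_(x in `]0%R, +oo[) (x ^+ n * chi_density x y)%:E =
   ((0 < y)%R%:R * (y ^+ n * (odd_double_fact n)%:R))%:E)%E.
Proof.
rewrite le_eqVlt => /predU1P[<-|y0].
  rewrite ltxx mul0r; apply: integral0_eq => x _.
  by rewrite /chi_density powR0 ?mul0r ?mulr0// oppr_eq0 invr_eq0 pnatr_eq0.
rewrite y0 mul1r.
have h0 : 0 < n%:R + 2^-1 :> R by rewrite ltr_wpDl// invr_gt0.
have l0 : 0 < 2^-1 * y `^ (- 1) by rewrite mulr_gt0 ?powR_gt0// invr_gt0.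
pose k := (2 * pi) `^ (- 2^-1) * y `^ (- 2^-1).
transitivity (\int[leb]_(x in `]0%R, +oo[)
    (k%:E * (x `^ (n%:R + 2^-1 - 1) * expR (- (2^-1 * y `^ (- 1) * x)))%:E))%E.
  apply: eq_integral => x; rewrite inE/= in_itv/= andbT => x0.
  rewrite -EFinM; congr EFin; rewrite /chi_density.
  rewrite (_ : n%:R + 2^-1 - 1 = n%:R + - 2^-1); last by field.
  rewrite (_ : 2^-1 * (x * y `^ (- 1)) = 2^-1 * y `^ (- 1) * x); last by ring.
  by rewrite powR_gt0D// powR_mulrn ?(ltW x0)// /k; ring.
rewrite ge0_integralZl//; last 3 first.
- by have /measurable_int := integrable_powR_expR h0 l0.
- by move=> x _; rewrite lee_fin mulr_ge0 ?powR_ge0 ?expR_ge0.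
- by rewrite lee_fin mulr_ge0 ?powR_ge0.
rewrite Gamma_scale// -EFinM; congr EFin.
rewrite -odd_double_Gamma_nat /odd_double_Gamma /k.
have -> : (2^-1 * y `^ (- 1)) `^ (- (n%:R + 2^-1)) =
    2 `^ n%:R * 2 `^ 2^-1 * (y ^+ n * y `^ 2^-1).
  rewrite -[X in X * _](powR_inv1 (ler0n R 2)) -powRM ?(ltW y0)// -powRrM mulN1r opprK.
  by rewrite powRM ?(ltW y0)// !powR_gt0D// [y `^ n%:R]powR_mulrn ?(ltW y0).
rewrite powRM ?pi_ge0// !powRN (powR12_sqrt (pi_ge0 R)).
have h1 : 2 `^ 2^-1 != 0 :> R by rewrite gt_eqF ?powR_gt0.
have h2 : y `^ 2^-1 != 0 by rewrite gt_eqF ?powR_gt0.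
have h3 : Num.sqrt pi != 0 :> R by rewrite gt_eqF ?sqrtr_gt0 ?pi_gt0.
by field; rewrite h1 h2 h3.
Qed.

End gamma_mixture_density.

(** * The law of Y Z^2, its lower bound and the two solutions *)

Section mixture.
Context {R : realType} d (T : measurableType d) (P : probability T R) (Y : T -> R).
Local Notation leb := (@lebesgue_measure R).
Local Notation RB := (measurableTypeR R).
Variable b : R.
Hypotheses (b1 : 1 < b) (YM : is_mellin P Y (fun s => odd_double_Gamma s `^ b)).
Implicit Types x y : R.

Let D n : R := (odd_double_fact n)%:R.
Let m n : R := D n `^ b.
Let c : R := b + 1.

Let b0 : 0 < b. Proof. exact: lt_trans b1. Qed.

Let mY : measurable_fun setT Y. Proof. by case: YM. Qed.

Let Y0 t : 0 <= Y t. Proof. by case: YM. Qed.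

Let D0 n : 0 < D n. Proof. by rewrite ltr0n odd_double_fact_gt0. Qed.

Let m0 n : 0 < m n. Proof. exact: powR_gt0. Qed.

Let Ym n : (\int[P]_t (Y t ^+ n)%:E = (m n)%:E)%E.
Proof.
have [_ _ H] := YM; rewrite /m /D -odd_double_Gamma_nat -H//.
by apply: eq_integral => t _; rewrite powR_mulrn.
Qed.

Let mYX n : measurable_fun setT (fun t => (Y t ^+ n)%:E).
Proof. by apply/measurable_EFinP; exact: measurable_funX. Qed.

Let joint_measurable :
  measurable_fun setT (fun z : RB * T => (chi_density z.1 (Y z.2))%:E).
Proof.
have m1 : measurable_fun setT (fun z : RB * T => z.1 : R) by exact: measurable_fst.
have m2 : measurable_fun setT (fun z : RB * T => Y z.2).
  exact: (measurableT_comp mY measurable_snd).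
have mp (Z : RB * T -> R) s : measurable_fun setT Z -> measurable_fun setT (fun z => Z z `^ s).
  by move=> mZ; exact: (measurableT_comp (measurable_powR s) mZ).
apply/measurable_EFinP; apply: measurable_funM => //.
apply: measurable_funM; first exact: mp.
apply: measurable_funM; first exact: mp.
apply: measurableT_comp => //; apply: measurableT_comp => //.
apply: measurable_funM => //; apply: measurable_funM => //; exact: mp.
Qed.

Let mchi x : measurable_fun setT (fun t => (chi_density x (Y t))%:E).
Proof.
have mp (Z : T -> R) s : measurable_fun setT Z -> measurable_fun setT (fun z => Z z `^ s).
  by move=> mZ; exact: (measurableT_comp (measurable_powR s) mZ).
apply/measurable_EFinP; apply: measurable_funM => //; apply: measurable_funM => //.
apply: measurable_funM; first exact: mp.
apply: measurableT_comp => //; apply: measurableT_comp => //.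
apply: measurable_funM => //; apply: measurable_funM => //; exact: mp.
Qed.

Let f x : \bar R := (\int[P]_t (chi_density x (Y t))%:E)%E.

Let f_ge0 x : (0 <= f x)%E.
Proof. by apply: integral_ge0 => t _; rewrite lee_fin chi_density_ge0. Qed.

Let measurable_f : measurable_fun (setT : set RB) f.
Proof.
apply: (@measurable_fun_fubini_tonelli_F _ _ RB T R P
  (fun z : RB * T => (chi_density z.1 (Y z.2))%:E) joint_measurable).
by move=> z; rewrite lee_fin chi_density_ge0.
Qed.

Let atom : R := fine (P (Y @^-1` [set 0])).

(** Tonelli's theorem. The density misses the event Y = 0, which is an atom at 0 of the law of Y Z^2
    and counts for n = 0 only, as 0 ^+ 0 = 1. *)
Let moment_f n : (\int[leb]_(x in `]0%R, +oo[) ((x ^+ n)%:E * f x) +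
  (atom * 0 ^+ n)%:E = (D n `^ c)%:E)%E.
Proof.
pose B : set RB := `]0%R, +oo[%classic.
have mB : measurable B by exact: measurable_itv.
have mX : measurable_fun setT (fun x : RB => x ^+ n) by exact: measurable_funX.
pose g (z : RB * T) : \bar R := (\1_B z.1 * (z.1 ^+ n * chi_density z.1 (Y z.2)))%:E.
have g0 z : (0 <= g z)%E.
  rewrite lee_fin indicE; have [|_] := boolP (z.1 \in B); last by rewrite mul0r.
  rewrite inE /B/= in_itv/= andbT => z0.
  by rewrite mul1r mulr_ge0 ?chi_density_ge0// exprn_ge0 ?ltW.
have mg : measurable_fun setT g.
  apply/measurable_EFinP; apply: measurable_funM.
    by apply: measurableT_comp => //; exact: measurable_fst.
  apply: measurable_funM; last by have /measurable_EFinP := joint_measurable.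
  by apply: measurable_funX; exact: measurable_fst.
transitivity (\int[leb]_x (\int[P]_t g (x, t)) + (atom * 0 ^+ n)%:E)%E.
  congr (_ + _)%E; rewrite [LHS]integral_mkcond; apply: eq_integral => x _.
  rewrite patchE /g/= indicE; case: ifPn => xB; last first.
    by apply/esym/integral0_eq => t _; rewrite mul0r.
  under eq_integral do rewrite mul1r EFinM.
  rewrite ge0_integralZl//; first by move=> t _; rewrite lee_fin chi_density_ge0.
  move: xB; rewrite inE /B/= in_itv/= andbT => x0.
  by rewrite lee_fin exprn_ge0 ?ltW.
rewrite (fubini_tonelli g mg g0).
pose Z : set T := Y @^-1` [set 0].
have mZ : measurable Z by rewrite -[Z]setTI; exact: mY.
have E t : (\int[leb]_x g (x, t) = (\1_(~` Z) t * (Y t ^+ n * D n))%:E)%E.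
  transitivity (((0 < Y t)%R%:R * (Y t ^+ n * D n))%:E).
    rewrite -integral_chi_density// [RHS]integral_mkcond; apply: eq_integral => x _.
    rewrite patchE /g/= indicE; case: ifPn => xB; first by rewrite mul1r.
    by rewrite mul0r.
  rewrite indicE in_setC lt0r Y0 andbT; congr ((~~ _)%:R * _)%:E.
  by apply/idP/idP; [move=> /eqP Yt; rewrite inE|rewrite inE => /eqP].
under eq_integral do rewrite E.
have -> : ((atom * 0 ^+ n)%:E = \int[P]_t (0 ^+ n * \1_Z t)%:E)%E.
  under eq_integral do rewrite EFinM.
  rewrite ge0_integralZl ?lee_fin ?exprn_ge0//; last first.
    exact/measurable_EFinP/measurable_indic.
  by rewrite integral_indic// setIT mulrC EFinM /atom fineK ?fin_num_measure.
have mYn : measurable_fun setT (fun t => Y t ^+ n) by exact: measurable_funX.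
rewrite -ge0_integralD//; last 3 first.
- by move=> t _; rewrite lee_fin !mulr_ge0 ?exprn_ge0 ?(ltW (D0 n)).
- apply/measurable_EFinP; apply: measurable_funM; last exact: measurable_funM.
  exact/measurable_indic/measurableC.
- by apply/measurable_EFinP; apply: measurable_funM => //; exact: measurable_indic.
transitivity (\int[P]_t ((D n)%:E * (Y t ^+ n)%:E))%E; last first.
  rewrite ge0_integralZl ?Ym// ?lee_fin ?(ltW (D0 n))//.
    by rewrite -EFinM /c powR_gt0D// powRr1 ?(ltW (D0 n))// mulrC.
  by move=> t _; rewrite lee_fin exprn_ge0.
apply: eq_integral => t _; rewrite -EFinD -EFinM; congr EFin; rewrite !indicE in_setC.
have := Y0 t; rewrite le_eqVlt => /predU1P[Yt|Yt].
  have -> : t \in Z by rewrite inE.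
  rewrite mul0r add0r mulr1 -Yt.
  by case: (n) => [|j]; rewrite expr0n ?mulr0// /D odd_double_fact0 mulr1.
have -> : t \in Z = false.
  by apply/negP; rewrite inE /Z/= => Yt0; move: Yt; rewrite Yt0 ltxx.
by rewrite mul1r mulr0 addr0 mulrC.
Qed.

(** The minorant of the kernel is averaged over Y. The condition 4 y0^n <= m n ensures that the term
    in y0 costs at most half of the main term. *)
Let f_lower x y0 n : 0 < x -> 1 <= y0 -> 4 * y0 ^+ n <= m n ->
  (((2 * pi) `^ (- 2^-1) * x `^ (- 2^-1) * expR (- (x / (2 * y0))) *
    (m n ^+ 2 / (2 * m n.*2.+1)))%:E <= f x)%E.
Proof.
move=> x0 y01 y0m; have y0_gt0 : 0 < y0 by exact: lt_le_trans y01.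
pose k := (2 * pi) `^ (- 2^-1) * x `^ (- 2^-1) * expR (- (x / (2 * y0))).
have k0 : 0 <= k by rewrite !mulr_ge0 ?powR_ge0 ?expR_ge0.
(* The choice that maximizes 2 m n / A - m (2n + 1) / A^2; the maximum is (m n)^2 / m (2n + 1). *)
pose A := m n.*2.+1 / m n; have A0 : 0 < A by rewrite divr_gt0.
pose u : R := 2 * k / A; have u0 : 0 <= u.
  by apply: divr_ge0; [exact: mulr_ge0|exact: ltW].
pose v : R := 2 * k * y0 ^+ n / A.
have v0 : 0 <= v.
  apply: divr_ge0; last exact: ltW.
  by apply: mulr_ge0; [exact: mulr_ge0|rewrite exprn_ge0// ltW].
pose w : R := k / A ^+ 2; have w0 : 0 <= w by apply: divr_ge0 => //; exact: sqr_ge0.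
have mk (r : R) j : measurable_fun setT (fun t => (r%:E * (Y t ^+ j)%:E)%E).
  by apply: emeasurable_funM.
have Yk (r : R) j : 0 <= r -> (\int[P]_t (r%:E * (Y t ^+ j)%:E) = (r * m j)%:E)%E.
  move=> r0; rewrite ge0_integralZl// ?Ym ?EFinM//.
  by move=> t _; rewrite lee_fin exprn_ge0.
(* The negative terms of the minorant are moved to the other side, so that only nonnegative
   integrands occur. *)
have H : (\int[P]_t (u%:E * (Y t ^+ n)%:E) <=
    \int[P]_t ((chi_density x (Y t))%:E +
       (v%:E * (Y t ^+ 0)%:E + w%:E * (Y t ^+ n.*2.+1)%:E)))%E.
  apply: ge0_le_integral => //.
  - by move=> t _; rewrite -EFinM lee_fin mulr_ge0 ?exprn_ge0.
  - by apply: emeasurable_funD => //; exact: emeasurable_funD.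
  - move=> t _; rewrite -!EFinM -!EFinD lee_fin -lerBlDr.
    apply: le_trans (chi_density_lower n x0 (Y0 t) y01 A0).
    rewrite -/k le_eqVlt; apply/orP; left; apply/eqP.
    by rewrite /u /v /w; field; rewrite gt_eqF.
move: H; rewrite ge0_integralD//; last 3 first.
- by move=> t _; rewrite lee_fin chi_density_ge0.
- by move=> t _; rewrite -!EFinM -!EFinD lee_fin addr_ge0// mulr_ge0// exprn_ge0.
- by apply: emeasurable_funD.
rewrite ge0_integralD//; last 2 first.
- by move=> t _; rewrite -EFinM lee_fin mulr_ge0// exprn_ge0.
- by move=> t _; rewrite -EFinM lee_fin mulr_ge0// exprn_ge0.
rewrite !Yk// -EFinD -leeBlDr// -EFinB; apply: le_trans; rewrite lee_fin.
have -> : m 0 = 1 by rewrite /m /D odd_double_fact0 powR1.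
have mn0 := m0 n; have mN0 := m0 n.*2.+1.
rewrite -/k /u /v /w /A.
rewrite (_ : _ - _ = k * (m n * (m n - 2 * y0 ^+ n) / m n.*2.+1)); last first.
  by field; rewrite !gt_eqF.
rewrite ler_wpM2l// invfM mulrA ler_wpM2r ?invr_ge0 ?(ltW mN0)//.
rewrite expr2 -mulrA ler_wpM2l ?(ltW mn0)//; lra.
Qed.

Let c0 : 0 < c. Proof. by rewrite addr_gt0. Qed.

(** With u = (1 + x)^(1/c) every loss is of the form exp (- const u), and u <= 1 + x^(1/c). The
    choice y0 = u^b gives x / y0 <= u because u^c = u u^b, and n is taken proportional to u, so that
    the moment quotient, at least 16^(- b n) up to the factor 1/2, is such a loss too. *)
Let f_stretched : exists2 k : R, 0 < k & exists2 dl : R, 0 < dl &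
  forall x, 0 < x -> ((dl * expR (- (k * x `^ c^-1)))%:E <= f x)%E.
Proof.
pose q : R := 4 * expR 1 + 1.
have q0 : 0 < q by rewrite addr_gt0// mulr_gt0// expR_gt0.
have l16 : 0 < ln 16 :> R by rewrite ln_gt0// ltr1n.
have one r : 1 `^ r = 1 :> R by rewrite powR1.
(* The three terms come from x^(- 1/2), from exp (- x / (2 y0)) and from the moment quotient. *)
pose k := c / 2 + 2^-1 + q * (b * ln 16).
have k0 : 0 < k by rewrite !addr_gt0 ?divr_gt0 ?mulr_gt0 ?invr_gt0.
exists k => //; exists ((2 * pi) `^ (- 2^-1) * 2^-1 * expR (- k)).
  by rewrite !mulr_gt0 ?invr_gt0 ?expR_gt0 ?powR_gt0 ?mulr_gt0 ?pi_gt0.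
move=> x x0; have x1 : 0 < 1 + x by rewrite addr_gt0.
pose u : R := (1 + x) `^ c^-1.
have u0 : 0 < u by exact: powR_gt0.
have u1 : 1 <= u.
  by rewrite -[leLHS](one c^-1) ge0_ler_powR ?nnegrE ?invr_ge0 ?(ltW c0) ?(ltW x1)// lerDl ltW.
have uc : u `^ c = 1 + x by rewrite -powRrM mulVf ?gt_eqF// powRr1// ltW.
have ux : u <= 1 + x `^ c^-1.
  apply: powR_onePlus_le; last exact: ltW.
  by rewrite invf_le1 ?c0// lerDr ltW.
pose y0 := u `^ b.
have y01 : 1 <= y0.
  by rewrite -[leLHS](one b) ge0_ler_powR ?nnegrE ?(ltW b0) ?(ltW u0).
(* n >= 4 e u turns (n / e)^n into (4 u)^n, and the resulting factor 4^(n b) >= 4 yields the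
   condition on y0. Here n >= 1 matters. *)
pose n := (Num.truncn (4 * expR 1 * u)).+1.
have eu0 : 0 <= 4 * expR 1 * u by rewrite !mulr_ge0 ?expR_ge0 ?(ltW u0).
have n1 : 4 * expR 1 * u <= n%:R by rewrite ltW// truncnS_gt.
have n2 : n%:R <= q * u.
  rewrite /n -natr1 /q [leRHS]mulrDl mul1r lerD//.
  by rewrite truncn_le.
have nm : (4 * u) ^+ n <= D n.
  apply: le_trans (odd_double_fact_lower R n).
  rewrite -(mulr1 (- n%:R)) mulNr -mulrN expRM_natl -exprMn lerXn2r ?nnegrE
    ?mulr_ge0 ?expR_ge0 ?(ltW u0)//.
  by rewrite expRN ler_pdivlMr ?expR_gt0// mulrAC.
have y0m : 4 * y0 ^+ n <= m n.
  apply: (@le_trans _ _ (((4 * u) ^+ n) `^ b)); last first.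
    rewrite ge0_ler_powR ?nnegrE ?(ltW b0) ?(ltW (D0 n)) ?exprn_ge0//.
    by rewrite mulr_ge0 ?(ltW u0).
  rewrite exprMn powRM ?exprn_ge0 ?(ltW u0)//.
  have -> : (u ^+ n) `^ b = y0 ^+ n
    by rewrite -(powR_mulrn n (ltW u0)) -(powR_mulrn n (powR_ge0 u b)) powRAC.
  rewrite ler_wpM2r ?exprn_ge0 ?powR_ge0//.
  apply: (@le_trans _ _ (4 ^+ n)); first by rewrite -[leLHS]expr1 ler_weXn2l// ler1n.
  rewrite -[leLHS]powRr1 ?exprn_ge0// ler_powR ?(ltW b1)//.
  by rewrite exprn_ege1// ler1n.
apply: le_trans (f_lower x0 y01 y0m); rewrite lee_fin.
have mm : 2^-1 * expR (- (q * (b * ln 16) * u)) <= m n ^+ 2 / (2 * m n.*2.+1).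
  have mD : m n.*2.+1 <= expR (n%:R * (b * ln 16)) * m n ^+ 2.
    apply: (@le_trans _ _ ((16 ^+ n * D n ^+ 2) `^ b)).
      rewrite ge0_ler_powR ?nnegrE ?(ltW b0) ?(ltW (D0 _)) ?mulr_ge0 ?exprn_ge0 ?(ltW (D0 _))//.
      by rewrite /D -!natrX -natrM ler_nat odd_double_fact_double.
    rewrite powRM ?exprn_ge0 ?(ltW (D0 n))//.
    rewrite -(powR_mulrn 2 (ltW (D0 n))) powRAC powR_mulrn ?powR_ge0// -/(m n).
    rewrite ler_wpM2r ?sqr_ge0// -powR_mulrn// -powRrM.
    by rewrite /powR pnatr_eq0/= mulrA.
  rewrite invfM [leRHS]mulrCA ler_wpM2l// ler_pdivlMr//.
  apply: (@le_trans _ _ (expR (- (n%:R * (b * ln 16))) * m n.*2.+1)).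
    rewrite ler_wpM2r ?(ltW (m0 _))// ler_expR lerN2 [leRHS]mulrAC ler_wpM2r//.
    by rewrite mulr_ge0 ?(ltW b0) ?(ltW l16).
  by rewrite expRN ler_pdivrMl ?expR_gt0.
have xy : expR (- (2^-1 * u)) <= expR (- (x / (2 * y0))).
  rewrite ler_expR lerN2 invfM mulrCA ler_wpM2l// ler_pdivrMr ?powR_gt0//.
  apply: (@le_trans _ _ (1 + x)); first by rewrite lerDr.
  by rewrite -uc powR_gt0D// powRr1 ?(ltW u0)// mulrC.
have xx : expR (- (c / 2 * u)) <= x `^ (- 2^-1).
  rewrite powRN expRN lef_pV2 ?posrE ?powR_gt0 ?expR_gt0//.
  apply: (@le_trans _ _ ((1 + x) `^ 2^-1)).
    by rewrite ge0_ler_powR ?nnegrE ?(ltW x0) ?(ltW x1) ?invr_ge0// lerDr.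
  rewrite -uc -powRrM (mulrC _ u) expRM ge0_ler_powR ?nnegrE ?expR_ge0 ?(ltW u0)//.
    by rewrite divr_ge0// ltW.
  by rewrite (le_trans _ (expR_ge1Dx u))// lerDr.
pose E1 := expR (- (c / 2 * u)); pose E2 := expR (- (2^-1 * u)).
pose E3 := expR (- (q * (b * ln 16) * u)).
have e0 (r : R) := expR_ge0 r.
apply: (@le_trans _ _ ((2 * pi) `^ (- 2^-1) * E1 * E2 * (2^-1 * E3))); last first.
  apply: ler_pM; [by rewrite !mulr_ge0 ?powR_ge0 ?e0|by rewrite mulr_ge0 ?e0| |exact: mm].
  apply: ler_pM; [by rewrite mulr_ge0 ?powR_ge0 ?e0|exact: e0| |exact: xy].
  by rewrite ler_wpM2l ?powR_ge0.
rewrite (_ : _ * (2^-1 * E3) = (2 * pi) `^ (- 2^-1) * 2^-1 * (E1 * E2 * E3)); last by ring.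
rewrite -[leLHS]mulrA ler_wpM2l ?mulr_ge0 ?powR_ge0//.
rewrite /E1 /E2 /E3 -!expRD ler_expR.
rewrite (_ : _ + _ + _ = - (k * u)); last by rewrite /k; ring.
by rewrite -opprD lerN2 -[X in _ <= X + _]mulr1 -mulrDr ler_wpM2l// ltW.
Qed.

Let B : set RB := `]0%R, +oo[%classic.

Let mB : measurable B. Proof. exact: measurable_itv. Qed.

Let B_gt0 x : B x -> 0 < x.
Proof. by rewrite /B/= in_itv/= andbT. Qed.

Let atom_ge0 : 0 <= atom. Proof. by rewrite fine_ge0. Qed.

Let integrable_f n : leb.-integrable B (fun x => (x ^+ n)%:E * f x)%E.
Proof.
have mf : measurable_fun B (fun x : RB => (x ^+ n)%:E * f x)%E.
  apply: emeasurable_funM; last exact: measurable_funTS.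
  by apply: measurable_funTS; apply/measurable_EFinP; exact: measurable_funX.
apply/integrableP; split => //.
have E : {in B, (fun x => `|(x ^+ n)%:E * f x|)%E =1 (fun x => (x ^+ n)%:E * f x)%E}.
  move=> x; rewrite inE => /B_gt0 x0; rewrite gee0_abs// mule_ge0// lee_fin exprn_ge0//.
  exact: ltW.
rewrite (eq_integral _ _ E); apply: (@le_lt_trans _ _ (D n `^ c)%:E); last exact: ltry.
by rewrite -(moment_f n) leeDl// lee_fin mulr_ge0 ?exprn_ge0.
Qed.

(** Serves for both solutions, with h = 0 for the first. The last clause keeps track of the values
    away from the common atom, where the two are told apart. *)
Let perturbed_measure (h : R -> R) :
  (forall n, leb.-integrable B (fun x => (x ^+ n * h x)%:E) /\
    (\int[leb]_(x in B) (x ^+ n * h x)%:E = 0)%E) ->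
  (forall x, 0 < x -> (0 <= f x + (h x)%:E)%E) ->
  exists mu : {measure set RB -> \bar R},
    has_stieltjes_moments mu (fun n => D n `^ c) /\
    forall A, measurable A -> A `<=` B ->
      mu A = (\int[leb]_(x in A) (f x + (h x)%:E))%E.
Proof.
move=> hn fh.
have mh : measurable_fun B (fun x => (h x)%:E).
  have [/measurable_int] := hn 0%N.
  by under eq_fun do rewrite expr0 mul1r.
pose F : RB -> \bar R := (fun x => f x + (h x)%:E)%E \_ B.
have mF : measurable_fun setT F.
  apply/(measurable_restrictT _ mB).
  by apply: emeasurable_funD => //; exact: measurable_funTS.
have F0 x : (0 <= F x)%E by apply: erestrict_ge0 => y /B_gt0; exact: fh.
pose mu1 := density_measure leb mF F0.
pose mu2 := mscale (NngNum atom_ge0) (\d_(0 : RB)).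
have FB (E : set RB) (g : RB -> \bar R) :
    (\int[leb]_(x in E) (g x * F x) = \int[leb]_(x in E `&` B) (g x * (f x + (h x)%:E)))%E.
  rewrite integral_mkcondr; apply: eq_integral => x _.
  by rewrite /F !patchE; case: ifP => // _; rewrite mule0.
have mu1E (E : set RB) : (mu1 E = \int[leb]_(x in E `&` B) (f x + (h x)%:E))%E.
  transitivity (\int[leb]_(x in E) (1 * F x))%E.
    by apply: eq_integral => x _; rewrite mul1e.
  by rewrite FB; apply: eq_integral => x _; rewrite mul1e.
have not0 (E : set RB) : ~ E 0 -> (mu2 E = 0)%E.
  by move=> E0; rewrite /mu2 /mscale/= diracE memNset// mule0.
pose nu : {measure set RB -> \bar R} := measure_add mu1 mu2.
have nuE (E : set RB) : nu E = (mu1 E + mu2 E)%E by exact: measure_addE.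
exists nu; split; first split.
- rewrite nuE mu1E not0 ?adde0.
    rewrite (_ : _ `&` _ = set0) ?integral_set0//.
    apply/seteqP; split => // x [/= xN /B_gt0 x0]; apply: xN.
    by rewrite in_itv/= andbT ltW.
  by rewrite /= in_itv/= andbT => /(_ (lexx _)).
- move=> n; have mX : measurable_fun (`[0%R, +oo[%classic : set RB) (fun x : RB => (x ^+ n)%:E).
    by apply: measurable_funTS; apply/measurable_EFinP; exact: measurable_funX.
  have X0 (x : RB) : `[0%R, +oo[%classic x -> (0 <= (x ^+ n)%:E)%E.
    by rewrite /= in_itv/= andbT => x0; rewrite lee_fin exprn_ge0.
  rewrite ge0_integral_measure_add// -moment_f; congr (_ + _)%E; last first.
    rewrite ge0_integral_mscale// integral_dirac// diracE mem_set//= ?mul1e//.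
    by rewrite in_itv/= andbT.
  rewrite ge0_integral_density// FB (_ : _ `&` B = B); last first.
    by apply/setIidr => x /B_gt0 x0 /=; rewrite in_itv/= andbT ltW.
  transitivity (\int[leb]_(x in B) ((x ^+ n)%:E * f x + (x ^+ n * h x)%:E))%E.
    apply: eq_integral => x; rewrite inE => /B_gt0 x0.
    by rewrite muleDr ?EFinM// fin_num_adde_defl.
  rewrite integralD//; last by have [] := hn n.
  by have [_ ->] := hn n; rewrite adde0.
- move=> A mA AB; rewrite nuE mu1E not0 ?adde0.
    by rewrite (setIidl AB).
  by move=> /AB /B_gt0; rewrite ltxx.
Qed.

Lemma stieltjes_indeterminate_mixture :
  exists mu nu : {measure set RB -> \bar R},
    [/\ has_stieltjes_moments mu (fun n => D n `^ c),
        has_stieltjes_moments nu (fun n => D n `^ c) &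
        exists A : set RB, measurable A /\ mu A <> nu A].
Proof.
have [k k0 [dl dl0 fk]] := f_stretched.
pose a := c^-1; have a0 : 0 < a by rewrite invr_gt0.
have c2 : 2 < c by rewrite /c; have := b1; lra.
have a2 : a < 2^-1 by rewrite ltf_pV2 ?posrE.
have a1 : a <= 1 by rewrite (le_trans (ltW a2))// invf_le1// ler1n.
have api : 0 < a * pi < pi / 2.
  by rewrite mulr_gt0 ?pi_gt0//= mulrC ltr_pM2l ?pi_gt0.
have cosa : 0 < cos (a * pi).
  by case/andP: api => t0 t1; apply: cos_gt0_pihalf; rewrite t1 andbT; have := pi_gt0 R; lra.
have sina : 0 < sin (a * pi) by exact: sin_gt0_pihalf.
pose K := k / cos (a * pi); have K0 : 0 < K by rewrite divr_gt0.
pose h x := expR (- (K * x `^ a * cos (a * pi))) * sin (K * x `^ a * sin (a * pi)).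
have hn n : leb.-integrable B (fun x => (x ^+ n * (dl * h x))%:E) /\
    (\int[leb]_(x in B) (x ^+ n * (dl * h x))%:E = 0)%E.
  have ap : a * (n.+1%:R * c) = n.+1%:R by rewrite mulrCA mulVf ?mulr1// gt_eqF.
  have [ih h0] := stretched_sin_moment K0 a0 a1 ap a2.
  have -> : (fun x : R => (x ^+ n * (dl * h x))%:E) =
      (fun x : R => dl%:E * (x ^+ n * h x)%:E)%E.
    by apply/funext => x; rewrite -EFinM; congr EFin; ring.
  by split; [exact: integrableZl|rewrite integralZl// h0 mule0].
have fh x : 0 < x -> (0 <= f x + (dl * h x)%:E)%E.
  move=> x0; apply: (le_trans _ (leeD2r _ (fk x x0))).
  rewrite -EFinD lee_fin -mulrDr mulr_ge0 ?(ltW dl0)// /h -/a.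
  have -> : K * x `^ a * cos (a * pi) = k * x `^ a by rewrite /K; field; rewrite gt_eqF.
  by rewrite -[X in X + _]mulr1 -mulrDr mulr_ge0 ?expR_ge0.
have [mu [mu_m muA]] : exists mu : {measure set RB -> \bar R},
    has_stieltjes_moments mu (fun n => D n `^ c) /\
    forall A, measurable A -> A `<=` B -> mu A = (\int[leb]_(x in A) (f x + 0%:E))%E.
  apply: (perturbed_measure (h := fun=> 0)) => [n|x _]; last by rewrite adde0.
  have -> : (fun x : R => (x ^+ n * 0)%:E) = cst 0%E by apply/funext => x; rewrite mulr0.
  by split; [exact: integrable0|rewrite integral0].
have [nu [nu_m nuA]] := perturbed_measure hn fh.
exists mu, nu; split => //.
(* Up to [x0] the argument K x^a sin (a pi) of the sine stays below pi, so h > 0 on ]0, x0[ and the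
   two measures differ there. *)
pose x0 := (pi / (K * sin (a * pi))) `^ c.
have Ks : 0 < K * sin (a * pi) by rewrite mulr_gt0.
have x00 : 0 < x0 by rewrite powR_gt0// divr_gt0 ?pi_gt0.
pose A : set RB := `]0%R, x0[%classic.
have mA : measurable A by exact: measurable_itv.
have AB : A `<=` B by move=> x; rewrite /A /B/= !in_itv/= andbT => /andP[].
exists A; split => // munu.
have h_gt0 x : A x -> 0 < dl * h x.
  rewrite /A/= in_itv/= => /andP[x_gt0 xx0].
  rewrite mulr_gt0// mulr_gt0 ?expR_gt0// sin_gt0_pi//.
  rewrite mulrAC mulr_gt0 ?powR_gt0//= mulrC -ltr_pdivlMr//.
  have -> : pi / (K * sin (a * pi)) = x0 `^ a.
    by rewrite -powRrM mulfV ?gt_eqF// powRr1// divr_ge0 ?pi_ge0 ?(ltW Ks).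
  by rewrite gt0_ltr_powR ?nnegrE ?(ltW x_gt0) ?(ltW x00).
have i_f : leb.-integrable A f.
  apply: (integrableS mB) => //; have := integrable_f 0.
  by apply: eq_integrable => // x _; rewrite expr0 mul1e.
have ih : leb.-integrable A (fun x => (dl * h x)%:E).
  apply: (integrableS mB) => //; have [+ _] := hn 0%N.
  by apply: eq_integrable => // x _; rewrite expr0 mul1r.
have lebA : leb A != 0%E.
  have H : leb `]0%R, x0[%classic = x0%:E.
    by rewrite lebesgue_measure_itv/= lte_fin x00 oppr0 adde0.
  by rewrite [leb A]H gt_eqF.
have mh : measurable_fun A (fun x => dl * h x).
  by have /measurable_int/measurable_EFinP := ih.
have /eqP := @integral_neq0 _ _ R leb A (fun x => dl * h x) mA mh h_gt0 lebA; apply.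
have fin := integrable_fin_num mA i_f.
have muAf : mu A = (\int[leb]_(x in A) f x)%E.
  by rewrite muA//; apply: eq_integral => x _; rewrite adde0.
have finh := integrable_fin_num mA ih.
have : (\int[leb]_(x in A) f x = \int[leb]_(x in A) f x + \int[leb]_(x in A) (dl * h x)%:E)%E.
  by rewrite -[LHS]muAf munu nuA// integralD.
rewrite -(fineK fin) -(fineK finh) -EFinD => -[H]; congr EFin.
by apply: (addrI (fine (\int[leb]_(x in A) f x))); rewrite addr0 -H.
Qed.

End mixture.

Unset Implicit Arguments.

Theorem theorem3 (R : realType) :
  let D : nat -> R := fun n => (odd_double_fact n)%:R in
  infinitely_divisible D /\
  (forall c : R, 0 < c ->
     (stieltjes_determinate (fun n => D n `^ c) <-> c <= 2)) /\
  (forall c : R, 0 < c -> c <= 2 ->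
     forall mu : {measure set (measurableTypeR R) -> \bar R},
       has_stieltjes_moments mu (fun n => D n `^ c) ->
       forall s : R, 0 <= s ->
         (\int[mu]_(t in `[0%R, +oo[) (t `^ s)%:E)%E
           = ((2 `^ s / Num.sqrt pi * Gamma (s + 1 / 2)) `^ c)%:E /\
         (2 `^ s / Num.sqrt pi * Gamma (s + 1 / 2)) `^ c
           = (1 / 2 `^ s * (Gamma (2 * s + 1) / Gamma (s + 1))) `^ c).
Proof.
move=> D.
have D1 n : 1 <= D n by rewrite ler1n odd_double_fact_gt0.
have momentE (c : R) (mu : {measure set (measurableTypeR R) -> \bar R}) :
    mu (~` `[0%R, +oo[) = 0%E ->
    (forall s, 0 <= s -> (\int[mu]_(x in `[0%R, +oo[) (x `^ s)%:E =
      (odd_double_Gamma s `^ c)%:E)%E) ->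
    has_stieltjes_moments mu (fun n => D n `^ c).
  move=> mu0 muM; split => // n; rewrite /D -odd_double_Gamma_nat -muM//.
  apply: eq_integral => x; rewrite inE/= in_itv/= andbT => x0.
  by rewrite powR_mulrn.
have moment (c : R) : 0 < c -> stieltjes_moment_seq (fun n => D n `^ c).
  move=> c0; have [mu [mu0 muM]] := mellin_measure (mellin_odd_double_Gamma c0).
  by exists mu; exact: momentE.
have unique (c : R) : 0 < c -> c <= 2 ->
    forall mu nu : {measure set (measurableTypeR R) -> \bar R},
    has_stieltjes_moments mu (fun n => D n `^ c) ->
    has_stieltjes_moments nu (fun n => D n `^ c) ->
    forall A : set (measurableTypeR R), measurable A -> mu A = nu A.
  move=> c0 c2 mu nu mu_m nu_m A mA.
  apply: (stieltjes_moments_unique mu_m nu_m _ mA) => n.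
  (* D n >= 1 makes c = 2 the worst case. *)
  apply: (@le_trans _ _ (D n `^ 2)); first by rewrite ler_powR.
  by rewrite powR_mulrn// /D -natrX ler_nat odd_double_fact_sqr_le.
split; [split => //|split].
- have := moment 1 ltr01; rewrite (_ : (fun n => D n `^ 1) = D)//.
  by apply/funext => n; rewrite powRr1.
- move=> c c0; split => [[_ det]|c2]; last by split; [exact: moment|exact: unique].
  rewrite leNgt; apply/negP => c2.
  have b1 : 1 < c - 1 by lra.
  have [d [T [P [Y YM]]]] := mellin_odd_double_Gamma (lt_trans ltr01 b1).
  have := stieltjes_indeterminate_mixture b1 YM; rewrite subrK.
  by move=> [mu [nu [mu_m nu_m [A [mA]]]]]; apply; exact: det.
move=> c c0 c2 mu mu_m s s0; rewrite div1r.
(* The measure constructed has the required Mellin transform by design, and by uniqueness [mu]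
   coincides with it. *)
have [nu [nu0 nuM]] := mellin_measure (mellin_odd_double_Gamma c0).
split.
  rewrite -[RHS]nuM//; apply: eq_measure_integral => A mA _.
  by apply: (unique c c0 c2) => //; exact: momentE.
congr (_ `^ c).
have sp0 : Num.sqrt pi != 0 :> R by rewrite gt_eqF// sqrtr_gt0 pi_gt0.
have G1 : Gamma (s + 1) != 0 by rewrite gt_eqF// Gamma_gt0// ltr_wpDl.
have s2 : 2 `^ s != 0 :> R by rewrite gt_eqF// powR_gt0.
have -> : Gamma (2 * s + 1) = 2 `^ (2 * s) * Gamma (s + 2^-1) * Gamma (s + 1) / Num.sqrt pi.
  by rewrite -(Gamma_duplication s0) mulfK.
rewrite (_ : 2 * s = s + s); last by ring.
by rewrite powR_gt0D//; field; rewrite sp0 G1 s2.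
Qed.
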